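(* Let $a\in\mathbb Z$, let $q=e^{\sqrt{-1}\lambda}$, $i=\sqrt{-1}$, and let $F^{(a)}_{g;k;\mu}$ and $\tilde F^{(a)}_{g;k;\mu}$ ($g,k\ge 0$, $\mu$ a nonempty partition) be the open Gromov-Witten invariants of the resolved conifold with one outer brane and framing $a$, for the two possible positions of the brane, i.e. the coefficients defined by $$\hat Z^{(a)}(\lambda;t;\mathbf p)=\exp\sum_{\mu\in\mathcal P^+}\sum_{g=0}^\infty\sum_{k=0}^\infty F^{(a)}_{g;k;\mu}\,\lambda^{2g-2+l(\mu)}e^{-kt}p_\mu(\mathbf x),$$ $$\hat{\tilde Z}^{(a)}(\lambda;t;\mathbf p)=\exp\sum_{\mu\in\mathcal P^+}\sum_{g=0}^\infty\sum_{k=0}^\infty \tilde F^{(a)}_{g;k;\mu}\,\lambda^{2g-2+l(\mu)}e^{-kt}p_\mu(\mathbf x),$$ where $\hat Z^{(a)}$ and $\hat{\tilde Z}^{(a)}$ are the normalized topological vertex amplitudes defined in the context. Then $$\exp\sum_{\mu\in\mathcal P^+}\sum_{g=0}^\infty\sum_{k=0}^\infty i^{l(\mu)}F^{(a)}_{g;k;\mu}\,\lambda^{2g-2+l(\mu)}e^{(|\mu|/2-k)t}p_\mu(\mathbf x)=\sum_\mu s_\mu(\mathbf x)\,q^{(a+1)\kappa_\mu/2}\cdot\dim_q R_{\mu^t},$$ $$\exp\sum_{\mu\in\mathcal P^+}\sum_{g=0}^\infty\sum_{k=0}^\infty i^{l(\mu)}\tilde F^{(a)}_{g;k;\mu}\,\lambda^{2g-2+l(\mu)}e^{(|\mu|/2-k)t}p_\mu(\mathbf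 x)=\sum_\mu s_\mu(\mathbf x)\,q^{a\kappa_\mu/2}\cdot\dim_q R_{\mu},$$ where the sums on the right run over all partitions $\mu$ (including the empty one).
   Context: Partitions: $\mathcal P^+$ is the set of nonempty partitions; for $\mu=(\mu_1\ge\dots\ge\mu_l>0)$ put $l(\mu)=l$, $|\mu|=\sum_i\mu_i$, $z_\mu=\prod_i\mu_i\cdot|\mathrm{Aut}(\mu)|$ (where $|\mathrm{Aut}(\mu)|=\prod_j m_j!$, $m_j$ the multiplicity of $j$ in $\mu$), $\kappa_\mu=\sum_i\mu_i(\mu_i-2i+1)$, and let $\mu^t$ be the transposed partition. $\chi_\mu(\eta)$ is the value of the irreducible character of the symmetric group $S_{|\mu|}$ indexed by $\mu$ on the conjugacy class of cycle type $\eta$ (zero if $|\eta|\neq|\mu|$). $(0)$ denotes the empty partition. Symmetric functions: $\mathbf x=(x_1,x_2,\dots)$; $p_n(\mathbf x)$ are the power sums, $p_\mu=\prod_i p_{\mu_i}$, and $s_\mu$ are the Schur functions, $s_\mu=\sum_\eta \frac{\chi_\mu(\eta)}{z_\eta}p_\eta$. Quantum numbers: $q=e^{\sqrt{-1}\lambda}$, $q^{1/2}=e^{\sqrt{-1}\lambda/2}$, $[n]=q^{n/2}-q^{-n/2}$, $[n]_{e^t}=e^{nt_0}$-type notation is defined precisely by $[n]_{e^t}=e^{t/2}q^{n/2}-e^{-t/2}q^{-n/2}$. Quantum dimension: $$\dim_q R_\mu=\prod_{1\le i<j\le l(\mu)}\frac{[\mu_i-\mu_j+j-i]}{[j-i]}\cdot\prod_{i=1}^{l(\mu)}\frac{\prod_{j=1}^{\mu_i}[j-i]_{e^t}}{\prod_{j=1}^{\mu_i}[j-i+l(\mu)]},$$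 with $\dim_qR_{(0)}=1$. Topological vertex: let $q^{\mu+\rho}$ denote the specialization of symmetric functions at the variables $q^{\mu_i-i+1/2}$, $i\ge 1$ (with $\mu_i=0$ for $i>l(\mu)$), meaning $p_n(q^{\mu+\rho})=\frac1{[n]}+\sum_{i=1}^{l(\mu)}\left(q^{n(\mu_i-i+1/2)}-q^{n(-i+1/2)}\right)$; in particular $p_n(q^\rho)=1/[n]$. Set $W_{\mu\nu}(q)=s_\mu(q^\rho)s_\nu(q^{\mu+\rho})$ and $W_\mu(q)=W_{\mu,(0)}(q)=s_\mu(q^\rho)$. With $c^{\lambda}_{\alpha\beta}$ the Littlewood-Richardson coefficients, the topological vertex is $$C_{\mu^1,\mu^2,\mu^3}(q)=q^{(\kappa_{\mu^2}+\kappa_{\mu^3})/2}\sum_{\eta,\alpha,\beta}c^{\mu^1}_{\eta\alpha}\,c^{(\mu^3)^t}_{\eta\beta}\,\frac{W_{(\mu^2)^t\alpha}(q)\,W_{\mu^2\beta}(q)}{W_{\mu^2}(q)}.$$ In particular $C_{(0),\mu,\nu^t}(q)=q^{-\kappa_\nu/2}W_{\mu\nu}(q)$, $C_{\mu,(0),\nu^t}(q)=q^{\kappa_\mu/2}W_{\mu^t\nu^t}(q)$, $C_{\nu,(0),(0)}(q)=W_\nu(q)$. Open string amplitudes of the resolved conifold with one outer brane and framing $a$ (two positions of the brane), with $Q=-e^{-t}$, as formal power series in $Q$ and the $p_n(\mathbf x)$: $$Z^{(a)}(\lambda;t;\mathbf p)=\sum_{\mu,\nu,\eta}q^{a\kappa_\mu/2}C_{(0),\mu,\nu^t}(q)\,Q^{|\nu|}\,C_{\nu,(0),(0)}(q)\,\frac{\chi_\mu(\eta)}{z_\eta\sqrt{-1}^{\,l(\eta)}}p_\eta(\mathbf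 x),$$ $$\tilde Z^{(a)}(\lambda;t;\mathbf p)=\sum_{\mu,\nu,\eta}q^{a\kappa_\mu/2}C_{\mu,(0),\nu^t}(q)\,Q^{|\nu|}\,C_{\nu,(0),(0)}(q)\,\frac{\chi_\mu(\eta)}{z_\eta\sqrt{-1}^{\,l(\eta)}}p_\eta(\mathbf x).$$ Normalized amplitudes: $\hat Z^{(a)}=Z^{(a)}/Z^{(a)}|_{\mathbf p=\mathbf 0}$ and $\hat{\tilde Z}^{(a)}=\tilde Z^{(a)}/\tilde Z^{(a)}|_{\mathbf p=\mathbf 0}$, where $\mathbf p=\mathbf 0$ means all $p_n(\mathbf x)=0$. Coefficients depending on $q$ are expanded as Laurent series in $\lambda$ at $\lambda=0$. *)

(* Defs.v *)
From HB Require Import structures.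
From mathcomp Require Import all_boot all_order all_algebra all_fingroup.
From mathcomp Require Import all_solvable all_field all_character.
From mathcomp Require Import boolp classical_sets cardinality fsbigop.

Set Implicit Arguments.
Unset Strict Implicit.
Unset Printing Implicit Defensive.

Import Order.TTheory GRing.Theory Num.Theory.
Local Open Scope ring_scope.

(* A record rather than [nat -> R], whose ring structure would be pointwise. *)
Record fps (R : Type) := Fps { fcoef : nat -> R }.

Notation "{ 'fps' R }" := (fps R) (format "{ 'fps'  R }") : type_scope.

HB.instance Definition _ (R : Type) := gen_eqMixin {fps R}.
HB.instance Definition _ (R : Type) := gen_choiceMixin {fps R}.

Section FpsRing.
Variable R : comNzRingType.
Implicit Types f g h : {fps R}.

Lemma fpsP f g : (forall n, fcoef f n = fcoef g n) <-> f = g.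
Proof.
split=> [|-> //]; case: f g => f [g] /= fg; congr Fps; exact/funext.
Qed.

Definition fps0 : {fps R} := Fps (fun=> 0).
Definition fps_opp f : {fps R} := Fps (fun n => - fcoef f n).
Definition fps_add f g : {fps R} := Fps (fun n => fcoef f n + fcoef g n).
Definition fps_const (c : R) : {fps R} := Fps (fun n => if n == 0%N then c else 0).
Definition fps_mul f g : {fps R} :=
  Fps (fun n => \sum_(i < n.+1) fcoef f i * fcoef g (n - i)).

Let addA : associative fps_add.
Proof. by move=> f g h; apply/fpsP => n /=; rewrite addrA. Qed.
Let addC : commutative fps_add.
Proof. by move=> f g; apply/fpsP => n /=; rewrite addrC. Qed.
Let add0 : left_id fps0 fps_add.
Proof. by move=> f; apply/fpsP => n /=; rewrite add0r. Qed.
Let addN : left_inverse fps0 fps_opp fps_add.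
Proof. by move=> f; apply/fpsP => n /=; rewrite addNr. Qed.

HB.instance Definition _ :=
  GRing.isZmodule.Build {fps R} addA addC add0 addN.

Definition fps_trunc n f : {poly R} := \poly_(i < n.+1) fcoef f i.

Lemma fps_mul_trunc n k f g : (k <= n)%N ->
  fcoef (fps_mul f g) k = (fps_trunc n f * fps_trunc n g)`_k.
Proof.
move=> kn; rewrite coefM /=; apply: eq_bigr => i _.
by rewrite !coef_poly !ltnS (leq_trans _ kn) ?(leq_trans (leq_subr _ _) kn) // -ltnS.
Qed.

Let mulC : commutative fps_mul.
Proof. by move=> f g; apply/fpsP => n; rewrite !(fps_mul_trunc _ _ (leqnn n)) mulrC. Qed.

Let mulA : associative fps_mul.
Proof.
move=> f g h; apply/fpsP => n.
transitivity (fps_trunc n f * (fps_trunc n g * fps_trunc n h))`_n.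
  rewrite coefM /=; apply: eq_bigr => i _.
  by rewrite coef_poly ltn_ord -fps_mul_trunc ?leq_subr.
rewrite mulrA coefM /=; apply: eq_bigr => i _.
by rewrite -fps_mul_trunc -1?ltnS // coef_poly ltnS leq_subr.
Qed.

Let mul1 : left_id (fps_const 1) fps_mul.
Proof.
move=> f; apply/fpsP => n /=; rewrite big_ord_recl /= mul1r subn0 big1 ?addr0 //.
by move=> i _; rewrite mul0r.
Qed.

Let mulDl : left_distributive fps_mul fps_add.
Proof.
move=> f g h; apply/fpsP => n /=; rewrite -big_split /=.
by apply: eq_bigr => i _; rewrite mulrDl.
Qed.

Let one_neq0 : fps_const 1 != fps0.
Proof.
by apply/eqP => /fpsP/(_ 0%N)/= /eqP; rewrite oner_eq0.
Qed.

HB.instance Definition _ :=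
  GRing.Zmodule_isComNzRing.Build {fps R} mulA mulC mul1 mulDl one_neq0.

Definition fps_unit : {pred {fps R}} := fun f => `[< exists g, g * f = 1 >].
Definition fps_inv f : {fps R} :=
  if pselect (exists g, g * f = 1) is left ex then projT1 (cid ex) else f.

Let mulVx : {in fps_unit, left_inverse 1 fps_inv *%R}.
Proof.
move=> f /asboolP exf; rewrite /fps_inv; case: pselect => // ex.
exact: (projT2 (cid ex)).
Qed.
Let unitPl f g : g * f = 1 -> fps_unit f.
Proof. by move=> gf; apply/asboolP; exists g. Qed.
Let invr_out : {in [predC fps_unit], fps_inv =1 id}.
Proof.
by move=> f /asboolPn nf; rewrite /fps_inv; case: pselect.
Qed.

HB.instance Definition _ :=
  GRing.ComNzRing_hasMulInverse.Build {fps R} mulVx unitPl invr_out.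

Lemma fcoef0 n : fcoef (0 : {fps R}) n = 0. Proof. by []. Qed.

Lemma fcoefM f g n :
  fcoef (f * g) n = \sum_(i < n.+1) fcoef f i * fcoef g (n - i).
Proof. by []. Qed.

Definition fpsX : {fps R} := Fps (fun n => (n == 1%N)%:R).

End FpsRing.

Section FpsDomain.
Variable R : idomainType.

Lemma fps_order (f : {fps R}) : f != 0 ->
  exists m, fcoef f m != 0 /\ forall i, (i < m)%N -> fcoef f i = 0.
Proof.
move=> f0; have ex : exists m, fcoef f m != 0.
  apply: contrapT => nex; move/eqP: f0; apply; apply/fpsP => n.
  by rewrite fcoef0; apply: contrapT => fn; apply: nex; exists n; apply/eqP.
case: (ex_minnP ex) => m fm mmin; exists m; split=> // i im.
by apply/eqP/negPn; apply/negP => /mmin; rewrite leqNgt im.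
Qed.

Let integral : GRing.integral_domain_axiom {fps R}.
Proof.
move=> f g fg; rewrite -[_ || _]negbK negb_or; apply/negP.
case/andP=> /fps_order[m [fm mmin]] /fps_order[n [gn nmin]].
move/fpsP/(_ (m + n)%N): fg; rewrite fcoef0 fcoefM.
have lt_m : (m < (m + n).+1)%N by rewrite ltnS leq_addr.
rewrite (bigD1 (Ordinal lt_m)) //= addKn big1 ?addr0.
  by move/eqP; rewrite mulf_eq0 (negPf fm) (negPf gn).
move=> i /eqP ni; have [im|mi|im] := ltngtP i m.
- by rewrite mmin ?mul0r.
- by rewrite [fcoef g _]nmin ?mulr0 // ltn_subLR ?ltn_add2r // -ltnS.
- by case: ni; apply: val_inj.
Qed.

HB.instance Definition _ :=
  GRing.ComUnitRing_isIntegral.Build {fps R} integral.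

End FpsDomain.

(* [\sum_(i \in setT)] is the sum over the support when the latter is finite
   (and 0 otherwise), so this is the sum of a family of power series each of
   whose coefficients involves finitely many members of the family. *)
Definition fps_sum (R : comNzRingType) (I : choiceType) (f : I -> {fps R}) :
    {fps R} :=
  Fps (fun n => \sum_(i \in (classical_sets.setT : set I)) fcoef (f i) n).

(* The field of Laurent series R((X)) is the fraction field of R[[X]]. *)
Notation laurent R := {fraction {fps R}}.

Definition lconst (R : fieldType) (c : R) : laurent R :=
  FracField.tofrac (fps_const c).
Definition lX (R : fieldType) : laurent R := FracField.tofrac (fpsX R).

Definition is_part (s : seq nat) := sorted geq s && (0%N \notin s).

Record part := Part { pval :> seq nat; _ : is_part pval }.
HB.instance Definition _ := [isSub for pval].
HB.instance Definition _ := [Countable of part by <:].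

Implicit Types mu nu eta : part.

Definition psize mu : nat := sumn mu.

Definition part0 : part := Part (isT : is_part [::]).

Lemma is_part_conj mu :
  is_part (mkseq (fun j => count (ltn j) mu) (head 0%N mu)).
Proof.
apply/andP; split.
  apply: (homo_sorted (e := ltn) (e' := geq)); last exact: iota_ltn_sorted.
  move=> i j ij /=.
  by apply: sub_count => k /=; apply: ltn_trans.
apply/mapP => -[j]; rewrite mem_iota add0n /=.
by case: mu => -[|k s] //= _ ->.
Qed.
Definition conj_part mu : part := Part (is_part_conj mu).

Lemma is_part_cat mu nu : is_part (sort geq (mu ++ nu)).
Proof.
rewrite /is_part sort_sorted; last by move=> m n; apply: leq_total.
rewrite mem_sort mem_cat negb_or.
by case: mu nu => [s /= /andP[_ ->]] [t /= /andP[_ ->]].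
Qed.
(* the multiset union, so that p_mu * p_nu = p_(cat_part mu nu) *)
Definition cat_part mu nu : part := Part (is_part_cat mu nu).

Definition zpart mu : nat :=
  ((\prod_(m <- (mu : seq nat)) m) *
   \prod_(j < (head 0 mu).+1) (count_mem (j : nat) mu)`!)%N.

(* i is 0-based here, whence i.+1, as in p_mu_rho and qdim below. *)
Definition kappa mu : int :=
  \sum_(i < size mu) (nth 0%N mu i)%:Z * ((nth 0%N mu i)%:Z - 2 * i.+1%:Z + 1).

Section SymChar.
Variable n : nat.
Local Notation G := [set: 'S_n]%G.

Fact sign_cfun_subproof : is_class_fun <<G>>%g [ffun s : 'S_n => (-1) ^+ s].
Proof.
apply: intro_class_fun => [s t _ _ | s]; last by rewrite mem_gen ?inE.
by rewrite odd_permJ.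
Qed.
Definition sign_cfun : 'CF(G) := Cfun 0 sign_cfun_subproof.

Definition young_set (mu : part) : {set 'S_n} :=
  [set s : 'S_n |
    [forall i : 'I_n, reshape_index mu (s i) == reshape_index mu i]].

Fact young_group_set mu : group_set (young_set mu).
Proof.
apply/group_setP; split.
  by rewrite inE; apply/forallP => i; rewrite perm1.
move=> s t; rewrite !inE => /forallP hs /forallP ht; apply/forallP => i.
by rewrite permM (eqP (ht _)).
Qed.
(* S_(mu_1) x ... x S_(mu_l), acting on consecutive blocks of 'I_n *)
Definition young mu : {group 'S_n} := Group (young_group_set mu).

(* The irreducible character indexed by mu is the unique common constituent of
   the trivial character induced from S_mu and of the sign character induced
   from S_(mu^t). *)
Definition irr_part (mu : part) : Iirr G :=
  odflt 0 [pick i | (i \in irr_constt ('Ind[G] (1 : 'CF(young mu))))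
    && (i \in irr_constt ('Ind[G] ('Res[young (conj_part mu)] sign_cfun)))].

Definition cycle_type (s : 'S_n) : seq nat :=
  sort geq [seq #|(c : {set 'I_n})| | c <- enum (porbits s)].

End SymChar.

(* The characters of symmetric groups are integer valued, so that taking the
   floor only changes their type. *)
Definition chi mu eta : int :=
  if [pick s : 'S_(psize mu) | cycle_type s == eta] is Some s
  then Num.floor ('chi_(irr_part (psize mu) mu) s) else 0.

(* f : pseries R stands for \sum_mu f(mu) p_mu. *)
Definition pseries (R : Type) := part -> R.

Definition pmul (R : comNzRingType) (f g : pseries R) : pseries R := fun mu =>
  \sum_(ab \in ([set ab | cat_part ab.1 ab.2 = mu]%classic : set (part * part)))
    f ab.1 * g ab.2.

Definition ppow (R : comNzRingType) (f : pseries R) (n : nat) : pseries R :=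
  iter n (pmul f) (fun mu => (mu == part0)%:R).

(* For f without constant term, ppow f n vanishes at mu as soon as
   n > size mu. *)
Definition pexp (R : fieldType) (f : pseries R) : pseries R := fun mu =>
  \sum_(n \in (classical_sets.setT : set nat)) ppow f n mu / n`!%:R.

(* The sum of a family of series each of whose coefficients involves finitely
   many members of the family. *)
Definition psum (R : fieldType) (f : part -> pseries R) : pseries R := fun eta =>
  \sum_(mu \in (classical_sets.setT : set part)) f mu eta.

Definition schur (R : fieldType) mu : pseries R := fun eta =>
  (chi mu eta)%:~R / (zpart eta)%:R.

Definition hall (R : fieldType) (f g : pseries R) : R :=
  \sum_(eta \in (classical_sets.setT : set part)) (zpart eta)%:R * f eta * g eta.

(* c^lam_(mu, nu), the coefficient of s_lam in s_mu s_nu: the Schur functions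
   are orthonormal for the Hall inner product. *)
Definition LR (R : fieldType) (lam mu nu : part) : R :=
  hall (pmul (schur R mu) (schur R nu)) (schur R lam).

(* s_mu at p_n := p n *)
Definition schur_at (R : fieldType) (p : nat -> R) mu : R :=
  \sum_(eta \in (classical_sets.setT : set part))
    schur R mu eta * \prod_(n <- (eta : seq nat)) p n.

Section Vertex.
Variable C : numClosedFieldType.

(* Laurent series in lambda *)
Local Notation K := (laurent C).

Definition lambda : K := lX C.

(* q^(1/2) = exp (i lambda / 2); all the exponents of q below are integers or
   half-integers, and q^(m/2) is qh ^ m. *)
Definition qh : K :=
  FracField.tofrac (Fps (fun n => ('i / 2) ^+ n / n`!%:R) : {fps C}).

Definition qnum (n : int) : K := qh ^ n - qh ^ (- n).

(* p_n(q^rho) *)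
Definition p_rho (n : nat) : K := (qnum n%:Z)^-1.

(* p_n(q^(mu + rho)) *)
Definition p_mu_rho mu (n : nat) : K :=
  (qnum n%:Z)^-1 +
  \sum_(i < size mu)
    (qh ^ (n%:Z * (2 * (nth 0%N mu i)%:Z - 2 * i.+1%:Z + 1))
     - qh ^ (n%:Z * (- (2 * i.+1%:Z) + 1))).

Definition W2 mu nu : K := schur_at p_rho mu * schur_at (p_mu_rho mu) nu.
Definition W1 mu : K := W2 mu part0.

Definition vertex (mu1 mu2 mu3 : part) : K :=
  qh ^ (kappa mu2 + kappa mu3) *
  \sum_(x \in (classical_sets.setT : set (part * part * part)))
    let: (eta, alpha, beta) := x in
    LR K mu1 eta alpha * LR K (conj_part mu3) eta beta *
    (W2 (conj_part mu2) alpha * W2 mu2 beta / W1 mu2).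

(* Laurent series in u = exp (- t / 2) over K *)
Local Notation L := (laurent K).

Definition u : L := lX K.

(* Q = - exp (- t) = - u^2 *)
Definition Q : {fps K} := - fpsX K ^+ 2.

(* \sum_(mu, nu, eta) q^(a kappa_mu / 2) V mu nu^t Q^|nu| C_(nu, (0), (0))(q)
     chi_mu(eta) / (z_eta i^l(eta)) p_eta *)
Definition amplitude (V : part -> part -> K) (a : int) : pseries L := fun eta =>
  FracField.tofrac (fps_sum (fun x : part * part => let: (mu, nu) := x in
    fps_const (qh ^ (a * kappa mu) * V mu (conj_part nu)) * Q ^+ psize nu *
    fps_const (vertex nu part0 part0 *
      ((chi mu eta)%:~R / ((zpart eta)%:R * lconst 'i ^+ size eta))))).

Definition Z (a : int) : pseries L :=
  amplitude (fun mu nu => vertex part0 mu nu) a.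
Definition Z' (a : int) : pseries L :=
  amplitude (fun mu nu => vertex mu part0 nu) a.

Definition normalized (f : pseries L) : pseries L := fun eta => f eta / f part0.

(* the sum over mu in P^+ of
   \sum_(g, k >= 0) F g k mu lambda^(2g - 2 + l(mu)) e^(- k t) p_mu *)
Definition free_energy (F : nat -> nat -> part -> C) : pseries L := fun mu =>
  if mu == part0 then 0 else
  FracField.tofrac (fps_sum (fun k : nat =>
    fps_const (lambda ^ ((size mu)%:Z - 2) *
      FracField.tofrac (fps_sum (fun g : nat =>
        fps_const (F g k mu) * fpsX C ^+ (2 * g)))) *
    fpsX K ^+ (2 * k))).

(* [n]_(e^t) = e^(t/2) q^(n/2) - e^(-t/2) q^(-n/2) *)
Definition qnum_t (n : int) : L :=
  u^-1 * lconst (qh ^ n) - u * lconst (qh ^ (- n)).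

Definition qdim mu : L :=
  let m i := (nth 0%N mu i)%:Z in
  let l := size mu in
  lconst (\prod_(i < l) \prod_(j < l | (i < j)%N)
    (qnum (m i - m j + j%:Z - i%:Z) / qnum (j%:Z - i%:Z))) *
  \prod_(i < l)
    ((\prod_(1 <= j < (nth 0%N mu i).+1) qnum_t (j%:Z - i.+1%:Z)) /
     (\prod_(1 <= j < (nth 0%N mu i).+1) lconst (qnum (j%:Z - i.+1%:Z + l%:Z)))).

End Vertex.

Arguments u {C}.
Arguments qh {C}.
Arguments qdim {C}.

(* Main.v *)
(** Everything is reduced to symmetric function identities. Counting the words
    fixed by a permutation identifies the permutation characters of the Young
    subgroups with the complete symmetric functions; the Jacobi-Trudi determinant
    of these characters is a virtual character of norm 1 and therefore is the
    irreducible character [irr_part]. This gives the orthogonality relations of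
    [chi], the Cauchy identities, the effect of transposition, and the bialternant
    formula for [schur_at].

    In both amplitudes the sum over [nu] is then a (skew) Cauchy sum. It equals the
    closed amplitude [exp (- sum_m [m]^-2 e^(- m t) / m)] times [s_mu] at
    [p_m = (1 - e^(- m t)) / [m]] (for [Z], at the transpose of [mu] and with an
    extra framing factor), so that normalization leaves only the latter. At
    [e^t = q^N] this is a principal specialization, a quotient of Vandermonde
    determinants; as both sides are polynomials in [e^(- t)], it is the
    quantum dimension for all [t], up to [e^(- |mu| t / 2)]. Rescaling each
    [p_mu] by [i^l(mu) e^(|mu| t / 2)], which commutes with the exponential,
    gives the two formulas. *)

From HB Require Import structures.
From mathcomp Require Import all_boot all_order all_algebra all_fingroup.
From mathcomp Require Import all_field all_character.
From mathcomp Require Import mpoly.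
From mathcomp Require boolp.
From mathcomp Require Import ring lra zify.
Require Import Defs.

Set Implicit Arguments.
Unset Strict Implicit.
Unset Printing Implicit Defensive.

Import Order.TTheory GRing.Theory Num.Theory.
Local Open Scope ring_scope.

(** * Words and the Burnside lemma *)

(** The obstacle is that [chi] is known only through [irr_part], a [pick] among common constituents.
    Three facts have to be recovered from it: that the [pick] succeeds and separates partitions,
    which rests on 0-1 matrices with prescribed margins; that partitions label both the classes and
    the irreducible characters, which follows by counting; and that a class has [n! / z_eta]
    elements, which is read off from the expansion of [h_n] in power sums. Moreover [e^t] is formal,
    so that [e^t = q^N] has no meaning in the target field. The comparison is made for polynomials
    in a variable [X] standing for [e^(- t)], over the Laurent series in [lambda], where the powers
    of [q] give infinitely many points because [q] is not a root of unity. Half-integral powers of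
    [e^t] make [u = e^(- t / 2)] the outer variable, and the polynomials reach it through
    [X = u^2]. *)

Section Words.
Variables (n : nat) (A : finType).
Implicit Types (s t : 'S_n) (w : {ffun 'I_n -> A}) (M : {ffun A -> 'I_n.+1}).

Definition content w : {ffun A -> 'I_n.+1} := [ffun a => inord #|[set i | w i == a]|].

Definition wperm w s : {ffun 'I_n -> A} := [ffun i => w (s i)].

Lemma contentE w a : content w a = #|[set i | w i == a]| :> nat.
Proof. by rewrite ffunE inordK // ltnS -[X in (_ <= X)%N]card_ord max_card. Qed.

Lemma content_wperm w s : content (wperm w s) = content w.
Proof.
apply/ffunP => a; apply: val_inj; rewrite /= !contentE.
rewrite -(card_preimset [set i | w i == a] (@perm_inj _ s)).
by apply: eq_card => i; rewrite !inE ffunE.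
Qed.

Lemma wpermM w s t : wperm w (s * t)%g = wperm (wperm w t) s.
Proof. by apply/ffunP => i; rewrite !ffunE permM. Qed.

Lemma wperm1 w : wperm w 1%g = w.
Proof. by apply/ffunP => i; rewrite ffunE perm1. Qed.

Lemma wpermK s : cancel (wperm^~ s) (wperm^~ s^-1%g).
Proof. by move=> w; rewrite -wpermM mulVg wperm1. Qed.

Lemma sum_content w : (\sum_a content w a = n)%N.
Proof.
rewrite -[RHS]card_ord -sum1_card (partition_big w predT) //=.
apply: eq_bigr => a _; rewrite contentE -sum1_card.
by apply: eq_bigl => i; rewrite inE.
Qed.

Lemma content_trans w w' : content w = content w' -> exists s, w' = wperm w s.
Proof.
move=> ww'; have : perm_eq [tuple w' i | i < n] [tuple w i | i < n].
  apply/allP => a _ /=; rewrite !count_map; apply/eqP.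
  have := congr1 (fun M : {ffun A -> 'I_n.+1} => M a : nat) ww'.
  rewrite /= !contentE !cardE /enum_mem !size_filter => /esym e.
  apply: etrans (etrans e _); rewrite ?count_predI; apply: eq_count => i.
    by rewrite /= inE.
  by rewrite /= inE.
case/tuple_permP => s es; exists s; apply/ffunP => i; rewrite ffunE.
have := congr1 (fun x => tnth x i) (val_inj es : _ = [tuple _ | _ < n]).
by rewrite !tnth_mktuple.
Qed.

Lemma content_exists M : (\sum_a M a = n)%N -> exists w, content w = M.
Proof.
move=> sM; pose S := flatten [seq nseq (M a) a | a <- enum A].
have sS : size S = n.
  rewrite size_flatten /shape -map_comp sumnE big_map -[RHS]sM big_enum /=.
  by apply: eq_bigr => a _; rewrite size_nseq.
have /eqP tS := sS; exists [ffun i => tnth (Tuple tS) i].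
apply/ffunP => a; apply: val_inj; rewrite /= contentE.
transitivity (count (pred1 a) (tval (Tuple tS))).
  rewrite -[in RHS](map_tnth_enum (Tuple tS)) count_map.
  by rewrite cardE /enum_mem size_filter count_filter; apply: eq_count => i; rewrite /= inE ffunE andbT.
rewrite /= count_flatten -map_comp sumnE big_map big_enum /= (bigD1 a) //=.
rewrite count_nseq /= eqxx mul1n big1 ?addn0 // => b /negPf nab.
by rewrite count_nseq /= nab.
Qed.

Lemma card_orbit_fiber w0 w : content w = content w0 ->
  #|[set s | wperm w0 s == w]| = #|[set s | wperm w s == w]|.
Proof.
move/esym/content_trans => [t ->].
rewrite -(card_preimset [set s | wperm w0 s == _] (@mulIg _ t)).
by apply: eq_card => s; rewrite !inE wpermM.
Qed.

Lemma sum_content_stab M : (\sum_a M a = n)%N ->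
  (\sum_(w | content w == M) #|[set s | wperm w s == w]| = n`!)%N.
Proof.
move=> /content_exists[w0 <-].
transitivity (\sum_(w | content w == content w0) #|[set s | wperm w0 s == w]|)%N.
  by apply: eq_bigr => w /eqP/card_orbit_fiber ->.
rewrite -card_Sn -sum1_card (partition_big (wperm w0) (fun w => content w == content w0)) /=.
  by apply: eq_bigr => w _; rewrite -sum1_card; apply: eq_bigl => s; rewrite !inE.
by move=> s _; rewrite content_wperm.
Qed.

(** The words of one content form a single orbit of [S_n], along which the orders of the stabilizers
    add up to [n!]; a weight that depends only on the content contributes [n!] times its value once
    per orbit. *)
Lemma burnside_content (R : pzSemiRingType) (g : {ffun A -> 'I_n.+1} -> R) :
  \sum_s \sum_(w | wperm w s == w) g (content w) =
  n`!%:R * \sum_(M : {ffun A -> 'I_n.+1} | (\sum_a M a == n)%N) g M.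
Proof.
rewrite (exchange_big_dep predT) //=.
rewrite (partition_big content (fun M : {ffun A -> 'I_n.+1} => \sum_a M a == n)%N) /=; last first.
  by move=> w _; rewrite sum_content.
rewrite mulr_sumr; apply: eq_bigr => M /eqP sM; rewrite -(sum_content_stab sM) natr_sum mulr_suml.
apply: eq_bigr => w /eqP <-; rewrite -sum1_card natr_sum mulr_suml.
by apply: eq_big => [s|s _]; rewrite ?inE ?mul1r.
Qed.

(** A word with a repeated letter is fixed by a transposition, under which the signs in its
    stabilizer cancel in pairs. What survives are the words with distinct letters, whose stabilizer
    is trivial. *)
Lemma sign_burnside_content (R : pzRingType) (g : {ffun A -> 'I_n.+1} -> R) :
  \sum_s \sum_(w | wperm w s == w) (-1) ^+ s * g (content w) =
  n`!%:R * \sum_(M : {ffun A -> 'I_n.+1} | (\sum_a M a == n)%N && [forall a, M a <= 1]%N) g M.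
Proof.
rewrite (exchange_big_dep predT) //= (bigID (fun w => injectiveb w)) /= addrC big1 ?add0r.
  rewrite (partition_big content (fun M : {ffun A -> 'I_n.+1} =>
    (\sum_a M a == n)%N && [forall a, M a <= 1]%N)) /=; last first.
    move=> w /injectiveP iw; rewrite sum_content eqxx /=; apply/forallP => a.
    rewrite contentE; apply/card_le1_eqP => i j; rewrite !inE => /eqP <- /eqP/iw //.
  rewrite mulr_sumr; apply: eq_bigr => M /andP[/eqP sM /forallP M1].
  rewrite -(sum_content_stab sM) natr_sum mulr_suml.
  have injw w : content w = M -> injective w.
    move=> cw i j wij; have := M1 (w i); rewrite -cw contentE => /card_le1_eqP; apply;
      by rewrite inE ?wij.
  apply: eq_big => [w|w /andP[_ /eqP cw]].
    by case: eqP => [/injw/injectiveP -> |_]; rewrite ?andbF.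
  rewrite cw (_ : [set s | _] = [set 1%g]) ?cards1; last first.
    apply/setP => s; rewrite !inE; apply/eqP/eqP => [ws|->]; last exact: wperm1.
    apply/permP => i; rewrite perm1; apply: (injw w cw).
    by rewrite -[in RHS]ws ffunE.
  rewrite mul1r (big_pred1 1%g) ?odd_perm1 ?mul1r // => s /=.
  apply/eqP/eqP => [ws|->]; last exact: wperm1.
  apply/permP => i; rewrite perm1; apply: (injw w cw).
  by rewrite -[in RHS]ws ffunE.
move=> w /injectivePn[i [j nij wij]]; rewrite -mulr_suml.
suff -> : \sum_(s | wperm w s == w) (-1) ^+ s = 0 :> R by rewrite mul0r.
pose t := tperm i j.
have wt : wperm w t = w.
  by apply/ffunP => k; rewrite ffunE /t; case: tpermP => [->|->|].
rewrite (bigID (@odd_perm _)) /= addrC (reindex_inj (mulgI t)) /=.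
have ws s : (wperm w (t * s) == w) = (wperm w s == w).
  rewrite wpermM -[in RHS](can_eq (wpermK t)) wt //.
have ot s : odd_perm (t * s)%g = ~~ s by rewrite odd_mul_tperm nij.
rewrite (eq_big (fun s => (wperm w s == w) && odd_perm s) (fun s => - (-1) ^+ s)).
- by rewrite sumrN addNr.
- by move=> s; rewrite ws ot negbK.
- by move=> s _; rewrite ot signrN.
Qed.
End Words.

Section PairWords.
Variables (n : nat) (A B : finType).
Implicit Types (s : 'S_n) (u : {ffun 'I_n -> A * B}).

Definition wfst u : {ffun 'I_n -> A} := [ffun i => (u i).1].
Definition wsnd u : {ffun 'I_n -> B} := [ffun i => (u i).2].

Lemma content_wfst u a : content (wfst u) a = (\sum_b content u (a, b))%N :> nat.
Proof.
rewrite contentE -sum1_card (partition_big (fun i => (u i).2) predT) //=.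
apply: eq_bigr => b _; rewrite contentE -sum1_card; apply: eq_bigl => i.
by rewrite !inE ffunE; case: (u i).
Qed.

Lemma content_wsnd u b : content (wsnd u) b = (\sum_a content u (a, b))%N :> nat.
Proof.
rewrite contentE -sum1_card (partition_big (fun i => (u i).1) predT) //=.
apply: eq_bigr => a _; rewrite contentE -sum1_card; apply: eq_bigl => i.
by rewrite !inE ffunE; case: (u i) => a' b'; rewrite andbC.
Qed.

(** Pairs of fixed words are fixed words over the product alphabet, and the contents of the
    components are the margins of a matrix. Both a product of two permutation characters and a
    permutation character against a power sum are evaluated in this way. *)
Lemma sum_pair_words (V : nmodType) s (g : {ffun 'I_n -> A} -> {ffun 'I_n -> B} -> V) :
  \sum_(w | wperm w s == w) \sum_(w' | wperm w' s == w') g w w' =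
  \sum_(u | wperm u s == u) g (wfst u) (wsnd u).
Proof.
rewrite pair_big_dep /=.
pose h u := (wfst u, wsnd u).
pose k (p : {ffun 'I_n -> A} * {ffun 'I_n -> B}) : {ffun 'I_n -> A * B} :=
  [ffun i => (p.1 i, p.2 i)].
rewrite (reindex_onto h k) /=; last first.
  by move=> [w w'] _; congr pair; apply/ffunP => i; rewrite !ffunE.
apply: eq_bigl => u; have -> : k (h u) = u.
  by apply/ffunP => i; rewrite !ffunE; case: (u i).
rewrite eqxx andbT; apply/andP/eqP => [[/eqP /ffunP e1 /eqP /ffunP e2]|e].
  apply/ffunP => i; have := e1 i; have := e2 i; rewrite !ffunE.
  by case: (u i) => a b; case: (u (s i)) => a' b' /= -> ->.
by split; apply/eqP/ffunP => i; rewrite !ffunE -[in RHS]e ffunE.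
Qed.

End PairWords.

(** * Power sums, complete symmetric functions and fixed words *)

Section PowerSums.
Variables (n : nat) (B : finType) (b0 : B) (R : comNzRingType) (x : B -> R).
Implicit Types (s : 'S_n).

Definition perm_psum s : R := \prod_(c in porbits s) \sum_b x b ^+ #|c|.

(** A word is fixed by [s] exactly when it is constant on the cycles, so the expanded product of
    power sums runs over the fixed words. The letter [b0] is the default value off the cycles that
    [big_distr_big] asks for. *)
Lemma perm_psumE s :
  perm_psum s = \sum_(w : {ffun 'I_n -> B} | wperm w s == w) \prod_i x (w i).
Proof.
rewrite /perm_psum (big_distr_big b0) /=.
pose h (g : {ffun {set 'I_n} -> B}) : {ffun 'I_n -> B} := [ffun i => g (porbit s i)].
pose k (w : {ffun 'I_n -> B}) : {ffun {set 'I_n} -> B} :=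
  [ffun c => if [pick i | porbit s i == c] is Some i then w i else b0].
have wfix w i j : wperm w s = w -> j \in porbit s i -> w j = w i.
  move=> /ffunP ws /porbitP[m ->] {j}; elim: m => [|m IH]; first by rewrite expg0 perm1.
  by rewrite expgSr permM -IH -[RHS]ws ffunE.
rewrite (reindex_onto h k) /=.
  apply: eq_big => [g|g _].
    apply/pfamilyP/andP => [[/subsetP gs _]|[_ /eqP <-]].
      split; apply/eqP/ffunP => z.
        by rewrite !ffunE -[in RHS](porbit_perm s 1) expg1.
      rewrite ffunE; case: pickP => [i /eqP <-|no]; first by rewrite ffunE.
      apply/esym/eqP; apply: contraT => /gs /imsetP[i _ zi].
      by have := no i; rewrite zi eqxx.
    split=> //; apply/subsetP => c; rewrite inE ffunE.
    case: pickP => [i /eqP <- _|]; first exact: imset_f.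
    by rewrite eqxx.
  rewrite (partition_big (porbit s) (fun c => c \in porbits s)) /=; last first.
    by move=> i _; exact: imset_f.
  apply: eq_bigr => c /imsetP[i _ ->].
  rewrite -prodr_const; apply: eq_big => [j|j jc].
    by rewrite eq_porbit_mem porbit_sym.
  by rewrite ffunE; move: jc; rewrite -eq_porbit_mem => /eqP ->.
move=> w /eqP ws; apply/ffunP => i; rewrite !ffunE.
case: pickP => [j|/(_ i)]; last by rewrite eqxx.
by rewrite eq_porbit_mem => /(wfix _ w i j ws).
Qed.

Lemma prod_content (w : {ffun 'I_n -> B}) :
  \prod_i x (w i) = \prod_b x b ^+ content w b.
Proof.
rewrite (partition_big w predT) //=; apply: eq_bigr => b _.
rewrite contentE -prodr_const; apply: eq_big => [i|i /eqP -> //].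
by rewrite inE.
Qed.

End PowerSums.

(* The content [a] of the words counted is given as a difference [b - c], which
   makes the count vanish when [c <= b] fails: this is the convention
   [h_k = 0] for [k < 0]. *)
Definition hcount n (A : finType) (b c : A -> nat) (s : 'S_n) : nat :=
  #|[set w : {ffun 'I_n -> A} |
     (wperm w s == w) && [forall a, content w a + c a == b a]%N]|.

(** The complete symmetric function [h_(b - c)] as long as [b <= n + c]; beyond that, bounding each
    exponent by [n] truncates it. *)
Definition hsum n (B : finType) (R : comNzRingType) (x : B -> R) (b c : nat) : R :=
  \sum_(M : {ffun B -> 'I_n.+1} | (\sum_i M i + c == b)%N) \prod_i x i ^+ M i.

Lemma hcountE n (A : finType) (b c : A -> nat) (s : 'S_n) (R : pzSemiRingType) :
  (hcount b c s)%:R = \sum_(w : {ffun 'I_n -> A} | wperm w s == w)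
    ([forall a, content w a + c a == b a]%N)%:R :> R.
Proof.
rewrite /hcount -sum1_card natr_sum [RHS](big_mkcond _) /= big_mkcond /=.
by apply: eq_bigr => w _; rewrite inE; case: eqP => //= _; case: ifP.
Qed.

Lemma natr_forall (A : finType) (R : comPzSemiRingType) (P : pred A) :
  [forall a, P a]%:R = \prod_a (P a)%:R :> R.
Proof.
case: forallP => [all_P|not_all]; first by rewrite big1 // => a _; rewrite all_P.
case: (pickP (fun a => ~~ P a)) => [a /negPf Pa|all_P]; first by rewrite (bigD1 a) //= Pa mul0r.
by case: not_all => a; apply/negPn; rewrite all_P.
Qed.

(** The Frobenius characteristic of a permutation character is a product of complete functions: the
    pair words are counted by matrices whose rows are constrained by the content and whose columns
    record the exponents of [x]. *)
Lemma hcount_psum n (A B : finType) (b0 : B) (R : comNzRingType) (x : B -> R)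
    (b c : A -> nat) : (\sum_a b a = n + \sum_a c a)%N ->
  \sum_(s : 'S_n) (hcount b c s)%:R * perm_psum x s =
  n`!%:R * \prod_a hsum n x (b a) (c a).
Proof.
move=> bc.
pose g (M : {ffun A * B -> 'I_n.+1}) : R :=
  \prod_a (((\sum_i M (a, i) + c a == b a)%N)%:R * \prod_i x i ^+ M (a, i)).
transitivity (\sum_(s : 'S_n) \sum_(u : {ffun 'I_n -> A * B} | wperm u s == u) g (content u)).
  apply: eq_bigr => s _; rewrite (perm_psumE b0) hcountE big_distrlr /= sum_pair_words.
  apply: eq_bigr => u _; rewrite /g big_split /=; congr (_ * _).
    rewrite natr_forall; apply: eq_bigr => a _; by rewrite content_wfst.
  rewrite prod_content exchange_big /=; apply: eq_bigr => i _.
  by rewrite content_wsnd expr_sum.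
rewrite burnside_content; congr (_ * _).
under [RHS]eq_bigr => a _ do rewrite /hsum big_mkcond /=.
rewrite (bigA_distr_bigA (fun a (M : {ffun B -> 'I_n.+1}) => if (\sum_i M i + c a == b a)%N then
   \prod_i x i ^+ M i else 0)) /=.
pose h (M : {ffun A * B -> 'I_n.+1}) := [ffun a => [ffun i => M (a, i)]].
pose k (M : {ffun A -> {ffun B -> 'I_n.+1}}) := [ffun p => M p.1 p.2].
rewrite [RHS](reindex_onto h k) /=; last first.
  by move=> M _; apply/ffunP => a; apply/ffunP => i; rewrite !ffunE.
rewrite big_mkcond [RHS]big_mkcond /=; apply: eq_bigr => M _.
have -> : k (h M) == M by apply/eqP/ffunP => -[a i]; rewrite !ffunE.
have -> : \prod_a (if (\sum_i h M a i + c a)%N == b a then \prod_i x i ^+ h M a i else 0) = g M.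
  apply: eq_bigr => a _; rewrite !ffunE.
  under eq_bigr => i _ do rewrite ffunE.
  case: eqP => _; rewrite ?mul1r ?mul0r //; apply: eq_bigr => i _; by rewrite !ffunE.
(* A matrix whose total is not [n] violates one of the row conditions, since [bc] fixes their
   sum. *)
case: eqP => // nM; apply/esym; rewrite /g.
case: (pickP (fun a => (\sum_i M (a, i) + c a)%N != b a)) => [a /negPf na|all_a].
  by rewrite (bigD1 a) //= na !mul0r.
case: nM; apply/eqP; rewrite -(eqn_add2r (\sum_a c a)) -bc; apply/eqP.
rewrite (eq_bigr (fun p => M (p.1, p.2) : nat)); last by case.
rewrite -(pair_bigA _ (fun a i => M (a, i) : nat)) /= -big_split /=.
by apply: eq_bigr => a _; apply/eqP/negPn; rewrite all_a.
Qed.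

(** The sign keeps only the pair words with distinct letters, hence the matrices with entries 0 and
    1. *)
Lemma sign_hcount n (A B : finType) (b c : A -> nat) (b' c' : B -> nat) :
  \sum_(s : 'S_n) (-1) ^+ s * (hcount b c s)%:R * (hcount b' c' s)%:R =
  n`!%:R * #|[set M : {ffun A * B -> 'I_n.+1} |
     [&& (\sum_p M p == n)%N, [forall p, M p <= 1]%N,
         [forall a, \sum_i M (a, i) + c a == b a]%N &
         [forall i, \sum_a M (a, i) + c' i == b' i]%N]]|%:R :> int.
Proof.
pose g (M : {ffun A * B -> 'I_n.+1}) : int :=
  ([forall a, \sum_i M (a, i) + c a == b a]%N &&
         [forall i, \sum_a M (a, i) + c' i == b' i]%N)%:R.
transitivity (\sum_(s : 'S_n) \sum_(u : {ffun 'I_n -> A * B} | wperm u s == u)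
   (-1) ^+ s * g (content u)).
  apply: eq_bigr => s _; rewrite !hcountE -mulrA big_distrlr /= sum_pair_words mulr_sumr.
  apply: eq_bigr => u _; congr (_ * _); rewrite -natrM mulnb; congr (_ && _)%:R.
    by apply: eq_forallb => a; rewrite content_wfst.
  by apply: eq_forallb => a; rewrite content_wsnd.
rewrite sign_burnside_content; congr (_ * _).
rewrite -sum1_card natr_sum big_mkcond [RHS]big_mkcond /=; apply: eq_bigr => M _.
by rewrite inE /g; case: eqP => //= _; case: (boolP [forall p, M p <= 1]%N) => //= _; case: ifP.
Qed.

(** * Permutation characters of Young subgroups *)

Section PermutationCharacters.
Variables (n : nat) (A : finType).
Implicit Types (s t : 'S_n) (w : {ffun 'I_n -> A}) (b c : A -> nat).
Local Notation G := [set: 'S_n]%G.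

Fact wstab_group_set w : group_set [set s | wperm w s == w].
Proof.
apply/group_setP; split=> [|s t]; first by rewrite inE wperm1.
by rewrite !inE wpermM => /eqP ws /eqP ->; rewrite ws.
Qed.
Definition wstab w : {group 'S_n} := Group (wstab_group_set w).

Lemma card_wstab_coset w0 w : content w = content w0 ->
  #|[set s | wperm w0 s == w]| = #|wstab w0|.
Proof.
move/esym/content_trans => [t ->].
rewrite -(card_preimset [set s | wperm w0 s == _] (@mulgI _ t)).
by apply: eq_card => s; rewrite !inE wpermM (can_eq (wpermK t)).
Qed.

Lemma Ind_wstab w0 s : 'Ind[G] (1 : 'CF(wstab w0)) s =
  #|[set w | (wperm w s == w) && (content w == content w0)]|%:R.
Proof.
rewrite cfIndE ?subsetT //; apply: (canLR (mulKf (neq0CG _))).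
transitivity (\sum_(t : 'S_n) (wperm (wperm w0 t) s == wperm w0 t)%:R : algC).
  apply: eq_big => [t|t _]; first by rewrite inE.
  rewrite cfun1E /= inE conjgE !wpermM; congr (nat_of_bool _)%:R.
  by rewrite -{2}[w0](wpermK t) (can_eq (wpermK t^-1)).
rewrite (partition_big (wperm w0) (fun w => content w == content w0)) /=; last first.
  by move=> t _; rewrite content_wperm.
rewrite -[X in _ = _ * X%:R]sum1_card natr_sum mulr_sumr big_mkcond [RHS]big_mkcond /=.
apply: eq_bigr => w _; rewrite inE; case: (content w =P _) => [cw|]; last by rewrite andbF.
rewrite andbT (eq_bigr (fun=> (wperm w s == w)%:R)); last by move=> t /eqP ->.
rewrite sumr_const -(card_wstab_coset cw).
rewrite (_ : #|[set _ | _]| = #|[pred t | wperm w0 t == w]|); last first.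
  by apply: eq_card => t; rewrite !inE.
by case: (wperm w s == w); rewrite ?mulr1 // mul0rn.
Qed.

Lemma hcountJ b c s t : hcount b c (s ^ t)%g = hcount b c s.
Proof.
rewrite /hcount -[RHS](card_preimset _ (can_inj (wpermK t))); apply: eq_card => w.
rewrite !inE content_wperm; congr (_ && _); rewrite conjgE !wpermM.
by rewrite -{2}[w](wpermK t) (can_eq (wpermK t^-1)).
Qed.

Fact hcount_cfun_subproof b c : is_class_fun <<G>>%g [ffun s : 'S_n => (hcount b c s)%:R].
Proof.
apply: intro_class_fun => [s t _ _ | s]; last by rewrite mem_gen ?inE.
by rewrite hcountJ.
Qed.
Definition hcfun b c : 'CF(G) := Cfun 0 (hcount_cfun_subproof b c).

Lemma hcfunE b c s : hcfun b c s = (hcount b c s)%:R.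
Proof. by rewrite cfunE. Qed.

Lemma hcfun_ind b c w : (forall a, content w a + c a = b a)%N ->
  hcfun b c = 'Ind[G] (1 : 'CF(wstab w)).
Proof.
move=> cw; apply/cfunP => s; rewrite hcfunE Ind_wstab; congr _%:R.
apply: eq_card => v; rewrite !inE; congr (_ && _).
apply/forallP/eqP => [cv|-> a]; last by rewrite cw.
apply/ffunP => a; apply/val_inj/eqP; rewrite -(eqn_add2r (c a)) cw; exact: cv.
Qed.

Lemma hcfun_char b c : hcfun b c \is a character.
Proof.
case: (pickP (fun w : {ffun 'I_n -> A} => [forall a, content w a + c a == b a]%N)) => [w /forallP cw|no].
  by rewrite (hcfun_ind (w := w)) ?cfInd_char ?cfun1_char // => a; apply/eqP.
suff -> : hcfun b c = 0 by rewrite cfun0_char.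
apply/cfunP => s; rewrite hcfunE cfunE /hcount.
by rewrite (_ : [set w | _] = set0) ?cards0 //; apply/setP => w; rewrite !inE no andbF.
Qed.

End PermutationCharacters.

Lemma card_reshape_index sh j :
  #|[set i : 'I_(sumn sh) | reshape_index sh i == j]| = nth 0%N sh j.
Proof.
pose S := flatten (mkseq (fun j => nseq (nth 0%N sh j) j) (size sh)).
have shS : shape (mkseq (fun j => nseq (nth 0%N sh j) j) (size sh)) = sh.
  rewrite /shape /mkseq -map_comp -[RHS](mkseq_nth 0%N); apply: eq_map => i /=.
  by rewrite size_nseq.
have sS : size S = sumn sh by rewrite size_flatten shS.
have eS : S = [seq reshape_index sh i | i <- iota 0 (sumn sh)].
  apply: (@eq_from_nth _ 0%N); first by rewrite size_map size_iota.
  rewrite sS => i ish; rewrite (nth_map 0%N) ?size_iota // nth_iota // add0n.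
  rewrite nth_flatten shS; have rsh := reshape_indexP ish.
  by rewrite nth_mkseq // nth_nseq reshape_offsetP.
transitivity (count_mem j S).
  rewrite eS count_map -val_enum_ord count_map cardE /enum_mem size_filter count_filter.
  by apply: eq_count => i; rewrite /= inE andbT.
rewrite /S count_flatten /mkseq -map_comp; case: (ltnP j (size sh)) => jsh.
  rewrite (map_comp (count_mem j)) -/(mkseq _ _) sumnE !big_map.
  rewrite (bigD1_seq j) ?iota_uniq ?mem_iota //= count_nseq /= eqxx mul1n big1 ?addn0 //.
  by move=> i ij; rewrite count_nseq /= (negPf ij).
rewrite nth_default // sumnE !big_map big1_seq // => i /andP[_].
rewrite mem_iota add0n => ish; rewrite /= count_nseq /=.
by rewrite (ltn_eqF (leq_trans ish jsh)).
Qed.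

Section YoungCharacters.
Variables (N : nat) (mu : part).
Hypothesis muN : (size mu <= N.+1)%N.

Definition block_word : {ffun 'I_(psize mu) -> 'I_N.+1} :=
  [ffun i : 'I_(psize mu) => inord (reshape_index mu i)].

Lemma block_wordE i : block_word i = reshape_index mu i :> nat.
Proof. by rewrite ffunE inordK // (leq_trans (reshape_indexP (ltn_ord i))). Qed.

Lemma content_block_word j : content block_word j = nth 0%N mu j :> nat.
Proof.
rewrite contentE -(card_reshape_index mu j); apply: eq_card => i; rewrite !inE.
by rewrite -val_eqE /= block_wordE.
Qed.

Lemma young_wstab : young (psize mu) mu = wstab block_word.
Proof.
apply: val_inj; apply/setP => s; rewrite /= !inE; apply/forallP/eqP => [ms|ms i].
  by apply/ffunP => i; apply: val_inj; rewrite ffunE /= !block_wordE; apply/eqP.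
by rewrite -!block_wordE -[in X in _ == X]ms [X in _ == nat_of_ord X]ffunE.
Qed.

Lemma Ind_young : 'Ind[[set: 'S_(psize mu)]%G] (1 : 'CF(young (psize mu) mu)) =
  hcfun _ (fun j : 'I_N.+1 => nth 0%N mu j) (fun=> 0%N).
Proof.
by rewrite young_wstab; apply/esym/hcfun_ind => j; rewrite content_block_word addn0.
Qed.

End YoungCharacters.

(** * Diagrams of partitions and transposition *)

Lemma part_sorted (mu : part) : sorted geq mu.
Proof. by case: mu => s /= /andP[]. Qed.

Lemma part_neq0 (mu : part) i : (i < size mu)%N -> (0 < nth 0 mu i)%N.
Proof.
move=> imu; rewrite lt0n; apply: contraTneq (mem_nth 0%N imu) => ->.
by case: mu {imu} => s /= /andP[].
Qed.

Lemma part_inj (mu nu : part) : (forall i, nth 0%N mu i = nth 0%N nu i) -> mu = nu.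
Proof.
have size_le (p q : part) : (forall i, nth 0%N p i = nth 0%N q i) -> (size p <= size q)%N.
  move=> e; rewrite leqNgt; apply/negP => /part_neq0.
  by rewrite e nth_default.
move=> e; apply/val_inj/(@eq_from_nth _ 0%N) => [|i _]; last exact: e.
by apply/eqP; rewrite eqn_leq !size_le.
Qed.

Lemma part_geq (mu : part) i j : (i <= j)%N -> (nth 0 mu j <= nth 0 mu i)%N.
Proof.
move=> ij; case: (ltnP j (size mu)) => [jmu|/(nth_default 0%N) -> //].
apply: (sorted_leq_nth _ _ 0%N (part_sorted mu)) => //; rewrite ?inE //.
- by move=> a b c /= ba cb; exact: leq_trans cb ba.
- by move=> a /=; exact: leqnn.
- exact: leq_ltn_trans ij jmu.
Qed.

Lemma nth_conj_part (mu : part) j : nth 0%N (conj_part mu) j = count (ltn j) mu.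
Proof.
rewrite /conj_part /=; case: (ltnP j (head 0%N mu)) => hj; first by rewrite nth_mkseq.
rewrite nth_default ?size_mkseq //; apply/esym/eqP; rewrite -leqn0 leqNgt -has_count.
apply/hasPn => k /(nthP 0%N)[i _ <-]; rewrite -leqNgt (leq_trans (part_geq mu (leq0n i))) // nth0.
Qed.

(** Both sides say that a cell lies in the diagram of [mu]. Involutivity, the size of the transpose
    and the margins of the diagram all come from this equivalence. *)
Lemma conj_part_lt (mu : part) i j :
  (i < nth 0 (conj_part mu) j)%N = (j < nth 0 mu i)%N.
Proof.
rewrite nth_conj_part; have := part_sorted mu; elim: (mu : seq nat) i => [|m s IH] i /=.
  by rewrite nth_nil.
move=> ps; have jm : (j < m)%N = false -> count (ltn j) s = 0%N.
  move=> /negbT; rewrite -leqNgt => mj; apply/eqP; rewrite -leqn0 leqNgt -has_count.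
  apply/hasPn => k; have /allP := order_path_min (fun a b c (ba : geq b a) (cb : geq a c) => leq_trans cb ba) ps.
  by move=> /[apply] /= km; rewrite -leqNgt (leq_trans km).
case: i => [|i] /=; first by case: (ltnP j m) => [_|mj]; rewrite ?add1n // jm // ltnNge mj.
rewrite -IH ?(path_sorted ps) //; case: (ltnP j m) => [//|mj].
by rewrite jm // ltnNge mj.
Qed.

Lemma conj_partK : involutive conj_part.
Proof.
move=> mu; apply: part_inj => i; apply/eqP; rewrite eqn_leq.
have e j : (j < nth 0 (conj_part (conj_part mu)) i)%N = (j < nth 0 mu i)%N.
  by rewrite !conj_part_lt.
by apply/andP; split; rewrite leqNgt; [rewrite e ltnn | rewrite -e ltnn].
Qed.

Lemma sum_nth_part (s : seq nat) N : (size s <= N)%N -> (\sum_(i < N) nth 0%N s i = sumn s)%N.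
Proof.
elim: s N => [|m s IH] N /=; first by move=> _; rewrite big1 // => i _; rewrite nth_nil.
by case: N => [//|N] sN; rewrite big_ord_recl /= -(IH N).
Qed.

Lemma psizeE (mu : part) N : (size mu <= N)%N -> psize mu = (\sum_(i < N) nth 0 mu i)%N.
Proof. by move=> /sum_nth_part. Qed.

Lemma size_part (mu : part) : (size mu <= psize mu)%N.
Proof.
rewrite (psizeE (leqnn _)) -[X in (X <= _)%N]card_ord -sum1_card; apply: leq_sum => i _.
exact: part_neq0.
Qed.

Lemma nth_part_le (mu : part) i : (nth 0 mu i <= psize mu)%N.
Proof.
case: (ltnP i (size mu)) => [imu|/(nth_default 0%N) -> //].
by rewrite (psizeE (leqnn _)) (bigD1 (Ordinal imu)) //= leq_addr.
Qed.

Lemma sum_lt_ord N m : (m <= N)%N -> (\sum_(i < N) (i < m) = m)%N.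
Proof.
move=> mN; rewrite -[RHS]card_ord -sum1_card (big_ord_widen N (fun=> 1%N)) // [RHS]big_mkcond /=.
by apply: eq_bigr => i _; case: (i < m)%N.
Qed.

Lemma psize_conj (mu : part) : psize (conj_part mu) = psize mu.
Proof.
have cs : (size (conj_part mu) <= psize mu)%N.
  by rewrite size_mkseq -nth0 nth_part_le.
rewrite (psizeE cs) [RHS](psizeE (size_part mu)).
transitivity (\sum_(j < psize mu) \sum_(i < psize mu) (j < nth 0 mu i))%N.
  apply: eq_bigr => j _; under eq_bigr => i _ do rewrite -conj_part_lt.
  rewrite sum_lt_ord // nth_conj_part (leq_trans (count_size _ _)) //.
  exact: size_part.
rewrite exchange_big /=; apply: eq_bigr => i _.
by rewrite sum_lt_ord ?nth_part_le.
Qed.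

Lemma sum_ltn_ordE N m : (\sum_(i < N) (i < m) = minn N m)%N.
Proof.
case: (leqP m N) => [mN|Nm]; first by rewrite sum_lt_ord //; apply/esym/minn_idPr.
rewrite (eq_bigr (fun=> 1%N)) ?sum_nat_const ?card_ord ?muln1 //.
by move=> i _; rewrite (ltn_trans (ltn_ord i) Nm).
Qed.

Lemma sum_ltn_ord N m : (\sum_(i < N) (i < m) <= m)%N.
Proof. by rewrite sum_ltn_ordE geq_minr. Qed.

(** * The sign character and 0-1 matrices with prescribed margins *)

Section SignedPairing.
Variable n : nat.
Local Notation G := [set: 'S_n]%G.
Local Notation sgn := (sign_cfun n).

Lemma sign_cfunE (s : 'S_n) : sgn s = (-1) ^+ s.
Proof. by rewrite cfunE. Qed.

Lemma sign_lin_char : sgn \is a linear_char.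
Proof.
apply/andP; split; last by rewrite sign_cfunE odd_perm1.
pose f (s : 'S_n) : 'M[algC]_1 := ((-1) ^+ s)%:M.
have fP : mx_repr G f.
  split=> [|s t _ _]; first by rewrite /f odd_perm1.
  by rewrite /f odd_permM signr_addb scalar_mxM.
suff -> : sgn = cfRepr (MxRepresentation fP) by exact: cfRepr_char.
by apply/cfun_inP => s Gs; rewrite sign_cfunE cfunE Gs /= /f mxtrace_scalar mulr1n.
Qed.

Lemma cfdot_hcfun_sign (A B : finType) (b c : A -> nat) (b' c' : B -> nat) :
  '[hcfun n b c, sgn * hcfun n b' c'] = #|[set M : {ffun A * B -> 'I_n.+1} |
     [&& (\sum_p M p == n)%N, [forall p, M p <= 1]%N,
         [forall a, \sum_i M (a, i) + c a == b a]%N &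
         [forall i, \sum_a M (a, i) + c' i == b' i]%N]]|%:R.
Proof.
rewrite cfdotE; have := sign_hcount n b c b' c' => /(congr1 (intr : int -> algC)).
rewrite rmorphM /= rmorph_sum /= !rmorph_nat => e.
apply: (canLR (mulKf (neq0CG _))); rewrite cardsT card_Sn -e.
apply: eq_big => [s|s _]; first by rewrite inE.
rewrite !cfunE !rmorphM /= !rmorph_sign !rmorph_nat.
by rewrite mulrCA mulrA.
Qed.

(** In column [j] the first [k] rows hold at most the smaller of [k] and the [j]-th part of the
    transpose of [nu]; over all columns these bounds add up to at most the sum of the first [k]
    parts of [nu]. *)
Lemma zero_one_dominance N (b c : 'I_N.+1 -> nat) (nu : part) (M : {ffun 'I_N.+1 * 'I_n.+1 -> 'I_n.+1}) k :
  [forall p, M p <= 1]%N -> [forall a, \sum_i M (a, i) + c a == b a]%N ->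
  [forall i, \sum_a M (a, i) + 0 == nth 0 (conj_part nu) i]%N ->
  (\sum_(a < N.+1 | (a < k)%N) b a <=
   \sum_(i < k) nth 0 nu i + \sum_(a < N.+1 | (a < k)%N) c a)%N.
Proof.
move=> /forallP M1 /forallP Mb /forallP Mnu.
under eq_bigr => a _ do rewrite -(eqP (Mb a)).
rewrite big_split /= leq_add2r exchange_big /=.
have nuk : (\sum_(j < n.+1) \sum_(i < k) (i < nth 0 (conj_part nu) j) <= \sum_(i < k) nth 0 nu i)%N.
  rewrite exchange_big /=; apply: leq_sum => i _.
  under eq_bigr => j _ do rewrite conj_part_lt.
  exact: sum_ltn_ord.
apply: leq_trans nuk; apply: leq_sum => j _.
rewrite (sum_ltn_ordE k) leq_min; apply/andP; split.
  apply: leq_trans (sum_ltn_ord N.+1 k); rewrite big_mkcond /=; apply: leq_sum => a _.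
  by case: ifP => // _; exact: M1.
have := eqP (Mnu j); rewrite addn0 => <-.
by rewrite [X in (X <= _)%N]big_mkcond; apply: leq_sum => a _; case: ifP.
Qed.
End SignedPairing.

Lemma dominance_anti (mu nu : part) N : (size mu <= N)%N -> (size nu <= N)%N ->
  (forall k, (k <= N)%N -> \sum_(i < k) nth 0 mu i = \sum_(i < k) nth 0 nu i)%N -> mu = nu.
Proof.
move=> muN nuN e; apply: part_inj => i; case: (ltnP i N) => [iN|Ni].
  have := e i.+1 iN; rewrite !big_ord_recr /= e; last exact: ltnW.
  exact: addnI.
by rewrite !nth_default // (leq_trans _ Ni).
Qed.

(** * Dominance and the labelling of irreducible characters *)

Section IrrPart.
Variable n : nat.
Local Notation G := [set: 'S_n]%G.
Local Notation sgn := (sign_cfun n).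

Definition hpart N (mu : part) : 'CF(G) :=
  hcfun n (fun j : 'I_N.+1 => nth 0%N mu j) (fun=> 0%N).

Lemma Ind_young_hpart mu N : psize mu = n -> (size mu <= N.+1)%N ->
  'Ind[G] (1 : 'CF(young n mu)) = hpart N mu.
Proof. by move=> mun muN; rewrite /hpart; case: n / mun; exact: Ind_young. Qed.

Lemma Ind_Res_sign mu N : psize mu = n -> (size mu <= N.+1)%N ->
  'Ind[G] ('Res[young n mu] sgn) = sgn * hpart N mu.
Proof.
move=> mun muN; rewrite -[X in 'Ind[_] X]mul1r cfIndM ?subsetT //.
by rewrite (Ind_young_hpart mun muN) mulrC.
Qed.

Lemma size_part_n mu : psize mu = n -> (size mu <= n.+1)%N.
Proof. by move=> <-; rewrite leqW ?size_part. Qed.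

Lemma hpart_char N mu : hpart N mu \is a character.
Proof. exact: hcfun_char. Qed.

Lemma sign_hpart_char N mu : sgn * hpart N mu \is a character.
Proof. by rewrite rpredM ?hpart_char // lin_charW ?sign_lin_char. Qed.

Lemma cfdot_hcfun_dominance N (b c : 'I_N.+1 -> nat) nu k :
  '[hcfun n b c, sgn * hpart n (conj_part nu)] != 0 ->
  (\sum_(a < N.+1 | (a < k)%N) b a <=
   \sum_(i < k) nth 0 nu i + \sum_(a < N.+1 | (a < k)%N) c a)%N.
Proof.
rewrite cfdot_hcfun_sign pnatr_eq0 cards_eq0 => /set0Pn[M].
rewrite inE => /and4P[_ M1 Mb Mnu]; exact: (zero_one_dominance k M1 Mb Mnu).
Qed.

Lemma cfdot_hpart_conj N mu : psize mu = n -> (size mu <= N.+1)%N ->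
  '[hpart N mu, sgn * hpart n (conj_part mu)] != 0.
Proof.
move=> mun muN; rewrite cfdot_hcfun_sign pnatr_eq0 cards_eq0; apply/set0Pn.
(* The diagram of [mu] itself: its row sums are [mu] and its column sums the transpose. *)
pose M := [ffun p : 'I_N.+1 * 'I_n.+1 => inord (p.1 < nth 0 (conj_part mu) p.2)%N : 'I_n.+1].
have ME a i : M (a, i) = (a < nth 0 (conj_part mu) i)%N :> nat.
  rewrite ffunE inordK // ltnS; have [ai|//] := ltnP a (nth 0%N (conj_part mu) i).
  rewrite -[X in (_ <= X)%N]mun -psize_conj; apply: leq_trans (nth_part_le _ i).
  exact: leq_ltn_trans ai.
have rowM a : (\sum_i M (a, i) = nth 0 mu a)%N.
  under eq_bigr => i _ do rewrite ME conj_part_lt.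
  by rewrite sum_lt_ord // leqW // -mun nth_part_le.
exists M; rewrite inE; apply/and4P; split.
- rewrite (eq_bigr (fun p => M (p.1, p.2) : nat)); last by case.
  rewrite -(pair_bigA _ (fun a i => M (a, i) : nat)) /=.
  under eq_bigr => a _ do rewrite rowM.
  by rewrite -psizeE ?mun.
- by apply/forallP => -[a i]; rewrite ME; case: ltnP.
- by apply/forallP => a; rewrite rowM addn0.
- apply/forallP => i; under eq_bigr => a _ do rewrite ME.
  rewrite addn0 sum_lt_ord // nth_conj_part (leq_trans (count_size _ _)) //.
Qed.

Lemma irr_constt_common (gT : finGroupType) (H : {group gT}) (phi psi : 'CF(H)) :
  '[phi, psi] != 0 -> exists i, (i \in irr_constt phi) && (i \in irr_constt psi).
Proof.
rewrite cfdot_sum_irr; case: (pickP (fun i => (i \in irr_constt phi) && (i \in irr_constt psi))).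
  by move=> i ci _; exists i.
move=> no; rewrite big1 ?eqxx // => i _; have := no i; rewrite /= !irr_consttE.
by case: eqP => [->|_]; rewrite ?mul0r //= => /negbT/negPn/eqP ->; rewrite conjC0 mulr0.
Qed.

(** The diagram of [mu] makes the two characters non-orthogonal, so that the [pick] in [irr_part]
    succeeds and its default value does not appear. *)
Lemma irr_partP mu : psize mu = n ->
  irr_part n mu \in irr_constt (hpart n mu) /\
  irr_part n mu \in irr_constt (sgn * hpart n (conj_part mu)).
Proof.
move=> mun; have cmun : psize (conj_part mu) = n by rewrite psize_conj.
rewrite /irr_part; case: pickP => [i|].
  by rewrite (Ind_young_hpart mun (size_part_n mun)) (Ind_Res_sign cmun (size_part_n cmun)) => /andP.
have /irr_constt_common[i ci] := cfdot_hpart_conj mun (size_part_n mun).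
by move/(_ i); rewrite (Ind_young_hpart mun (size_part_n mun)) (Ind_Res_sign cmun (size_part_n cmun)) ci.
Qed.

(** [irr_part n nu] is also a constituent of the sign-twisted character of the transpose of [nu]. A
    constituent shared by two characters prevents orthogonality, and a 0-1 matrix exists. The shift
    [c] serves the terms of the Jacobi-Trudi determinant. *)
Lemma irr_part_dominance N (b c : 'I_N.+1 -> nat) nu k : psize nu = n ->
  irr_part n nu \in irr_constt (hcfun n b c) ->
  (\sum_(a < N.+1 | (a < k)%N) b a <=
   \sum_(i < k) nth 0 nu i + \sum_(a < N.+1 | (a < k)%N) c a)%N.
Proof.
move=> nun ci; apply: cfdot_hcfun_dominance; apply: contraTneq isT => e.
have [_ cj] := irr_partP nun.
have := constt_ortho_char (hcfun_char _ _ _) (sign_hpart_char _ _) ci cj e.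
by rewrite cfnorm_irr => /eqP; rewrite oner_eq0.
Qed.

Lemma irr_part_hpart_dominance mu nu k : psize mu = n -> psize nu = n -> (k <= n.+1)%N ->
  irr_part n nu \in irr_constt (hpart n mu) ->
  (\sum_(i < k) nth 0 mu i <= \sum_(i < k) nth 0 nu i)%N.
Proof.
move=> mun nun kn /(irr_part_dominance k nun).
by rewrite [X in (_ <= _ + X)%N -> _]big1 // addn0 -(big_ord_widen n.+1 (fun i => nth 0%N mu i)).
Qed.

Lemma irr_part_inj mu nu : psize mu = n -> psize nu = n ->
  irr_part n mu = irr_part n nu -> mu = nu.
Proof.
move=> mun nun e; apply: (@dominance_anti _ _ n.+1); rewrite ?size_part_n //.
move=> k kn; apply/eqP; rewrite eqn_leq; apply/andP; split.
  by apply: irr_part_hpart_dominance => //; rewrite -e; case: (irr_partP mun).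
by apply: irr_part_hpart_dominance => //; rewrite e; case: (irr_partP nun).
Qed.

End IrrPart.

(** * Cycle types *)

Section CycleType.
Variable n : nat.
Implicit Types s t g : 'S_n.

Lemma eq_iter_porbit s x k l :
  ((s ^+ k)%g x == (s ^+ l)%g x) = (k == l %[mod #|porbit s x|]).
Proof.
have xm m : (s ^+ m)%g x = iter (m %% #|porbit s x|) s x.
  rewrite {1}(divn_eq m #|porbit s x|) expgD permM mulnC expgM !permX; congr iter.
  elim: (m %/ _)%N => [//|d IH]; by rewrite iterS IH permX iter_porbit.
have p_gt0 : (0 < #|porbit s x|)%N by rewrite (cardD1 x) porbit_id.
rewrite !xm -(nth_traject s (ltn_pmod k p_gt0)) -(nth_traject s (ltn_pmod l p_gt0)).
by rewrite nth_uniq ?size_traject ?ltn_pmod // uniq_traject_porbit.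
Qed.

Lemma conj_of_porbits s t (phi : {set 'I_n} -> {set 'I_n}) :
  {in porbits s, forall c, phi c \in porbits t /\ #|phi c| = #|c|} ->
  {in porbits s &, injective phi} ->
  exists g, t = (s ^ g)%g.
Proof.
move=> phiP phi_inj.
case: (pickP (fun i : 'I_n => true)) => [i0 _|no]; last first.
  by exists 1%g; apply/permP => i; have := no i.
pose r (c : {set 'I_n}) := odflt i0 [pick i in c].
have rP u i : porbit u (r (porbit u i)) = porbit u i.
  rewrite /r; case: pickP => [j|/(_ i)]; last by rewrite porbit_id.
  by rewrite /= -eq_porbit_mem => /eqP.
have exk i : exists k, i == (s ^+ k)%g (r (porbit s i)).
  have : i \in porbit s (r (porbit s i)) by rewrite rP porbit_id.
  by case/porbitP => k ik; exists k; apply/eqP.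
pose k i := xchoose (exk i).
have kP i : (s ^+ k i)%g (r (porbit s i)) = i by apply/esym/eqP/(xchooseP (exk i)).
(* The [k]-th iterate from the representative of a cycle goes to the [k]-th iterate from the
   representative of its image; as the two cycles have the same length, the choice of [k] does not
   matter. *)
pose f i := (t ^+ k i)%g (r (phi (porbit s i))).
have ps i : porbit s i \in porbits s by exact: imset_f.
have phir i : porbit t (r (phi (porbit s i))) = phi (porbit s i).
  by have [/imsetP[j _ ->] _] := phiP _ (ps i); rewrite rP.
have cphi i : #|porbit t (r (phi (porbit s i)))| = #|porbit s (r (porbit s i))|.
  by rewrite phir rP; case: (phiP _ (ps i)).
have fs i : f (s i) = t (f i).
  have os : porbit s (s i) = porbit s i by rewrite (porbit_perm s 1).
  rewrite /f os -permM -expgSr; apply/eqP; rewrite eq_iter_porbit cphi -eq_iter_porbit.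
  by have := kP (s i); rewrite os => ->; rewrite expgSr permM kP.
have f_inj : injective f.
  move=> i j fij; have oij : porbit s i = porbit s j.
    apply: phi_inj; rewrite ?imset_f //.
    rewrite -phir -[RHS]phir; apply/eqP; rewrite eq_porbit_mem.
    have : f i \in porbit t (r (phi (porbit s i))) by rewrite mem_porbit.
    rewrite -!eq_porbit_mem => /eqP <-; rewrite fij eq_porbit_mem mem_porbit //.
  move: fij; rewrite /f oij => /eqP; rewrite eq_iter_porbit cphi -eq_iter_porbit.
  by have ki := kP i; rewrite oij in ki; rewrite ki kP => /eqP.
exists (perm f_inj); apply/permP => i; rewrite conjgE !permM.
by rewrite -{1}[i](permKV (perm f_inj)) !permE -fs.
Qed.

Lemma cycle_type_conj s t : cycle_type s = cycle_type t -> exists g, t = (s ^ g)%g.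
Proof.
rewrite /cycle_type !sort_map.
set Ls := sort _ _; set Lt := sort _ _ => e.
have sz : size Ls = size Lt by rewrite -(size_map (fun c : {set 'I_n} => #|c|) Ls) e size_map.
have memLs c : (c \in Ls) = (c \in porbits s) by rewrite mem_sort mem_enum.
have memLt c : (c \in Lt) = (c \in porbits t) by rewrite mem_sort mem_enum.
apply: (@conj_of_porbits s t (fun c => nth set0 Lt (index c Ls))) => [c|c d].
  rewrite -memLs -index_mem => cL; rewrite -memLt mem_nth ?sz -?sz //; split=> //.
  rewrite -(nth_map set0 0%N (fun c : {set 'I_n} => #|c|)) -?sz // -e (nth_map set0) //.
  by rewrite nth_index -?index_mem.
rewrite -!memLs -!index_mem => cL dL /eqP; rewrite nth_uniq -?sz // ?sort_uniq ?enum_uniq //.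
by move/eqP/(congr1 (nth set0 Ls)); rewrite !nth_index -?index_mem.
Qed.

End CycleType.

(** A partition of [n] has at most [n] parts, none larger than [n]; it is found among the tuples
    over ['I_n.+1] after removing the zeros and sorting. *)
Definition parts (n : nat) : seq part :=
  [seq mu <- undup (pmap insub [seq sort geq [seq val i | i <- (t : n.-tuple 'I_n.+1) & val i != 0%N]
                               | t <- enum {: n.-tuple 'I_n.+1}]) | psize mu == n].

Lemma parts_uniq n : uniq (parts n).
Proof. by rewrite filter_uniq ?undup_uniq. Qed.

Lemma mem_parts n mu : (mu \in parts n) = (psize mu == n).
Proof.
rewrite mem_filter; case: eqP => //= mun; rewrite mem_undup mem_pmap.
apply/mapP; exists (pval mu); last by rewrite valK.
have sz : size (map (@inord n) (mu ++ nseq (n - size mu) 0%N)) == n.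
  by rewrite size_map size_cat size_nseq subnKC // -[X in (_ <= X)%N]mun size_part.
apply/mapP; exists (Tuple sz); first by rewrite mem_enum.
rewrite /= map_cat filter_cat map_cat.
rewrite (_ : map val (filter _ (map _ (nseq _ _))) = [::]) ?cats0; last first.
  by rewrite map_nseq filter_nseq /= inordK.
rewrite filter_map -map_comp.
have inordE m : m \in (mu : seq nat) -> nat_of_ord (inord m : 'I_n.+1) = m.
  by move=> /(nthP 0%N)[i _ <-]; rewrite inordK // ltnS -mun nth_part_le.
rewrite (eq_in_filter (a2 := predT)) ?filter_predT; last first.
  move=> m mmu; rewrite /= inordE //; apply: contraTneq mmu => ->.
  by case: mu {mun sz inordE} => p /= /andP[].
rewrite (_ : map _ _ = pval mu); last first.
  by rewrite -[RHS]map_id; apply/eq_in_map => m mmu /=; rewrite inordE.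
rewrite sorted_sort ?part_sorted //.
by move=> a b c /= ba cb; exact: leq_trans cb ba.
Qed.

Section CyclePart.
Variable n : nat.
Implicit Types s t : 'S_n.

Lemma is_part_cycle_type s : is_part (cycle_type s).
Proof.
apply/andP; split; first by apply: sort_sorted => a b; exact: leq_total.
rewrite mem_sort; apply/mapP => -[c]; rewrite mem_enum => /imsetP[i _ ->] /esym/eqP.
by rewrite cards_eq0 => /eqP p0; have := porbit_id s i; rewrite p0 inE.
Qed.
Definition cycle_part s : part := Part (is_part_cycle_type s).

Lemma perm_cycle_part s :
  perm_eq (cycle_part s) [seq #|(c : {set 'I_n})| | c <- enum (porbits s)].
Proof. by rewrite perm_sort. Qed.

Lemma size_cycle_part s : size (cycle_part s) = #|porbits s|.
Proof. by rewrite (perm_size (perm_cycle_part s)) size_map -cardE. Qed.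

Lemma psize_cycle_part s : psize (cycle_part s) = n.
Proof.
rewrite /psize (perm_sumn (perm_cycle_part s)) sumnE big_map big_enum /=.
rewrite -[RHS]card_ord -sum1_card (partition_big (porbit s) (fun c => c \in porbits s)) /=; last first.
  by move=> i _; exact: imset_f.
apply: eq_bigr => c /imsetP[i _ ->]; rewrite -sum1_card; apply: eq_bigl => j.
by rewrite eq_porbit_mem.
Qed.

Lemma odd_perm_cycle_part s : odd_perm s = odd (n - size (cycle_part s)).
Proof.
by rewrite oddB -?[X in (_ <= X)%N](psize_cycle_part s) ?size_part // size_cycle_part /odd_perm card_ord.
Qed.

Lemma prod_porbits (R : comPzSemiRingType) (F : nat -> R) s :
  \prod_(c in porbits s) F #|c| = \prod_(m <- (cycle_part s : seq nat)) F m.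
Proof. by rewrite (perm_big _ (perm_cycle_part s)) big_map big_enum. Qed.

Local Notation G := [set: 'S_n]%G.

Lemma uniq_cycle_part_classes : uniq (map (fun c => cycle_part (repr c)) (enum (classes G))).
Proof.
rewrite map_inj_in_uniq ?enum_uniq // => c d; rewrite !mem_enum.
move=> /repr_classesP[_ ec] /repr_classesP[_ ed] /(congr1 pval) /cycle_type_conj [g e].
by rewrite ec ed; apply/esym/class_eqP; rewrite e memJ_class ?inE.
Qed.

(** [irr_part] injects the partitions into the irreducible characters, cycle types inject the
    classes into the partitions, and there are as many classes as irreducible characters. Both
    injections are therefore onto. *)
Lemma size_parts : size (parts n) = Nirr G.
Proof.
apply/eqP; rewrite eqn_leq; apply/andP; split.
  have u : uniq (map (irr_part n) (parts n)).
    rewrite map_inj_in_uniq ?parts_uniq // => mu nu; rewrite !mem_parts => /eqP mun /eqP nun.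
    exact: irr_part_inj.
  by rewrite -(size_map (irr_part n)) -[X in (_ <= X)%N]card_ord -(card_uniqP u) max_card.
rewrite NirrE cardE -(size_map (fun c => cycle_part (repr c))).
apply: uniq_leq_size; last by move=> _ /mapP[c _ ->]; rewrite mem_parts psize_cycle_part.
exact: uniq_cycle_part_classes.
Qed.

Lemma irr_part_surj i : exists2 mu, psize mu = n & irr_part n mu = i.
Proof.
have u : uniq (map (irr_part n) (parts n)).
  rewrite map_inj_in_uniq ?parts_uniq // => mu nu; rewrite !mem_parts => /eqP mun /eqP nun.
  exact: irr_part_inj.
have : i \in map (irr_part n) (parts n).
  have sub : {subset map (irr_part n) (parts n) <= enum {: Iirr G}} by move=> j _; rewrite mem_enum.
  have le : (size (enum {: Iirr G}) <= size (map (irr_part n) (parts n)))%N.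
    by rewrite -cardE card_ord size_map size_parts.
  by have [_ ->] := uniq_min_size u sub le; rewrite mem_enum.
by case/mapP => mu; rewrite mem_parts => /eqP mun ->; exists mu.
Qed.

Lemma cycle_part_surj mu : psize mu = n -> exists s, cycle_part s = mu.
Proof.
move=> mun; have u := uniq_cycle_part_classes.
have : mu \in map (fun c => cycle_part (repr c)) (enum (classes G)).
  have sub : {subset map (fun c => cycle_part (repr c)) (enum (classes G)) <= parts n}.
    by move=> _ /mapP[c _ ->]; rewrite mem_parts psize_cycle_part.
  have le : (size (parts n) <= size (map (fun c => cycle_part (repr c)) (enum (classes G))))%N.
    by rewrite size_map -cardE -NirrE size_parts.
  by have [_ ->] := uniq_min_size u sub le; rewrite mem_parts mun.
by case/mapP => c _ ->; exists (repr c).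
Qed.

Lemma cycle_part_conj s t : cycle_part s = cycle_part t -> exists g, t = (s ^ g)%g.
Proof. by move/(congr1 pval); exact: cycle_type_conj. Qed.

End CyclePart.

(** * The Jacobi-Trudi formula *)

Section CompleteSums.
Variable R : comNzRingType.
Implicit Types (y : R) (f g : {fps R}).

Definition fgeo y : {fps R} := Fps (fun m => y ^+ m).
Definition flin y : {fps R} := Fps (fun m => if m == 0%N then 1 else if m == 1%N then - y else 0).

Lemma fcoef_flin0 y f : fcoef (flin y * f) 0 = fcoef f 0.
Proof. by rewrite fcoefM big_ord1 /= mul1r. Qed.

Lemma fcoef_flinS y f m : fcoef (flin y * f) m.+1 = fcoef f m.+1 - y * fcoef f m.
Proof.
rewrite fcoefM !big_ord_recl /= mul1r subn0 /bump /= subn1 /= mulNr big1 ?addr0 // => i _.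
by rewrite mul0r.
Qed.

Lemma flin_fgeo y : flin y * fgeo y = 1.
Proof.
apply/fpsP => -[|m]; first by rewrite fcoef_flin0.
by rewrite fcoef_flinS /= exprS subrr.
Qed.

Lemma fcoef_prod_flin (I : Type) (s : seq I) (x : I -> R) m : (size s < m)%N ->
  fcoef (\prod_(l <- s) flin (x l)) m = 0.
Proof.
elim: s m => [|i s IH] [|m] //=; first by rewrite big_nil.
by rewrite ltnS => sm; rewrite big_cons fcoef_flinS !IH ?mulr0 ?subr0 // ltnW.
Qed.

Lemma fcoef_prod (I : finType) (F : I -> {fps R}) n r : (r <= n)%N ->
  fcoef (\prod_i F i) r =
  \sum_(M : {ffun I -> 'I_n.+1} | (\sum_i M i)%N == r) \prod_i fcoef (F i) (M i).
Proof.
move=> rn; pose rel f (p : {poly R}) := forall r, (r <= n)%N -> fcoef f r = p`_r.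
have -> : fcoef (\prod_i F i) r = (\prod_i fps_trunc n (F i))`_r.
  move: r rn; apply: (big_ind2 rel).
  - by move=> r _; rewrite coef1; case: r.
  - move=> f p g q fp gq r rn; rewrite coefM fcoefM; apply: eq_bigr => i _.
    by rewrite fp ?gq // ?(leq_trans (leq_subr _ _)) // (leq_trans _ rn) // -ltnS.
  - by move=> i _ r rn; rewrite coef_poly ltnS rn.
under eq_bigr => i _ do rewrite /fps_trunc poly_def.
rewrite (bigA_distr_bigA (fun i (j : 'I_n.+1) => fcoef (F i) j *: 'X^j)) /= coef_sum.
rewrite [RHS]big_mkcond /=; apply: eq_bigr => M _.
rewrite scaler_prod -expr_sum coefZ coefXn eq_sym; case: eqP => _; first by rewrite mulr1.
by rewrite mulr0.
Qed.

Variables (I : finType) (x : I -> R).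

Definition hgen : {fps R} := \prod_i fgeo (x i).
Definition hcoef (b c : nat) : R := if (c <= b)%N then fcoef hgen (b - c) else 0.

Lemma hsumE n b c : (b <= n + c)%N -> hsum n x b c = hcoef b c.
Proof.
move=> bn; rewrite /hsum /hcoef; case: leqP => [cb|bc].
  have bcn : (b - c <= n)%N by rewrite leq_subLR addnC.
  rewrite (fcoef_prod _ bcn); apply: eq_bigl => M.
  by rewrite -{1}(subnK cb) eqn_add2r.
rewrite big1 // => M /eqP e; have := leq_addl (\sum_i M i) c.
by rewrite e leqNgt bc.
Qed.

End CompleteSums.

Section JacobiTrudi.
Variables (R : comNzRingType) (N : nat) (x : 'I_N.+1 -> R).
Implicit Type a : 'I_N.+1 -> nat.

Definition alternant a : R := \det (\matrix_(i, k) x k ^+ a i).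

Definition delta (i : 'I_N.+1) : nat := (N - i)%N.

(** Compare the coefficients of degree [b] in [H(X) * \prod_(l != k) (1 - x_l X) = 1 / (1 - x_k X)],
    with [H] the generating series of the complete functions. *)
Lemma sum_hcoef_flin b k :
  \sum_(j < N.+1) hcoef x b (delta j) *
     fcoef (\prod_(l | l != k) flin (x l)) (delta j) = x k ^+ b.
Proof.
set E := \prod_(l | _) _.
have E0 m : (N < m)%N -> fcoef E m = 0.
  move=> Nm; rewrite /E -big_filter fcoef_prod_flin // size_filter.
  have := count_predC (fun l => l != k) (index_enum 'I_N.+1).
  rewrite (_ : size _ = N.+1) ?/index_enum -?enumT ?size_enum_ord //.
  rewrite (_ : count (predC _) _ = 1%N) ?addn1 => [[->] //|].
  rewrite (eq_count (a2 := pred1 k)) ?count_uniq_mem ?enum_uniq ?mem_enum //.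
  by move=> l /=; rewrite negbK.
have eE : hgen x * E = fgeo (x k).
  rewrite /hgen (bigD1 k) //= -mulrA -big_split /= big1 ?mulr1 // => l _.
  by rewrite mulrC flin_fgeo.
transitivity (fcoef (hgen x * E) b); last by rewrite eE.
rewrite mulrC fcoefM (reindex_inj rev_ord_inj) /=.
have dE (i : 'I_N.+1) : delta (rev_ord i) = i.
  by rewrite /delta /= subSS subKn // -ltnS.
under eq_bigr => i _ do rewrite dE.
(* Both ranges are enlarged to their maximum: a term in only one of them vanishes, by the degree of
   [E] when [i > N] and by the convention of [hcoef] when [i > b]. *)
rewrite (big_ord_widen_cond (maxn N.+1 b.+1) predT (fun i => hcoef x b i * fcoef E i)) ?leq_maxl //.
rewrite (big_ord_widen_cond (maxn N.+1 b.+1) predT (fun i => fcoef E i * fcoef (hgen x) (b - i))) ?leq_maxr //.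
rewrite big_mkcond [RHS]big_mkcond /=; apply: eq_bigr => i _.
rewrite !ltnS /hcoef; case: (leqP i N) => iN; case: (leqP i b) => ib //; last first.
- by rewrite E0 ?mul0r.
- by rewrite mul0r.
by rewrite mulrC.
Qed.

(** The factorization given by [sum_hcoef_flin] has the same right factor [C] for every [a]. For
    [a = delta] its left factor is unitriangular, so that [C] has determinant [alternant delta]. *)
Lemma jacobi_trudi a :
  alternant a = \det (\matrix_(i, j) hcoef x (a i) (delta j)) * alternant delta.
Proof.
pose C := \matrix_(j, k) fcoef (\prod_(l | l != k) flin (x l)) (delta j).
have eqC b : \matrix_(i, k) x k ^+ b i = \matrix_(i, j) hcoef x (b i) (delta j) *m C.
  apply/matrixP => i k; rewrite !mxE -sum_hcoef_flin.
  by apply: eq_bigr => j _; rewrite !mxE.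
rewrite /alternant !eqC !det_mulmx; congr (_ * _).
rewrite -[LHS]mul1r; congr (_ * _); apply/esym; rewrite -det_tr det_trig.
  rewrite big1 // => i _; rewrite !mxE /hcoef leqnn subnn /hgen.
  rewrite (fcoef_prod _ (leqnn 0%N)) (big_pred1 [ffun=> ord0]) ?big1 //.
    by move=> j _; rewrite ffunE.
  move=> M /=; rewrite big1 ?eqxx => [|j _]; last by case: (M j) => -[].
  by apply/esym/eqP/ffunP => j; rewrite ffunE; apply/val_inj; case: (M j) => -[].
apply/is_trig_mxP => i j ij; rewrite !mxE /hcoef /delta leqNgt ltn_sub2l //.
by rewrite (leq_trans ij) // -ltnS.
Qed.

End JacobiTrudi.

(** Induction over the prefixes: once [s] fixes everything below [a], the prefix sum gives
    [s a <= a], and the smaller values are already taken. *)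
Lemma perm_le_id N (s : 'S_N) :
  (forall k, (k <= N)%N -> \sum_(a < N | (a < k)%N) s a <= \sum_(a < N | (a < k)%N) a)%N -> s = 1%g.
Proof.
move=> le_s; have fix_s k : forall a : 'I_N, (a < k)%N -> s a = a.
  elim: k => [//|k IH] a; rewrite ltnS leq_eqVlt => /orP[/eqP ak|]; last exact: IH.
  have := le_s a.+1 (ltn_ord a).
  rewrite (bigD1 a) ?ltnSn //= [X in (_ <= X)%N](bigD1 a) ?ltnSn //=.
  rewrite (eq_bigr (fun b : 'I_N => nat_of_ord b)); last first.
    move=> b /andP[ba nba]; rewrite IH // -ak ltn_neqAle -ltnS ba andbT.
    by apply: contraNneq nba => /val_inj ->.
  rewrite leq_add2r leq_eqVlt => /orP[/eqP/val_inj //|sa].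
  have := IH (s a); rewrite -ak => /(_ sa) /perm_inj; exact.
by apply/permP => a; rewrite perm1 (fix_s a.+1).
Qed.

(** * The Jacobi-Trudi determinant of permutation characters *)

Section JacobiTrudiCharacter.
Variables (n N : nat) (kap : part).
Hypotheses (kapn : psize kap = n) (kapN : (size kap <= N.+1)%N).
Local Notation G := [set: 'S_n]%G.
Local Notation beta := (fun j : 'I_N.+1 => (nth 0 kap j + delta j)%N).

Definition jt_val (s : 'S_n) : int :=
  \sum_(t : 'S_N.+1) (-1) ^+ t * (hcount beta (fun j => delta (t j)) s)%:R.

(* [det (h_(mu_i - i + j))], in which the product [h_a] stands for the
   permutation character on the words of content [a]. *)
Definition jt_cfun : 'CF(G) :=
  \sum_(t : 'S_N.+1) (-1) ^+ t *: hcfun n beta (fun j => delta (t j)).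

Lemma jt_cfunE s : jt_cfun s = (jt_val s)%:~R.
Proof.
rewrite sum_cfunE rmorph_sum /=; apply: eq_bigr => t _.
by rewrite !cfunE rmorphM /= rmorph_sign rmorph_nat.
Qed.

Lemma sum_beta (t : 'S_N.+1) : (\sum_j beta j = n + \sum_j delta (t j))%N.
Proof.
rewrite big_split /= -psizeE // kapn; congr (_ + _)%N.
by rewrite (reindex_inj (@perm_inj _ t)).
Qed.

Lemma sum_jt_psum (R : comNzRingType) (x : 'I_N.+1 -> R) :
  \sum_s (jt_val s)%:~R * perm_psum x s =
  n`!%:R * \det (\matrix_(i, j) hcoef x (beta i) (delta j)).
Proof.
under eq_bigr => s _ do rewrite /jt_val rmorph_sum mulr_suml.
rewrite exchange_big /determinant mulr_sumr; apply: eq_bigr => t _ /=.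
transitivity ((-1) ^+ t * \sum_(s : 'S_n) (hcount beta (fun j => delta (t j)) s)%:R * perm_psum x s).
  rewrite mulr_sumr; apply: eq_bigr => s _.
  by rewrite rmorphM /= rmorph_sign rmorph_nat mulrA.
rewrite (hcount_psum ord0 x (sum_beta t)) mulrCA; congr (_ * (_ * _)).
under [RHS]eq_bigr => i _ do rewrite mxE.
(* [hsum] is a genuine complete function unless its index exceeds [n]. In that case [sum_beta]
   forces a negative index in another row, and both products vanish. *)
case: (pickP (fun i => n + delta (t i) < beta i)%N) => [i lti|le_all]; last first.
  by apply: eq_bigr => i _; rewrite hsumE // leqNgt le_all.
case: (pickP (fun j => beta j < delta (t j))%N) => [j ltj|le_j].
  rewrite (bigD1 j) //= [RHS](bigD1 j) //= {1}/hcoef leqNgt ltj mul0r /hsum big1 ?mul0r //.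
  move=> M /eqP e; have := leq_addl (\sum_i M i) (delta (t j)).
  by rewrite e leqNgt ltj.
have := sum_beta t; rewrite (bigD1 i) //= [in RHS](bigD1 i) //= addnA => e.
suff : (n + delta (t i) + \sum_(j | j != i) delta (t j) < beta i + \sum_(j | j != i) beta j)%N.
  by rewrite -e ltnn.
apply: (leq_trans (n := (beta i + \sum_(j | j != i) delta (t j))%N)); first by rewrite ltn_add2r.
by rewrite leq_add2l; apply: leq_sum => j _; rewrite leqNgt le_j.
Qed.

Lemma sum_jt_alternant (R : comNzRingType) (x : 'I_N.+1 -> R) :
  (\sum_s (jt_val s)%:~R * perm_psum x s) * alternant x (@delta N) = n`!%:R * alternant x beta.
Proof. by rewrite sum_jt_psum (jacobi_trudi x beta) mulrA. Qed.

Local Notation X := (fun i : 'I_N.+1 => 'X_i : {mpoly int[N.+1]}).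
Local Notation mbeta := [multinom beta i | i < N.+1].

Lemma alternant_mpoly (a : 'I_N.+1 -> nat) :
  alternant X a = \sum_(t : 'S_N.+1) (-1) ^+ t * 'X_[[multinom a (t i) | i < N.+1]].
Proof.
rewrite /alternant -det_tr /determinant; apply: eq_bigr => t _; congr (_ * _).
by rewrite mpolyXE_id; apply: eq_bigr => i _; rewrite !mxE mnmE.
Qed.

Lemma mcoeff_sign (b : bool) (p : {mpoly int[N.+1]}) m :
  ((-1) ^+ b * p)@_m = (-1) ^+ b * p@_m.
Proof. by case: b; rewrite ?expr1 ?expr0 ?mulN1r ?mul1r ?mcoeffN. Qed.

Lemma beta_inj : injective beta.
Proof.
have lt_beta (i j : 'I_N.+1) : (i < j)%N -> (beta j < beta i)%N.
  move=> ij; rewrite -addnS leq_add ?part_geq ?(ltnW ij) // /delta ltn_sub2l //.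
  by rewrite (leq_trans ij) // -ltnS.
move=> i j e; apply/val_inj; case: (ltngtP i j) => // /lt_beta; rewrite e ltnn //.
Qed.

Lemma mcoeff_alternant_beta : (alternant X beta)@_mbeta = 1.
Proof.
rewrite alternant_mpoly raddf_sum /= (bigD1 1%g) //= mcoeff_sign odd_perm1 mul1r mcoeffX.
rewrite big1 ?addr0 => [|t nt].
  rewrite (_ : _ == _) //; apply/eqP/mnmP => i; by rewrite !mnmE perm1.
rewrite mcoeff_sign mcoeffX; case: eqP => [/mnmP e|_]; last by rewrite mulr0.
case/eqP: nt; apply/permP => i; rewrite perm1; apply: beta_inj.
by have := e i; rewrite !mnmE.
Qed.

(* Frobenius' formula: with [sum_jt_alternant] it makes the norm of [jt_cfun] the
   leading coefficient of an alternant. *)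
Lemma mcoeff_psum_alternant s :
  (perm_psum X s * alternant X (@delta N))@_mbeta = jt_val s.
Proof.
rewrite alternant_mpoly mulr_sumr raddf_sum /=; apply: eq_bigr => t _.
rewrite mulrCA mcoeff_sign (perm_psumE ord0) hcountE mulr_suml raddf_sum /=; congr (_ * _).
apply: eq_bigr => w _.
rewrite (_ : \prod_(i < n) _ = 'X_[[multinom content w i : nat | i < N.+1]]); last first.
  rewrite mpolyXE_id; apply: etrans (prod_content X w) _.
  by apply: eq_bigr => i _; rewrite mnmE.
rewrite -mpolyXD mcoeffX; congr (nat_of_bool _)%:R.
apply/eqP/forallP => [/mnmP e i|e].
  by have := e i; rewrite mnmDE !mnmE => ->.
by apply/mnmP => i; rewrite mnmDE !mnmE; exact/eqP.
Qed.

Lemma sum_jt_sqr : \sum_s jt_val s ^+ 2 = n`!%:R.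
Proof.
have := congr1 (mcoeff mbeta) (sum_jt_alternant X).
rewrite mulr_suml raddf_sum /= => e.
transitivity (\sum_s ((jt_val s)%:~R * perm_psum X s * alternant X (@delta N))@_mbeta).
  apply: eq_bigr => s _; rewrite -mulrA mulrzl raddfMz /= mcoeff_psum_alternant.
  by rewrite expr2 -mulrzl intz.
by rewrite e mulr_natl raddfMn /= mcoeff_alternant_beta.
Qed.

Lemma jt_cfun_norm : '[jt_cfun] = 1.
Proof.
rewrite cfdotE; apply: (canLR (mulKf (neq0CG _))); rewrite cardsT card_Sn mulr1.
have := congr1 (intr : int -> algC) sum_jt_sqr; rewrite rmorph_nat => <-.
rewrite rmorph_sum /=; apply: eq_big => [s|s _]; first by rewrite inE.
by rewrite jt_cfunE rmorph_int -expr2 rmorphXn.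
Qed.

Lemma jt_cfun_vchar : jt_cfun \in 'Z[irr G]%g.
Proof.
rewrite rpred_sum // => t _; rewrite rpredZsign.
exact/char_vchar/hcfun_char.
Qed.

(** Only the diagonal term of the determinant contains this irreducible character: if the term of
    [t] does, dominance bounds the prefix sums of [t] by those of the identity, and [perm_le_id]
    applies. *)
Lemma cfdot_jt_irr_part : '[jt_cfun, 'chi_(irr_part n kap)] = '[hpart n N kap, 'chi_(irr_part n kap)].
Proof.
rewrite cfdot_suml (bigD1 1%g) //= odd_perm1 scale1r big1 ?addr0 => [|t nt1].
  congr '[_, _]; apply/cfunP => s; rewrite !hcfunE /hcount; congr _%:R.
  apply: eq_card => w; rewrite !inE; congr (_ && _); apply: eq_forallb => j.
  by rewrite perm1 addn0 eqn_add2r.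
rewrite cfdotZl; apply/eqP; rewrite mulf_eq0; apply/orP; right.
apply: contraNT nt1; rewrite -irr_consttE => ci; apply/eqP/perm_le_id => k kN.
have := irr_part_dominance k kapn ci; rewrite big_split /=.
rewrite -(big_ord_widen N.+1 (fun i => nth 0%N kap i)) // leq_add2l /delta.
have e (f : 'I_N.+1 -> 'I_N.+1) : (\sum_(a < N.+1 | (a < k)%N) (N - f a) + \sum_(a < N.+1 | (a < k)%N) f a =
    \sum_(a < N.+1 | (a < k)%N) N)%N.
  by rewrite -big_split /=; apply: eq_bigr => a _; rewrite subnK // -ltnS.
by rewrite -(leq_add2r (\sum_(a < N.+1 | (a < k)%N) t a)) (e t) -(e id) leq_add2l.
Qed.

(** Norm 1 leaves an irreducible character up to sign. Its product with ['chi_(irr_part n kap)] is a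
    nonzero multiplicity in a permutation character, which determines both the index and the
    sign. *)
Lemma irr_part_jt : 'chi_(irr_part n kap) = jt_cfun.
Proof.
have [ci _] := irr_partP kapn; move: ci; rewrite irr_consttE.
rewrite -(Ind_young_hpart kapn (size_part_n kapn)) (Ind_young_hpart kapn kapN) -cfdot_jt_irr_part.
have [b [i e]] := vchar_norm1P jt_cfun_vchar jt_cfun_norm.
have e2 : '[jt_cfun, 'chi_(irr_part n kap)] = (-1) ^+ b * (i == irr_part n kap)%:R.
  by rewrite e cfdotZl cfdot_irr.
have : 0 <= '[jt_cfun, 'chi_(irr_part n kap)].
  by rewrite cfdot_jt_irr_part natr_ge0 // Cnat_cfdot_char ?hpart_char ?irr_char.
rewrite e2; case: (i =P _) => [ei|_]; last by rewrite mulr0 eqxx.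
rewrite mulr1 e ei; case: b {e e2} => [|_ _]; last by rewrite scale1r.
by rewrite expr1 oppr_ge0 ler10.
Qed.

End JacobiTrudiCharacter.

(** * Adding a part to a partition, and the numbers [z_mu] *)

Lemma part_gt0 (mu : part) m : m \in (mu : seq nat) -> (0 < m)%N.
Proof. by move=> mmu; rewrite lt0n; apply: contraTneq mmu => ->; case: mu => s /= /andP[]. Qed.

Lemma perm_part (mu nu : part) : perm_eq mu nu -> mu = nu.
Proof.
move=> e; apply: val_inj; have geqA : antisymmetric geq by move=> a b; rewrite andbC => /anti_leq.
have geqT : transitive geq by move=> a b c /= ba cb; exact: leq_trans cb ba.
exact: (sorted_eq geqT geqA (part_sorted mu) (part_sorted nu) e).
Qed.

Lemma perm_cat_part (mu nu : part) : perm_eq (cat_part mu nu) (mu ++ nu).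
Proof. by rewrite /= perm_sort. Qed.

Lemma psize_cat (mu nu : part) : psize (cat_part mu nu) = (psize mu + psize nu)%N.
Proof. by rewrite /psize (perm_sumn (perm_cat_part mu nu)) sumn_cat. Qed.

Lemma size_cat_part (mu nu : part) : size (cat_part mu nu) = (size mu + size nu)%N.
Proof. by rewrite (perm_size (perm_cat_part mu nu)) size_cat. Qed.

Definition ppoint (k : nat) : part := Part (isT : is_part [:: k.+1]).
Definition pcons k (mu : part) : part := cat_part (ppoint k) mu.

Lemma perm_pcons k mu : perm_eq (pcons k mu) (k.+1 :: mu).
Proof. exact: perm_cat_part. Qed.

Lemma pcons_inj k : injective (pcons k).
Proof.
move=> mu nu e; apply: perm_part; rewrite -(perm_cons k.+1).
by rewrite -(permPr (perm_pcons k nu)) -e perm_sym perm_pcons.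
Qed.

Lemma psize_pcons k mu : psize (pcons k mu) = (k.+1 + psize mu)%N.
Proof. by rewrite psize_cat /psize /= addn0. Qed.

Lemma count_pcons k mu m : count_mem m (pcons k mu) = ((k.+1 == m) + count_mem m mu)%N.
Proof. by rewrite (seq.permP (perm_pcons k mu)) /=. Qed.

Lemma pcons_surj k (mu : part) : k.+1 \in (mu : seq nat) -> exists nu, mu = pcons k nu.
Proof.
move=> kmu; have rp : is_part (rem k.+1 mu).
  apply/andP; split; last first.
    by apply/negP => /mem_rem; case: (mu) => s /= /andP[_ /negPf ->].
  have geqT : transitive geq by move=> a b c /= ba cb; exact: leq_trans cb ba.
  exact: (subseq_sorted geqT (rem_subseq _ _) (part_sorted mu)).
exists (Part rp); apply: perm_part; rewrite (permPr (perm_pcons k _)) /=.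
exact: perm_to_rem.
Qed.

Lemma sum_parts_pcons (V : nmodType) n k (G : part -> V) : (k < n)%N ->
  (forall mu : part, k.+1 \notin (mu : seq nat) -> G mu = 0) ->
  \sum_(mu <- parts n) G mu = \sum_(mu <- parts (n - k.+1)%N) G (pcons k mu).
Proof.
move=> kn G0; rewrite (bigID (fun mu : part => k.+1 \in (mu : seq nat))) /= addrC big1 ?add0r; last first.
  by move=> mu /G0.
rewrite -big_filter -[RHS](big_map (pcons k) predT).
apply: perm_big; apply: uniq_perm.
- by rewrite filter_uniq ?parts_uniq.
- by rewrite map_inj_uniq ?parts_uniq //; exact: pcons_inj.
move=> mu; rewrite mem_filter mem_parts; apply/andP/mapP => [[/pcons_surj[nu ->] /eqP e]|[nu]].
  by exists nu; rewrite // mem_parts -e psize_pcons addKn.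
rewrite mem_parts => /eqP e ->; rewrite psize_pcons e subnKC //; split=> //.
by rewrite (perm_mem (perm_pcons k nu)) mem_head.
Qed.

Lemma zpartE (mu : part) M : (psize mu <= M)%N ->
  zpart mu = (\prod_(m <- (mu : seq nat)) m * \prod_(j < M.+1) (count_mem (j : nat) mu)`!)%N.
Proof.
move=> muM; congr (_ * _)%N; have hM : (head 0 mu <= M)%N.
  by rewrite -nth0 (leq_trans (nth_part_le mu 0)).
rewrite (big_ord_widen M.+1 (fun j => (count_mem j mu)`!)) // big_mkcond /=; apply: eq_bigr => j _.
rewrite ltnS; case: leqP => // hj; rewrite (_ : count_mem _ _ = 0%N) //.
apply/eqP; rewrite -leqn0 leqNgt -has_count; apply/hasPn => m /(nthP 0%N)[i _ <-] /=.
by rewrite neq_ltn (leq_ltn_trans _ hj) // -nth0 part_geq.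
Qed.

Lemma zpart_gt0 mu : (0 < zpart mu)%N.
Proof.
rewrite muln_gt0; apply/andP; split; last by apply: prodn_gt0 => j; exact: fact_gt0.
rewrite big_seq; apply: prodn_cond_gt0 => m; exact: part_gt0.
Qed.

Lemma zpart_pcons k mu :
  zpart (pcons k mu) = (k.+1 * (count_mem k.+1 mu).+1 * zpart mu)%N.
Proof.
rewrite (zpartE (leqnn _)) (@zpartE mu (psize (pcons k mu))); last by rewrite psize_pcons leq_addl.
rewrite (perm_big _ (perm_pcons k mu)) big_cons /= -!mulnA; congr (_ * _)%N.
rewrite mulnCA; congr (_ * _)%N.
have kM : (k.+1 < (psize (pcons k mu)).+1)%N by rewrite ltnS psize_pcons leq_addr.
rewrite (bigD1 (Ordinal kM)) //= [X in (_ = _ * X)%N](bigD1 (Ordinal kM)) //= mulnA.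
rewrite count_pcons eqxx add1n factS; congr (_ * _)%N.
apply: eq_bigr => j jk; rewrite count_pcons (_ : _ == _ = false) //.
by apply/negbTE; apply: contraNneq jk => kj; apply/eqP/val_inj.
Qed.

Lemma psize_count (mu : part) n : psize mu = n ->
  n = (\sum_(k < n) k.+1 * count_mem k.+1 mu)%N.
Proof.
move=> mun; rewrite -{1}mun /psize sumnE.
transitivity (\sum_(m <- (mu : seq nat)) \sum_(k < n) k.+1 * (m == k.+1))%N.
  rewrite big_seq [RHS]big_seq; apply: eq_bigr => m mmu; have m0 := part_gt0 mmu.
  have mn : (m <= n)%N by case/(nthP 0%N): mmu => i _ <-; rewrite -mun nth_part_le.
  have pm : (m.-1 < n)%N by rewrite prednK.
  rewrite (bigD1 (Ordinal pm)) //= prednK // eqxx muln1 big1 ?addn0 // => k nk.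
  rewrite (_ : m == _ = false) ?muln0 //; apply/negbTE; apply: contraNneq nk => e.
  by apply/eqP/val_inj; rewrite /= e.
rewrite exchange_big /=; apply: eq_bigr => k _.
rewrite -big_distrr /=; congr (_ * _)%N; rewrite -sum1_count [RHS]big_mkcond /=.
by apply: eq_bigr => m _; case: eqP.
Qed.

(** * Newton's identities *)

Section Newton.
Variable R : comUnitRingType.
Hypothesis natu : forall n, n.+1%:R \is a @GRing.unit R.
Implicit Types (p : nat -> R) (f g : {fps R}).

Lemma natr_gt0_unit m : (0 < m)%N -> m%:R \is a @GRing.unit R.
Proof. by case: m. Qed.

Definition pprod p (mu : part) : R := \prod_(m <- (mu : seq nat)) p m.

(** The series [exp (\sum_(n > 0) p n X^n / n)] written out in products of power sums; at the power
    sums of some variables it is the generating series of their complete functions. *)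
Definition hser p : {fps R} := Fps (fun n => \sum_(mu <- parts n) pprod p mu / (zpart mu)%:R).

Lemma pprod_pcons p k mu : pprod p (pcons k mu) = p k.+1 * pprod p mu.
Proof. by rewrite /pprod (perm_big _ (perm_pcons k mu)) big_cons. Qed.

(** Write [n] as the sum of the [k m_k(mu)]. Removing one part [k] from [mu] divides [z_mu] by
    exactly [k m_k(mu)]. *)
Lemma newton_hser p n :
  n%:R * fcoef (hser p) n = \sum_(k < n) p k.+1 * fcoef (hser p) (n - k.+1).
Proof.
rewrite /= mulr_sumr.
transitivity (\sum_(mu <- parts n) \sum_(k < n)
    (k.+1 * count_mem k.+1 mu)%:R * (pprod p mu / (zpart mu)%:R)).
  apply: eq_big_seq => mu; rewrite mem_parts => /eqP mun.
  by rewrite {1}(psize_count mun) natr_sum mulr_suml.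
rewrite exchange_big /=; apply: eq_bigr => k _.
rewrite (@sum_parts_pcons _ _ k) //; last first.
  by move=> mu /count_memPn ->; rewrite muln0 mul0r.
rewrite mulr_sumr; apply: eq_bigr => mu _.
rewrite pprod_pcons count_pcons eqxx zpart_pcons natrM.
have u := natr_gt0_unit (zpart_gt0 mu).
have v : (k.+1 * (count_mem k.+1 mu).+1)%:R \is a @GRing.unit R by rewrite natrM unitrM !natu.
by rewrite add1n -natrM [X in _ / X]natrM invrM // mulrC -!mulrA mulVr // mulr1.
Qed.

Lemma newton_uniq (p : nat -> R) f g : fcoef f 0 = fcoef g 0 ->
  (forall n, n%:R * fcoef f n = \sum_(k < n) p k.+1 * fcoef f (n - k.+1)) ->
  (forall n, n%:R * fcoef g n = \sum_(k < n) p k.+1 * fcoef g (n - k.+1)) -> f = g.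
Proof.
move=> e0 ef eg; apply/fpsP => n; have [m] := ubnP n; elim: m n => // m IH [|n] // nm.
apply: (mulrI (natu n)); rewrite ef eg; apply: eq_bigr => k _; rewrite IH //.
by rewrite subSS (leq_ltn_trans (leq_subr _ _)) // -ltnS.
Qed.

Definition pser p : {fps R} := Fps (fun n => if n == 0%N then 0 else p n).
(** The operator [X d/dX]. Newton's recursion becomes an equation for the logarithmic derivative,
    which characterizes [hser p] and reduces [hserD] to the Leibniz rule. *)
Definition feuler f : {fps R} := Fps (fun n => n%:R * fcoef f n).

Lemma fcoefD f g n : fcoef (f + g) n = fcoef f n + fcoef g n.
Proof. by []. Qed.

Lemma feulerM f g : feuler (f * g) = feuler f * g + f * feuler g.
Proof.
apply/fpsP => n; transitivity (n%:R * fcoef (f * g) n); first by [].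
rewrite fcoefD !fcoefM -big_split mulr_sumr; apply: eq_bigr => i _ /=.
rewrite -mulrA [in X in _ = _ + X]mulrCA -mulrDl -natrD subnKC // -ltnS //.
Qed.

Lemma newtonP p f : feuler f = pser p * f <->
  (forall n, n%:R * fcoef f n = \sum_(k < n) p k.+1 * fcoef f (n - k.+1)).
Proof.
have e n : fcoef (pser p * f) n = \sum_(k < n) p k.+1 * fcoef f (n - k.+1).
  by rewrite fcoefM big_ord_recl /= mul0r add0r.
split => [/fpsP h n|h]; first by rewrite -e -h.
by apply/fpsP => n; rewrite e -h.
Qed.

Lemma feuler_hser p : feuler (hser p) = pser p * hser p.
Proof. by apply/newtonP/newton_hser. Qed.

Lemma parts0 : parts 0 = [:: part0].
Proof.
have : perm_eq (parts 0) [:: part0].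
  apply: uniq_perm; rewrite ?parts_uniq // => mu; rewrite mem_parts inE.
  apply/eqP/eqP => [mu0|-> //]; apply: part_inj => i; rewrite nth_nil.
  by apply/eqP; rewrite -leqn0 -[X in (_ <= X)%N]mu0 nth_part_le.
by move=> e; apply: perm_small_eq.
Qed.

Lemma zpart0 : zpart part0 = 1%N.
Proof. by rewrite /zpart /= big_nil big_ord1. Qed.

Lemma hser0 p : fcoef (hser p) 0 = 1.
Proof. by rewrite /= parts0 big_seq1 /pprod big_nil zpart0 divr1. Qed.

Lemma hser_uniq p f : fcoef f 0 = 1 -> feuler f = pser p * f -> f = hser p.
Proof.
move=> f0 /newtonP ef; apply: (newton_uniq _ ef (newton_hser p)).
by rewrite f0 hser0.
Qed.

Lemma hserD p q : hser (fun n => p n + q n) = hser p * hser q.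
Proof.
apply/esym/hser_uniq; first by rewrite fcoefM big_ord1 !hser0 mulr1.
have -> : pser (fun n => p n + q n) = pser p + pser q.
  by apply/fpsP => -[|n] /=; rewrite ?addr0.
by rewrite feulerM !feuler_hser; ring.
Qed.

Lemma hser_const0 : hser (fun=> 0) = 1.
Proof.
apply/esym/hser_uniq => //; apply/fpsP => n; rewrite fcoefM /= big1 => [|i _].
  by case: n => [|n]; rewrite ?mul0r ?mulr0.
by case: ifP; rewrite mul0r.
Qed.

Lemma fgeo_hser (y : R) : fgeo y = hser (fun n => y ^+ n).
Proof.
apply: hser_uniq => //; apply/newtonP => n /=.
rewrite (eq_bigr (fun=> y ^+ n)) => [|k _]; last by rewrite -exprD subnKC.
by rewrite sumr_const card_ord mulr_natl.
Qed.

Lemma flin_hser (y : R) : flin y = hser (fun n => - y ^+ n).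
Proof.
rewrite -[RHS]mul1r -(flin_fgeo y) -mulrA fgeo_hser -hserD.
rewrite (_ : (fun n => _) = (fun=> 0)) ?hser_const0 ?mulr1 //.
by apply/boolp.funext => n; rewrite subrr.
Qed.

Lemma hser_sum (I : Type) (s : seq I) (P : I -> nat -> R) :
  hser (fun n => \sum_(i <- s) P i n) = \prod_(i <- s) hser (P i).
Proof.
elim: s => [|i s IH].
  rewrite big_nil -hser_const0; congr hser; apply/boolp.funext => n; by rewrite big_nil.
rewrite big_cons -IH -hserD; congr hser; apply/boolp.funext => n; by rewrite big_cons.
Qed.

Lemma hgen_hser (I : finType) (x : I -> R) : hgen x = hser (fun n => \sum_i x i ^+ n).
Proof. by rewrite hser_sum; apply: eq_bigr => i _; exact: fgeo_hser. Qed.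

End Newton.

(** * Sizes of conjugacy classes *)

Section ClassSizes.
Variable n : nat.
Local Notation G := [set: 'S_n]%G.
Local Notation R := {mpoly algC[n.+1]}.
Local Notation X := (fun i : 'I_n.+1 => 'X_i : R).

Definition class_size (eta : part) : nat := #|[set s : 'S_n | cycle_part s == eta]|.

Lemma mpoly_natu m : m.+1%:R \is a @GRing.unit R.
Proof.
apply/unitrP; exists ((m.+1%:R^-1)%:MP); rewrite -mpolyC_nat -!mpolyCM.
by rewrite mulVf ?mulfV ?pnatr_eq0.
Qed.

Lemma sum_perm_parts (V : nmodType) (F : part -> V) :
  \sum_(s : 'S_n) F (cycle_part s) = \sum_(eta <- parts n) F eta *+ class_size eta.
Proof.
rewrite (eq_bigr (fun s => \sum_(eta <- parts n) if cycle_part s == eta then F eta else 0)).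
  rewrite exchange_big /=; apply: eq_bigr => eta _; rewrite -big_mkcond sumr_const.
  by congr (_ *+ _); apply: eq_card => s; rewrite !inE.
move=> s _; rewrite (bigD1_seq (cycle_part s)) ?parts_uniq ?mem_parts ?psize_cycle_part //=.
by rewrite eqxx big1 ?addr0 // => eta; rewrite eq_sym => /negPf ->.
Qed.

Lemma perm_psum_pprod (A : comUnitRingType) (I : finType) (x : I -> A) (s : 'S_n) :
  perm_psum x s = pprod (fun m => \sum_i x i ^+ m) (cycle_part s).
Proof. exact: (prod_porbits (fun m => \sum_i x i ^+ m)). Qed.

Lemma sum_perm_psum (A : comUnitRingType) (I : finType) (i0 : I) (x : I -> A) :
  \sum_(s : 'S_n) perm_psum x s = n`!%:R * fcoef (hgen x) n.
Proof.
under eq_bigr => s _ do rewrite (perm_psumE i0).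
transitivity (\sum_(s : 'S_n) \sum_(w : {ffun 'I_n -> I} | wperm w s == w)
   (fun M : {ffun I -> 'I_n.+1} => \prod_i x i ^+ M i) (content w)).
  by apply: eq_bigr => s _; apply: eq_bigr => w _; rewrite prod_content.
by rewrite (burnside_content (fun M : {ffun I -> 'I_n.+1} => \prod_i x i ^+ M i)) (fcoef_prod _ (leqnn n)).
Qed.

(* Class sizes and the numbers [n! / z_eta] both expand [h_n] in power sums, so
   that the defect is orthogonal to the permutation characters, which span the
   class functions. *)
Definition defect (eta : part) : algC := n`!%:R / (zpart eta)%:R - (class_size eta)%:R.

Lemma sum_defect_pprod : \sum_(eta <- parts n) (defect eta)%:MP * pprod (fun m => \sum_i X i ^+ m) eta = 0.
Proof.
have := sum_perm_psum ord0 X; rewrite (hgen_hser mpoly_natu) /= mulr_sumr.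
rewrite (eq_bigr _ (fun s _ => perm_psum_pprod X s)).
rewrite sum_perm_parts => /esym/eqP; rewrite -subr_eq0 -sumrB => /eqP e.
apply: etrans e; apply: eq_bigr => eta _.
rewrite mpolyCB mulrBl mpolyCM mpolyC_nat mpolyC_nat mulr_natl; congr (_ - _); last by rewrite mulr_natl.
rewrite -mulr_natl -mulrA; congr (_ * _); rewrite mulrC; congr (_ * _).
apply: (mulIr (natr_gt0_unit mpoly_natu (zpart_gt0 eta))).
rewrite mulVr ?(natr_gt0_unit mpoly_natu) ?zpart_gt0 // -mpolyC_nat -mpolyCM.
by rewrite mulVf ?mpolyC1 // pnatr_eq0 -lt0n zpart_gt0.
Qed.

Lemma cycle_partJ (s t : 'S_n) : cycle_part (s ^ t)%g = cycle_part s.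
Proof.
apply: perm_part; rewrite (permPl (perm_cycle_part _)) (permPr (perm_cycle_part _)).
have oJ i : porbit (s ^ t)%g (t i) = t @: porbit s i.
  apply/setP => j; apply/porbitP/imsetP => [[k ->]|[_ /porbitP[k ->] ->]].
    by exists ((s ^+ k)%g i); rewrite ?mem_porbit // -conjXg permJ.
  by exists k; rewrite -conjXg permJ.
have eJ : perm_eq (enum (porbits (s ^ t)%g)) [seq t @: (c : {set 'I_n}) | c <- enum (porbits s)].
  apply: uniq_perm; rewrite ?enum_uniq //.
    by rewrite map_inj_uniq ?enum_uniq //; exact/imset_inj/perm_inj.
  move=> c; rewrite mem_enum; apply/imsetP/mapP => [[i _ ->]|[d]].
    by exists (porbit s (t^-1%g i)); rewrite ?mem_enum ?imset_f // -oJ permKV.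
  by rewrite mem_enum => /imsetP[i _ ->] ->; exists (t i).
rewrite (permPl (perm_map (fun c : {set 'I_n} => #|c|) eJ)) -map_comp.
by rewrite (eq_map (g := fun c : {set 'I_n} => #|c|)) // => c /=; rewrite card_imset //; exact: perm_inj.
Qed.

Lemma class_size_gt0 eta : psize eta = n -> (0 < class_size eta)%N.
Proof.
by move=> /cycle_part_surj[s <-]; rewrite card_gt0; apply/set0Pn; exists s; rewrite inE.
Qed.

(** In [n.+1] variables the coefficients of a product of power sums are values of permutation
    characters, so [sum_defect_pprod] is read monomial by monomial. Dividing by the class size
    passes from partitions to permutations. *)
Lemma sum_defect_hcount (b c : 'I_n.+1 -> nat) :
  \sum_(s : 'S_n) (defect (cycle_part s) / (class_size (cycle_part s))%:R) * (hcount b c s)%:R = 0.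
Proof.
case: (pickP (fun i => b i < c i)%N) => [i lti|le_all].
  rewrite big1 // => s _; rewrite (_ : hcount b c s = 0%N) ?mulr0 //.
  apply/eqP; rewrite cards_eq0; apply/eqP/setP => w; rewrite !inE.
  apply/negbTE; rewrite negb_and; apply/orP; right; apply/forallPn; exists i.
  apply: contraL lti => /eqP <-; by rewrite -leqNgt leq_addl.
pose m := [multinom (b i - c i)%N | i < n.+1].
have coefm (s : 'S_n) : (perm_psum X s)@_m = (hcount b c s)%:R.
  rewrite (perm_psumE ord0) hcountE raddf_sum /=; apply: eq_bigr => w _.
  rewrite (_ : \prod_(i < n) _ = 'X_[[multinom content w i : nat | i < n.+1]]); last first.
    rewrite mpolyXE_id; apply: etrans (prod_content X w) _.
    by apply: eq_bigr => i _; rewrite mnmE.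
  rewrite mcoeffX; congr (nat_of_bool _)%:R.
  have cb i : (c i <= b i)%N by rewrite leqNgt le_all.
  apply/eqP/forallP => [/mnmP e i|e].
    by have := e i; rewrite !mnmE => ->; rewrite subnK.
  by apply/mnmP => i; rewrite !mnmE -(eqP (e i)) addnK.
have := congr1 (mcoeff m) sum_defect_pprod; rewrite raddf0; apply: etrans.
pose F (eta : part) : R := (defect eta / (class_size eta)%:R)%:MP * pprod (fun m => \sum_i X i ^+ m) eta.
transitivity ((\sum_(eta <- parts n) F eta *+ class_size eta)@_m).
  rewrite -(sum_perm_parts F) raddf_sum /=; apply: eq_bigr => s _.
  by rewrite /F -(perm_psum_pprod X) mcoeffCM coefm.
congr mcoeff; apply: eq_big_seq => eta; rewrite mem_parts => /eqP /class_size_gt0 c0.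
rewrite /F -mulrnAl -mpolyCMn; congr (_%:MP * _).
by rewrite -[LHS]mulr_natr divfK // pnatr_eq0 -lt0n.
Qed.

Lemma class_sizeE eta : psize eta = n -> (class_size eta * zpart eta = n`!)%N.
Proof.
move=> etan; pose f (s : 'S_n) := defect (cycle_part s) / (class_size (cycle_part s))%:R.
have fP : is_class_fun <<G>>%g [ffun s => f s].
  apply: intro_class_fun => [s t _ _ | s]; last by rewrite mem_gen ?inE.
  by rewrite /f cycle_partJ.
pose phi : 'CF(G) := Cfun 0 fP.
have phi_irr i : '[phi, 'chi_i] = 0.
  have [mu mun <-] := irr_part_surj i.
  rewrite cfdotE (irr_part_jt mun (size_part_n mun)); apply/eqP; rewrite mulf_eq0; apply/orP; right.
  rewrite (eq_bigr (fun s => \sum_(t : 'S_n.+1) (-1) ^+ t * (f s *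
     (hcount (fun j : 'I_n.+1 => (nth 0 mu j + delta j)%N) (fun j => delta (t j)) s)%:R))).
    rewrite exchange_big /= big1 // => t _; rewrite -mulr_sumr.
    rewrite (eq_bigl predT) ?sum_defect_hcount ?mulr0 // => s; by rewrite inE.
  move=> s _; rewrite jt_cfunE cfunE rmorph_int rmorph_sum mulr_sumr; apply: eq_bigr => t _.
  by rewrite rmorphM /= rmorph_sign rmorph_nat mulrCA.
have phi0 : phi = 0.
  by rewrite (cfun_sum_cfdot phi) big1 // => i _; rewrite phi_irr scale0r.
have [s es] := cycle_part_surj etan.
have c0 : (class_size eta)%:R != 0 :> algC by rewrite pnatr_eq0 -lt0n class_size_gt0.
have z0 : (zpart eta)%:R != 0 :> algC by rewrite pnatr_eq0 -lt0n zpart_gt0.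
have := congr1 (fun g : 'CF(G) => g s) phi0; rewrite !cfunE /f es => /eqP.
rewrite mulf_eq0 invr_eq0 (negPf c0) orbF subr_eq0 => /eqP e; apply/eqP.
by rewrite -(eqr_nat algC) natrM -e divfK.
Qed.

End ClassSizes.

(** * Transposition and the orthogonality relations *)

Section CharacterValues.
Variable n : nat.
Local Notation G := [set: 'S_n]%G.
Implicit Types (mu nu eta zeta : part) (s t : 'S_n).

Lemma chi_irr mu s : psize mu = n ->
  'chi_(irr_part n mu) s = (chi mu (cycle_part s))%:~R :> algC.
Proof.
move=> mun; rewrite /chi; move: s; case: n / mun => s.
case: pickP => [t /eqP e|/(_ s)]; last by rewrite eqxx.
have [g ->] := cycle_type_conj e.
rewrite cfunJ ?inE // (irr_part_jt (erefl (psize mu)) (size_part_n (erefl (psize mu)))).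
by rewrite jt_cfunE intrKfloor.
Qed.

Lemma chi_eq0 mu eta : psize mu != psize eta -> chi mu eta = 0.
Proof.
move=> ne; rewrite /chi; case: pickP => [s /eqP e|] //.
by case/eqP: ne; rewrite -(psize_cycle_part s) /psize /= e.
Qed.

Lemma sign_cfunM_cfdot (phi psi : 'CF(G)) :
  '[sign_cfun n * phi, sign_cfun n * psi] = '[phi, psi].
Proof.
rewrite !cfdotE; congr (_ * _); apply: eq_bigr => s _.
by rewrite !cfunE rmorphM /= rmorph_sign mulrACA -signr_addb addbb mul1r.
Qed.

(** Multiplication by the sign exchanges, up to transposition, the two characters that define
    [irr_part]. The product is irreducible, indexed by some [lam], and both dominance inequalities
    between [lam] and the transpose of [mu] follow. *)
Lemma irr_part_conj mu : psize mu = n ->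
  'chi_(irr_part n (conj_part mu)) = sign_cfun n * 'chi_(irr_part n mu).
Proof.
move=> mun; have cmun : psize (conj_part mu) = n by rewrite psize_conj.
have [j ej] : exists j, sign_cfun n * 'chi_(irr_part n mu) = 'chi_j.
  by apply/irrP; rewrite mul_lin_irr ?sign_lin_char ?mem_irr.
have sgn2 : sign_cfun n * sign_cfun n = 1 :> 'CF(G).
  apply/cfun_inP => s Gs; rewrite cfunE cfun1E Gs !cfunE.
  by rewrite -signr_addb addbb.
have [lam lamn ejl] := irr_part_surj j.
have [mu1 mu2] := irr_partP mun; have [lam1 lam2] := irr_partP lamn.
rewrite ej -ejl; congr ('chi_(irr_part n _)).
apply: (@dominance_anti _ _ n.+1); rewrite ?size_part_n // => k kn; apply/eqP.
rewrite eqn_leq; apply/andP; split.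
  apply: (irr_part_hpart_dominance cmun lamn kn); rewrite ejl irr_consttE -ej.
  by rewrite -sign_cfunM_cfdot mulrA sgn2 mul1r -irr_consttE.
have := @cfdot_hcfun_dominance n n (fun j : 'I_n.+1 => nth 0%N lam j) (fun=> 0%N) (conj_part mu) k.
rewrite [X in (_ <= _ + X)%N]big1 // addn0 -(big_ord_widen n.+1 (fun i => nth 0%N lam i)) //.
apply; rewrite conj_partK; apply/eqP => e0.
have cj : j \in irr_constt (sign_cfun n * hpart n n mu).
  by rewrite irr_consttE -ej sign_cfunM_cfdot -irr_consttE.
move: lam1; rewrite ejl => cj'.
have := constt_ortho_char (hpart_char _ _ _) (sign_hpart_char _ _ _) cj' cj e0.
by rewrite cfnorm_irr => /eqP; rewrite oner_eq0.
Qed.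

End CharacterValues.

Lemma chi_conj mu eta : chi (conj_part mu) eta = (-1) ^+ (psize eta - size eta) * chi mu eta.
Proof.
case: (psize mu =P psize eta) => [e|/eqP ne]; last first.
  by rewrite !chi_eq0 ?mulr0 // psize_conj.
have [s es] := cycle_part_surj (erefl (psize eta)).
apply: (@intr_inj algC); rewrite rmorphM /= rmorphXn rmorphN1.
have := chi_irr s e; rewrite es => <-; have cm : psize (conj_part mu) = psize eta by rewrite psize_conj.
have := chi_irr s cm; rewrite es => <-; rewrite irr_part_conj // !cfunE.
by rewrite odd_perm_cycle_part es signr_odd.
Qed.

Lemma sum_chi_row mu nu : psize mu = psize nu ->
  \sum_(eta <- parts (psize mu)) (chi mu eta * chi nu eta) *+ class_size (psize mu) eta =
  ((psize mu)`! * (mu == nu))%:R.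
Proof.
move=> e; rewrite -(@sum_perm_parts (psize mu) _ (fun eta => chi mu eta * chi nu eta)).
apply: (@intr_inj algC); rewrite rmorph_sum /= rmorph_nat.
have := cfdot_irr (irr_part (psize mu) mu) (irr_part (psize mu) nu).
rewrite cfdotE cardsT card_Sn => /(canRL (mulVKf _)) h.
have f0 : ((psize mu)`!)%:R != 0 :> algC by rewrite pnatr_eq0 -lt0n fact_gt0.
rewrite natrM (_ : (mu == nu) = (irr_part (psize mu) mu == irr_part (psize mu) nu)); last first.
  by apply/eqP/eqP => [-> //|/irr_part_inj]; apply.
rewrite -h //; apply: eq_big => [s|s _]; first by rewrite inE.
by rewrite !chi_irr // rmorphM /= rmorph_int.
Qed.

(** Second orthogonality yields the order of the centralizer of a permutation of type [eta]; it is
    [z_eta] because the class has [n! / z_eta] elements. *)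
Lemma sum_chi_col eta zeta : psize eta = psize zeta ->
  \sum_(mu <- parts (psize eta)) chi mu eta * chi mu zeta = (zpart eta * (eta == zeta))%:R.
Proof.
set n := psize eta => e.
have [s es] := cycle_part_surj (erefl n : psize eta = n).
have [t et] := cycle_part_surj (esym e).
apply: (@intr_inj algC); rewrite rmorph_sum /= rmorph_nat.
have pe : perm_eq (map (irr_part n) (parts n)) (index_enum (Iirr [set: 'S_n]%G)).
  apply: uniq_perm; rewrite ?index_enum_uniq //.
    rewrite map_inj_in_uniq ?parts_uniq // => mu nu; rewrite !mem_parts => /eqP mun /eqP nun.
    exact: irr_part_inj.
  move=> i; rewrite mem_index_enum; have [mu mun <-] := irr_part_surj i.
  by rewrite map_f // mem_parts mun.
transitivity (\sum_i 'chi[[set: 'S_n]%G]_i s * ('chi_i t)^*).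
  rewrite -(perm_big _ pe) big_map; apply: eq_big_seq => mu; rewrite mem_parts => /eqP mun.
  by rewrite !chi_irr // es et rmorphM /= rmorph_int.
rewrite second_orthogonality_relation ?inE //.
have cs : (s \in (t ^: [set: 'S_n]%g)%g) = (eta == zeta).
  rewrite -es -et; apply/imsetP/eqP => [[g _ ->]|/esym/cycle_part_conj[g ->]].
    by rewrite cycle_partJ.
  by exists g; rewrite ?inE.
rewrite cs natrM; case: eqP => _; rewrite ?mulr0 ?mulr1 //=.
congr _%:R; apply/eqP.
have c0 : (0 < class_size n eta)%N by exact: class_size_gt0.
rewrite -(eqn_pmul2l c0) class_sizeE // -card_Sn -cardsT.
rewrite (_ : class_size n eta = #|(s ^: [set: 'S_n]%g)%g|).
  by rewrite -index_cent1 mulnC Lagrange ?subsetIl.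
rewrite /class_size -es; apply: eq_card => u; rewrite inE.
apply/eqP/imsetP => [/esym/cycle_part_conj[g ->]|[g _ ->]]; last by rewrite cycle_partJ.
by exists g; rewrite ?inE.
Qed.

(** * Values of Schur functions *)

Section SchurValues.
Variable R : comUnitRingType.
Hypothesis natu : forall n, n.+1%:R \is a @GRing.unit R.
Implicit Types (p q : nat -> R) (mu nu eta : part).

(** Unlike [schur_at], an explicit finite sum over a ring that may fail to be a field:
    specializations in polynomials are used below. *)
Definition sch p mu : R :=
  \sum_(eta <- parts (psize mu)) (chi mu eta)%:~R / (zpart eta)%:R * pprod p eta.

Lemma zpart_unit eta : (zpart eta)%:R \is a @GRing.unit R.
Proof. exact: natr_gt0_unit (zpart_gt0 eta). Qed.

Lemma fact_unit n : n`!%:R \is a @GRing.unit R.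
Proof. exact: natr_gt0_unit (fact_gt0 n). Qed.

Lemma class_size_div n eta : psize eta = n ->
  (class_size n eta)%:R = n`!%:R / (zpart eta)%:R :> R.
Proof.
move=> etan; apply: (canRL (mulrK (zpart_unit eta))).
by rewrite -natrM class_sizeE.
Qed.

Lemma schE p mu n : psize mu = n -> sch p mu = n`!%:R^-1 *
  \sum_(s : 'S_n) (chi mu (cycle_part s))%:~R * pprod p (cycle_part s).
Proof.
move=> mun; rewrite (@sum_perm_parts n _ (fun eta => (chi mu eta)%:~R * pprod p eta)).
rewrite mulr_sumr /sch mun; apply: eq_big_seq => eta; rewrite mem_parts => /eqP etan.
rewrite -[_ *+ class_size _ _]mulr_natr (class_size_div etan).
transitivity ((n`!%:R^-1 * n`!%:R) * ((chi mu eta)%:~R / (zpart eta)%:R * pprod p eta)).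
  by rewrite mulVr ?mul1r // fact_unit.
set f := n`!%:R^-1; set z := (zpart eta)%:R^-1; set g := n`!%:R; by ring.
Qed.

Lemma jt_val_chi n N (kap : part) s : psize kap = n -> (size kap <= N.+1)%N ->
  @jt_val n N kap s = chi kap (cycle_part s).
Proof.
move=> kapn kapN; apply: (@intr_inj algC).
by rewrite -jt_cfunE -(irr_part_jt kapn kapN) chi_irr.
Qed.

Lemma sch_alternant N (kap : part) (x : 'I_N.+1 -> R) : (size kap <= N.+1)%N ->
  sch (fun m => \sum_i x i ^+ m) kap * alternant x (@delta N) =
  alternant x (fun j => nth 0 kap j + delta j)%N.
Proof.
move=> kapN; rewrite (schE _ (erefl (psize kap))) -mulrA.
apply: (canLR (mulKr (fact_unit _))); rewrite -(sum_jt_alternant (erefl (psize kap)) kapN).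
congr (_ * _); apply: eq_bigr => s _.
by rewrite (jt_val_chi s (erefl (psize kap)) kapN) -perm_psum_pprod.
Qed.

Lemma pprodM p q eta : pprod (fun n => p n * q n) eta = pprod p eta * pprod q eta.
Proof. by rewrite /pprod big_split. Qed.

Lemma pprod_exp (c : R) eta : pprod (fun n => c ^+ n) eta = c ^+ psize eta.
Proof. by rewrite /pprod /psize sumnE -expr_sum. Qed.

Lemma pprod_const (c : R) eta : pprod (fun=> c) eta = c ^+ size eta.
Proof. by rewrite /pprod big_const_seq count_predT iter_mulr_1. Qed.

Lemma eq_pprod p q eta : (forall n, (0 < n)%N -> p n = q n) -> pprod p eta = pprod q eta.
Proof.
move=> pq; rewrite /pprod big_seq [RHS]big_seq; apply: eq_bigr => m /part_gt0; exact: pq.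
Qed.

Lemma eq_sch p q mu : (forall n, (0 < n)%N -> p n = q n) -> sch p mu = sch q mu.
Proof. by move=> pq; apply: eq_bigr => eta _; rewrite (eq_pprod _ pq). Qed.

Lemma schM_exp (c : R) p mu : sch (fun n => c ^+ n * p n) mu = c ^+ psize mu * sch p mu.
Proof.
rewrite /sch mulr_sumr; apply: eq_big_seq => eta; rewrite mem_parts => /eqP e.
by rewrite pprodM pprod_exp e mulrCA.
Qed.

(** The sign of a permutation is multiplicative over its cycles, a cycle of length [n] contributing
    [- (-1)^n]: this is the involution omega on power sums. *)
Lemma sch_conj p mu : sch p (conj_part mu) = sch (fun n => - (-1) ^+ n * p n) mu.
Proof.
rewrite /sch psize_conj; apply: eq_bigr => eta _; rewrite pprodM chi_conj.
rewrite (_ : pprod (fun n => - (-1) ^+ n) eta = (-1) ^+ (psize eta - size eta)).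
  rewrite rmorphM /= rmorphXn rmorphN1 mulrA; congr (_ * _).
  by rewrite [in RHS]mulrC mulrA.
transitivity (pprod (fun n => (-1) * (-1 : R) ^+ n) eta).
  by apply: eq_pprod => n _; rewrite mulN1r.
rewrite pprodM pprod_exp pprod_const -exprD -[LHS]signr_odd -[RHS]signr_odd.
by rewrite oddD oddB ?size_part // addbC.
Qed.

Lemma sch0 p : sch p part0 = 1.
Proof.
rewrite /sch parts0 big_seq1 zpart0 divr1 /pprod big_nil mulr1.
(* Orthogonality shows that the value squares to 1, and it is positive as the degree of a
   character. *)
have := sum_chi_col (erefl (psize part0)); rewrite parts0 big_seq1 zpart0 eqxx mul1n.
have [s es] : exists s : 'S_0, cycle_part s = part0 by exact: cycle_part_surj.
have s1 : s = 1%g by apply/permP => -[].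
have := irr1_gt0 (irr_part 0 part0); rewrite -s1 chi_irr // es ltr0z.
case: (chi part0 part0) => // -[|[|c]] //.
Qed.

Lemma pprod_sch p eta :
  pprod p eta = \sum_(mu <- parts (psize eta)) (chi mu eta)%:~R * sch p mu.
Proof.
transitivity (\sum_(mu <- parts (psize eta)) \sum_(zeta <- parts (psize eta))
   (chi mu eta * chi mu zeta)%:~R / (zpart zeta)%:R * pprod p zeta).
  rewrite exchange_big (bigD1_seq eta) ?parts_uniq ?mem_parts //=.
  rewrite [X in _ + X]big1_seq ?addr0 => [|zeta /andP[ne]].
    rewrite -!mulr_suml -rmorph_sum sum_chi_col // eqxx muln1 rmorph_nat divrr ?mul1r //.
    exact: zpart_unit.
  rewrite mem_parts => /eqP e; rewrite -!mulr_suml -rmorph_sum sum_chi_col //.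
  by rewrite eq_sym (negPf ne) muln0 !mul0r.
apply: eq_big_seq => mu; rewrite mem_parts => /eqP e; rewrite /sch e mulr_sumr.
by apply: eq_bigr => zeta _; rewrite rmorphM /= !mulrA.
Qed.

Lemma cauchy_sch p q n :
  \sum_(mu <- parts n) sch p mu * sch q mu = fcoef (hser (fun m => p m * q m)) n.
Proof.
rewrite /=; transitivity (\sum_(eta <- parts n) pprod p eta / (zpart eta)%:R *
   \sum_(mu <- parts n) (chi mu eta)%:~R * sch q mu).
  under [RHS]eq_bigr => eta _ do rewrite mulr_sumr.
  rewrite exchange_big /=; apply: eq_big_seq => mu; rewrite mem_parts => /eqP e.
  rewrite {1}/sch e mulr_suml; apply: eq_bigr => eta _.
  by rewrite mulrA; congr (_ * _); rewrite [in RHS]mulrC mulrA mulrAC.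
apply: eq_big_seq => eta; rewrite mem_parts => /eqP e.
by rewrite -{1}e -pprod_sch pprodM mulrAC.
Qed.

End SchurValues.

Lemma rmorph_sch (R S : comUnitRingType) (f : {rmorphism R -> S}) (p : nat -> R) mu :
  (forall n, n.+1%:R \is a @GRing.unit R) ->
  f (sch p mu) = sch (f \o p) mu.
Proof.
move=> natu; rewrite /sch rmorph_sum; apply: eq_bigr => eta _.
have fz : f (zpart eta)%:R^-1 = (zpart eta)%:R^-1.
  by rewrite rmorphV ?rmorph_nat // zpart_unit.
by rewrite 2!rmorphM /= fz rmorph_int /pprod rmorph_prod.
Qed.

Lemma prod_ltn_pair (R : comPzRingType) N (f : 'I_N.+1 -> R) :
  \prod_(i < N.+1) \prod_(j < N.+1 | (i < j)%N) (f i * f j) = \prod_(i < N.+1) f i ^+ N.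
Proof.
under eq_bigr => i _ do rewrite big_split /= prodr_const.
rewrite big_split /= [X in _ * X](exchange_big_dep predT) //= -big_split /=.
apply: eq_bigr => i _; rewrite prodr_const -exprD; congr (_ ^+ _).
pose A := [pred j : 'I_N.+1 | (i < j)%N]; pose B := [pred j : 'I_N.+1 | (j < i)%N].
suff : (#|A| + #|B|)%N = N by [].
apply: succn_inj; rewrite -[RHS](card_ord N.+1) -(cardC (pred1 i)) card1 add1n; congr _.+1.
rewrite -cardUI [X in (_ + X)%N]eq_card0 ?addn0.
  by apply: eq_card => j; rewrite inE /= !inE orbC -neq_ltn.
by move=> j; rewrite inE /= !inE; apply/negbTE/negP => /andP[ij /(ltn_trans ij)]; rewrite ltnn.
Qed.

(** * Principal specializations *)

Section QuantumDimension.
Variable K : fieldType.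
Hypothesis char0 : forall n, n.+1%:R != 0 :> K.
Variable t : K.
Hypotheses (t0 : t != 0) (t_inf : forall m, (0 < m)%N -> t ^+ m != 1).
Implicit Types (z w : int).

Let natu n : n.+1%:R \is a @GRing.unit K.
Proof. by rewrite unitfE char0. Qed.

(** The quantum number [[z]], with [t] in the role of [q^(1/2)]. *)
Definition qn z : K := t ^ z - t ^ (- z).

Lemma texp_neq1 z : z != 0 -> t ^ z != 1.
Proof.
case: z => [m|m] m0; first by rewrite -exprnP t_inf // lt0n.
by rewrite NegzE -invr_expz -exprnP invr_eq1 t_inf.
Qed.

Lemma qn_neq0 z : z != 0 -> qn z != 0.
Proof.
move=> z0; rewrite subr_eq0; apply/eqP => e.
have : t ^ (z + z) = 1 by rewrite expfzDr // {1}e -expfzDr // addNr expr0z.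
by apply/eqP/texp_neq1; rewrite -mulr2n mulrn_eq0.
Qed.

Lemma qnN z : qn (- z) = - qn z.
Proof. by rewrite /qn opprK opprB. Qed.

(** For this geometric progression exponents and variables change places: row [i] is [t^(- N a_i)]
    times the powers of [t^(2 a_i)], and a Vandermonde determinant appears. Its differences are
    [t^(a_i + a_j) [a_j - a_i]], and the powers of [t] cancel, every index lying in [N] pairs. *)
Lemma alternant_qn N (a : 'I_N.+1 -> nat) :
  alternant (fun k : 'I_N.+1 => t ^ ((k + k)%:Z - N%:Z)) a =
  \prod_(i < N.+1) \prod_(j < N.+1 | (i < j)%N) qn ((a j)%:Z - (a i)%:Z).
Proof.
pose b : 'rV[K]_N.+1 := \row_i t ^+ (a i + a i).
pose d : 'rV[K]_N.+1 := \row_i (t ^ (- (a i)%:Z)) ^+ N.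
have -> : alternant (fun k : 'I_N.+1 => t ^ ((k + k)%:Z - N%:Z)) a =
    \prod_i d 0 i * \det (Vandermonde N.+1 b).
  rewrite -det_diag -[X in _ * X]det_tr -det_mulmx; congr (\det _).
  apply/matrixP => i k; rewrite mul_diag_mx !mxE.
  rewrite -!exprM !exprnP !exprz_exp -expfzDr //; congr (_ ^ _).
  by rewrite !PoszM !PoszD; ring.
rewrite det_Vandermonde.
transitivity (\prod_i d 0 i * \prod_(i < N.+1) \prod_(j < N.+1 | (i < j)%N)
   ((t ^+ a i * t ^+ a j) * qn ((a j)%:Z - (a i)%:Z))).
  congr (_ * _); apply: eq_bigr => i _; apply: eq_bigr => j _; rewrite !mxE /qn mulrBr.
  rewrite !exprnP -!expfzDr //; congr (t ^ _ - t ^ _); rewrite !PoszD; ring.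
under [X in _ * X]eq_bigr => i _ do rewrite big_split /=.
rewrite big_split /= mulrA prod_ltn_pair -big_split /= big1 ?mul1r // => i _.
by rewrite mxE -exprMn [t ^+ a i]exprnP -expfzDr // addNr expr0z expr1n.
Qed.

Lemma prod_qn_telescope (i m N : nat) :
  \prod_(1 <= k < m.+1) qn (k%:Z - i.+1%:Z + N.+1%:Z) * qn (N%:Z - i%:Z) =
  \prod_(1 <= k < m.+1) qn (k%:Z - i.+1%:Z + N%:Z) * qn (m%:Z + N%:Z - i%:Z).
Proof.
elim: m => [|m IH]; first by rewrite !big_geq // add0r.
rewrite [in LHS](big_nat_recr m.+1) // [in RHS](big_nat_recr m.+1) //=.
rewrite mulrAC IH mulrAC -!mulrA; congr (_ * _).
rewrite mulrC; congr (qn _ * qn _); rewrite -!PoszD; lia.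
Qed.

Definition qfactor mu : K :=
  \prod_(i < size mu) \prod_(j < size mu | (i < j)%N)
    (qn ((nth 0%N mu i)%:Z - (nth 0%N mu j)%:Z + j%:Z - i%:Z) / qn (j%:Z - i%:Z)).

(** The product of [[N + c]] over the boxes of [mu], with [c] the content of the box: [k] counts
    columns from 1 and [i] rows from 0. *)
Definition qbox mu (N : nat) : K :=
  \prod_(i < size mu) \prod_(1 <= k < (nth 0%N mu i).+1) qn (k%:Z - i.+1%:Z + N%:Z).

Lemma qn_nat_neq0 z : 0 < z -> qn z != 0.
Proof. by move=> z0; apply: qn_neq0; rewrite gt_eqF. Qed.

(** Induction on the number of rows. An empty row [N] adds the factors [[mu_i + N - i] / [N - i]],
    each the telescoped effect on the boxes of row [i] of replacing [N] by [N + 1]. *)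
Lemma prod_qn_hook (mu : part) N : (size mu <= N)%N ->
  (\prod_(i < N) \prod_(j < N | (i < j)%N)
    (qn ((nth 0%N mu i)%:Z - (nth 0%N mu j)%:Z + j%:Z - i%:Z) / qn (j%:Z - i%:Z))) *
  qbox mu (size mu) = qfactor mu * qbox mu N.
Proof.
elim: N => [|N IH] muN; first by move: muN; rewrite leqn0 /qfactor => /eqP ->.
move: muN; rewrite leq_eqVlt => /orP[/eqP <- //|]; rewrite ltnS => muN.
pose F (i j : nat) := qn ((nth 0%N mu i)%:Z - (nth 0%N mu j)%:Z + j%:Z - i%:Z) / qn (j%:Z - i%:Z).
have -> : \prod_(i < N.+1) \prod_(j < N.+1 | (i < j)%N) F i j =
   \prod_(i < N) \prod_(j < N | (i < j)%N) F i j * \prod_(i < size mu) F i N.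
  rewrite big_ord_recr /= [X in _ * X]big1 ?mulr1; last by move=> j; rewrite ltnNge -ltnS ltn_ord.
  under eq_bigr => i _ do rewrite big_mkcond big_ord_recr /= ltn_ord -big_mkcond /=.
  rewrite big_split /=; congr (_ * _).
  rewrite [RHS](big_ord_widen N (fun i => F i N)) // [RHS]big_mkcond /=; apply: eq_bigr => i _.
  case: ltnP => // mui; rewrite /F !nth_default ?(leq_trans mui) //; last exact: ltnW.
  by rewrite subrr add0r divff // qn_nat_neq0 // subr_gt0 ltz_nat.
rewrite mulrAC IH // -mulrA; congr (_ * _); rewrite /qbox -big_split /=.
apply: eq_bigr => i _; have iN : (i < N)%N := leq_trans (ltn_ord i) muN.
have q0 : qn (N%:Z - i%:Z) != 0 by rewrite qn_nat_neq0 // subr_gt0 ltz_nat.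
rewrite /F (_ : (nth 0%N mu N)%:Z = 0); last by rewrite nth_default.
by rewrite subr0 mulrA -prod_qn_telescope mulfK.
Qed.

Lemma sch_qn_nat (mu : part) N : (size mu <= N.+1)%N ->
  sch (fun m => qn (m * N.+1)%:Z / qn m%:Z) mu * qbox mu (size mu) = qfactor mu * qbox mu N.+1.
Proof.
move=> muN; rewrite -prod_qn_hook //; congr (_ * _).
pose x (k : 'I_N.+1) := t ^ ((k + k)%:Z - N%:Z).
have -> : sch (fun m => qn (m * N.+1)%:Z / qn m%:Z) mu = sch (fun m => \sum_i x i ^+ m) mu.
  apply: eq_sch => m m0; have q0 : qn m%:Z != 0 by rewrite qn_nat_neq0 ?ltz_nat.
  apply: (canLR (mulfK q0)); rewrite mulr_suml.
  (* The difference of [g] at [k.+1] and [k] is [x k ^+ m] times [[m]], so that [[m (N + 1)] / [m]]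
     is the power sum of the [x k]. *)
  pose g (k : nat) : K := t ^ (m%:Z * ((k + k)%:Z - N.+1%:Z)).
  transitivity (g N.+1 - g 0%N).
    rewrite /g /qn; congr (t ^ _ - t ^ _); rewrite ?PoszM ?PoszD; ring.
  rewrite -telescope_sumr // big_mkord; apply: eq_bigr => k _.
  have -> : x k ^+ m = t ^ (((k + k)%:Z - N%:Z) * m%:Z) by rewrite exprnP exprz_exp.
  rewrite /g /qn [RHS]mulrBr.
  rewrite -!expfzDr //.
  congr (t ^ _ - t ^ _); rewrite ?PoszM ?PoszD; ring.
have d0 : alternant x (@delta N) != 0.
  rewrite alternant_qn; apply/prodf_neq0 => i _; apply/prodf_neq0 => j ij.
  have dlt : (delta j < delta i)%N.
    by apply: ltn_sub2l => //; apply: leq_trans ij _; rewrite -ltnS.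
  by apply: qn_neq0; rewrite subr_eq0 eqz_nat ltn_eqF.
apply: (mulIf d0); rewrite (sch_alternant natu x muN) !alternant_qn -big_split /=.
apply: eq_bigr => i _; rewrite -big_split /=; apply: eq_bigr => j ij.
have di (k : 'I_N.+1) : (delta k)%:Z = N%:Z - k%:Z by rewrite /delta -subzn // -ltnS.
have qij : qn (j%:Z - i%:Z) != 0 by rewrite qn_nat_neq0 // subr_gt0 ltz_nat.
rewrite !PoszD !di (_ : N%:Z - j%:Z - (N%:Z - i%:Z) = - (j%:Z - i%:Z)); last by ring.
rewrite qnN mulrN divfK // -qnN; congr qn; ring.
Qed.

Lemma qbox_size_neq0 (mu : part) : qbox mu (size mu) != 0.
Proof.
apply/prodf_neq0 => i _; rewrite prodf_seq_neq0; apply/allP => -[|k]; rewrite mem_index_iota //= => _.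
rewrite qn_nat_neq0 //; have := ltn_ord i; lia.
Qed.

Definition qcoef mu : K := qfactor mu / qbox mu (size mu).

Lemma poly_eq_inj (p q : {poly K}) (f : nat -> K) : injective f ->
  (forall N, p.[f N] = q.[f N]) -> p = q.
Proof.
move=> f_inj pq; apply/eqP; rewrite -subr_eq0; apply: contraT => ne0.
have : (size (map f (iota 0 (size (p - q)%R))) < size (p - q)%R)%N.
  apply: max_poly_roots => //; last by rewrite map_inj_uniq ?iota_uniq.
  by apply/allP => _ /mapP[N _ ->]; rewrite /root hornerD hornerN pq subrr.
by rewrite size_map size_iota ltnn.
Qed.

Lemma texp_inj : injective (fun z : int => t ^ z).
Proof.
move=> x y /= e; apply/eqP; rewrite -subr_eq0; apply/negPn/negP => /texp_neq1.
by rewrite expfzDr // e -expfzDr // subrr expr0z eqxx.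
Qed.

Let polyu n : n.+1%:R \is a @GRing.unit {poly K}.
Proof. by rewrite -polyC_natr poly_unitE coefC /= unitfE char0 size_polyC char0. Qed.

Local Notation vsum := (fun m : nat => (1 - 'X^m) * (qn m%:Z)^-1%:P : {poly K}).

(* At [X = t ^- (2 N + 2)] the left-hand side is, up to a power of [t], the Schur
   function at the [N + 1] variables [t ^ (2 k - N)]. *)
Lemma sch_quantum_dim (mu : part) :
  sch vsum mu = (qcoef mu)%:P * \prod_(i < size mu) \prod_(1 <= k < (nth 0%N mu i).+1)
     ((t ^ (k%:Z - i.+1%:Z))%:P - (t ^ (- (k%:Z - i.+1%:Z)))%:P * 'X).
Proof.
set P := _ * \prod_(i < _) _.
pose v N := t ^ (- (N.+1 + N.+1)%:Z).
suff ev N : (size mu <= N.+1)%N -> (sch vsum mu).[v N] = P.[v N].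
  (* The shift by [size mu] secures the number of variables that [ev] requires. *)
  apply: (@poly_eq_inj _ _ (fun N => v (N + size mu)%N)).
    by move=> M N /texp_inj /=; lia.
  by move=> N; apply: ev; rewrite leqW // leq_addl.
move=> muN; set w := t ^ (- N.+1%:Z).
have w2 : v N = w * w by rewrite /w -expfzDr //; congr (t ^ _); rewrite PoszD; ring.
rewrite -[LHS]/(horner_eval (v N) (sch vsum mu)) rmorph_sch //.
rewrite (eq_sch _ (q := fun m => w ^+ m * (qn (m * N.+1)%:Z / qn m%:Z))); last first.
  move=> m m0; rewrite /= /horner_eval hornerM hornerC mulrA; congr (_ / _).
  rewrite !hornerE /w /v /qn mulrBr !exprnP !exprz_exp -!expfzDr //; congr (_ - t ^ _).
    by rewrite (_ : _ + _ = 0) ?expr0z // PoszM; ring.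
  by rewrite PoszM PoszD; ring.
rewrite schM_exp /P hornerM hornerC /qcoef horner_prod.
have e := sch_qn_nat muN; rewrite (canRL (mulfK (qbox_size_neq0 mu)) e) mulrCA.
set B := \prod_(i < size mu) _; have -> : B = w ^+ psize mu * qbox mu N.+1.
  rewrite (psizeE (leqnn (size mu))) expr_sum /qbox -big_split /=; apply: eq_bigr => i _.
  rewrite horner_prod -[X in w ^+ X]subn0 -subSS -prodr_const_nat -big_split /=.
  apply: eq_bigr => k _; rewrite !hornerE /qn [RHS]mulrBr /w /v -!expfzDr //.
  congr (t ^ _ - t ^ _); rewrite ?PoszD; ring.
by rewrite !mulrA; set b := (qbox mu (size mu))^-1; ring.
Qed.

Lemma horner_sch_vsum (x : K) nu : (sch vsum nu).[x] = sch (fun m => (1 - x ^+ m) / qn m%:Z) nu.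
Proof.
rewrite -[LHS]/(horner_eval x (sch vsum nu)) rmorph_sch //; apply: eq_sch => m _.
by rewrite /= /horner_eval !hornerE.
Qed.

(** By [sch_conj] the transpose replaces [(1 - x^m) / [m]] by [(- x)^m (1 - x^(- m)) / [m]], which
    is the same specialization at [1 / x]: each linear factor has its two coefficients exchanged.
    The points [t^N] are used because they are invertible. *)
Lemma sch_quantum_dim_conj (mu : part) :
  sch vsum (conj_part mu) = (qcoef mu)%:P * \prod_(i < size mu) \prod_(1 <= k < (nth 0%N mu i).+1)
     ((t ^ (- (k%:Z - i.+1%:Z)))%:P - (t ^ (k%:Z - i.+1%:Z))%:P * 'X).
Proof.
apply: (@poly_eq_inj _ _ (fun N => t ^ N%:Z)) => [M N /texp_inj []//|N].
set v := t ^ N; have v0 : v != 0 by rewrite expfz_neq0.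
rewrite horner_sch_vsum sch_conj (eq_sch _ (q := fun m => (- v) ^+ m * ((1 - v^-1 ^+ m) / qn m%:Z))); last first.
  move=> m _; rewrite (exprNn v) exprVn.
  have vm : v ^+ m != 0 by rewrite expf_neq0.
  by set c := (qn m%:Z)^-1; field.
rewrite schM_exp -horner_sch_vsum sch_quantum_dim !hornerM !hornerC mulrCA; congr (_ * _).
rewrite !horner_prod (psizeE (leqnn (size mu))) expr_sum -big_split /=; apply: eq_bigr => i _.
rewrite !horner_prod -[X in _ ^+ X * _]subn0 -subSS -prodr_const_nat -big_split /=.
apply: eq_bigr => k _; rewrite !hornerE; set b := t ^ (- _); set c := t ^ _.
by field.
Qed.

Definition boxsum (mu : part) : int :=
  \sum_(i < size mu) \sum_(1 <= k < (nth 0%N mu i).+1) (k%:Z - i.+1%:Z).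

Lemma kappa_boxsum (mu : part) : kappa mu = boxsum mu + boxsum mu.
Proof.
rewrite /kappa /boxsum -big_split; apply: eq_bigr => i _ /=.
elim: (nth 0%N mu i) => [|m IH]; first by rewrite big_geq // mul0r addr0.
by rewrite big_nat_recr //= addrACA -IH -[m.+1]addn1 PoszD; ring.
Qed.

Lemma prod_box_exp (mu : part) (c : int) :
  \prod_(i < size mu) \prod_(1 <= k < (nth 0%N mu i).+1) t ^ (c * (k%:Z - i.+1%:Z)) = t ^ (c * boxsum mu).
Proof.
have texpD x y : t ^ (x + y) = t ^ x * t ^ y by rewrite expfzDr.
rewrite /boxsum mulr_sumr (big_morph (fun z : int => t ^ z) texpD (expr0z t)).
apply: eq_bigr => i _; rewrite mulr_sumr (big_morph (fun z : int => t ^ z) texpD (expr0z t)) //.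
Qed.

Lemma qcoef_neq0 (mu : part) : qcoef mu != 0.
Proof.
rewrite mulf_neq0 ?invr_eq0 ?qbox_size_neq0 //.
apply/prodf_neq0 => i _; apply/prodf_neq0 => j ij.
have mij := part_geq mu (ltnW ij).
rewrite mulf_neq0 ?invr_eq0 ?qn_nat_neq0 ?subr_gt0 ?ltz_nat //.
by rewrite -subr_gt0 -addrA ltr_wpDl ?subr_ge0 ?lez_nat ?subr_gt0 ?ltz_nat.
Qed.

Lemma sch_rhoE nu : sch (fun m => (qn m%:Z)^-1) nu = (sch vsum nu).[0].
Proof.
rewrite horner_sch_vsum; apply: eq_sch => m m0.
by rewrite expr0n eqn0Ngt m0 subr0 mul1r.
Qed.

Lemma sch_rho (mu : part) : sch (fun m => (qn m%:Z)^-1) mu = qcoef mu * t ^ boxsum mu.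
Proof.
rewrite sch_rhoE sch_quantum_dim hornerM hornerC; congr (_ * _).
rewrite -[boxsum mu]mul1r -prod_box_exp horner_prod; apply: eq_bigr => i _.
by rewrite horner_prod; apply: eq_bigr => k _; rewrite !hornerE ?mulr0 ?subr0 ?mul1r.
Qed.

(** At [X = 0] the product formulas for [mu] and its transpose differ only by the signs of the
    contents in the exponents of [t], and [kappa mu] is twice the total content. *)
Lemma sch_rho_conj (mu : part) :
  sch (fun m => (qn m%:Z)^-1) (conj_part mu) = t ^ (- kappa mu) * sch (fun m => (qn m%:Z)^-1) mu.
Proof.
rewrite [in RHS]sch_rho mulrCA -expfzDr // kappa_boxsum opprD addrNK.
rewrite sch_rhoE sch_quantum_dim_conj hornerM hornerC; congr (_ * _).
rewrite -[- boxsum mu]mulN1r -prod_box_exp horner_prod; apply: eq_bigr => i _.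
by rewrite horner_prod; apply: eq_bigr => k _; rewrite !hornerE ?mulr0 ?subr0 mulN1r.
Qed.

Lemma sch_rho_neq0 (mu : part) : sch (fun m => (qn m%:Z)^-1) mu != 0.
Proof. by rewrite sch_rho mulf_neq0 ?qcoef_neq0 ?expfz_neq0. Qed.

(** Using [sch_rho_conj] twice shows that [t] to the power [kappa mu + kappa (conj_part mu)] is 1,
    and [t] has infinite order. *)
Lemma kappa_conj (mu : part) : kappa (conj_part mu) = - kappa mu.
Proof.
have := sch_rho_conj (conj_part mu); rewrite conj_partK sch_rho_conj mulrA.
rewrite -[LHS]mul1r => /(mulIf (sch_rho_neq0 mu)); rewrite -expfzDr //.
move=> /esym e; apply/eqP; rewrite -addr_eq0 -oppr_eq0 opprD.
by apply: contraT => /texp_neq1; rewrite e eqxx.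
Qed.

(** The left-hand side is what the dual Cauchy sum at [q^(mu + rho)] leaves. Taking [t^c] out of the
    factor of a box of content [c] gives a factor of the transposed product formula; these powers of
    [t] and those in [s_mu(q^rho)] make up [t^(kappa mu)]. *)
Lemma sch_rho_boxes (mu : part) :
  (sch (fun m => (qn m%:Z)^-1) mu)%:P * \prod_(i < size mu) \prod_(1 <= k < (nth 0%N mu i).+1)
     (1 - (t ^ (2 * (k%:Z - i.+1%:Z)))%:P * 'X) = (t ^ kappa mu)%:P * sch vsum (conj_part mu).
Proof.
rewrite sch_quantum_dim_conj sch_rho kappa_boxsum [(qcoef mu * _)%:P]polyCM.
rewrite mulrCA -mulrA; congr (_ * _); rewrite expfzDr // polyCM -mulrA; congr (_ * _).
rewrite -[X in (t ^ X)%:P]mul1r -prod_box_exp rmorph_prod -big_split /=; apply: eq_bigr => i _.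
rewrite rmorph_prod -big_split /=; apply: eq_bigr => k _; rewrite mul1r [RHS]mulrBr -polyCM mulrA -polyCM.
rewrite -!expfzDr // subrr expr0z polyC1; congr (_ - (t ^ _)%:P * _); ring.
Qed.

End QuantumDimension.

(** * Littlewood-Richardson coefficients *)

Definition partsle (n : nat) : seq part := flatten [seq parts j | j <- iota 0 n.+1].

Lemma mem_partsle n mu : (mu \in partsle n) = (psize mu <= n)%N.
Proof.
apply/flatten_mapP/idP => [[j]|mun].
  by rewrite mem_iota add0n ltnS mem_parts => jn /eqP ->.
by exists (psize mu); rewrite ?mem_iota ?mem_parts ?add0n.
Qed.

Lemma partsle_uniq n : uniq (partsle n).
Proof.
rewrite /partsle; elim: (iota 0 n.+1) (iota_uniq 0 n.+1) => //= j s IH /andP[js us].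
rewrite cat_uniq parts_uniq IH // andbT /=; apply/hasPn => mu /flatten_mapP[i is_].
rewrite !mem_parts => /eqP ->; by apply: contraNneq js => <-.
Qed.

Section PartSums.
Variable V : nmodType.

Lemma sum_parts_partsle n j (F : part -> V) : (j <= n)%N ->
  \sum_(mu <- parts j) F mu = \sum_(mu <- partsle n | psize mu == j) F mu.
Proof.
move=> jn; rewrite -[RHS]big_filter; apply: perm_big; apply: uniq_perm.
- exact: parts_uniq.
- by rewrite filter_uniq ?partsle_uniq.
move=> mu; rewrite mem_parts mem_filter mem_partsle; case: eqP => [->|//]; by rewrite jn.
Qed.

Lemma exchange_partsle n (F : part -> part -> V) :
  \sum_(mu <- partsle n) \sum_(nu <- parts (psize mu)) F mu nu =
  \sum_(nu <- partsle n) \sum_(mu <- parts (psize nu)) F mu nu.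
Proof.
rewrite big_seq (eq_bigr (fun mu => \sum_(nu <- partsle n | psize nu == psize mu) F mu nu)); last first.
  by move=> mu; rewrite mem_partsle => mun; rewrite (sum_parts_partsle _ mun).
rewrite -big_seq [RHS]big_seq.
rewrite [RHS](eq_bigr (fun nu => \sum_(mu <- partsle n | psize mu == psize nu) F mu nu)); last first.
  by move=> mu; rewrite mem_partsle => mun; rewrite (sum_parts_partsle _ mun).
rewrite -big_seq (exchange_big_dep predT) //=; apply: eq_bigr => nu _.
by apply: eq_bigl => mu; rewrite eq_sym.
Qed.

Lemma sum_partsle_pcons n k (G : part -> V) :
  (forall mu : part, k.+1 \notin (mu : seq nat) -> G mu = 0) ->
  (forall mu : part, (n < psize mu)%N -> G mu = 0) ->
  \sum_(mu <- partsle n) G mu = \sum_(mu <- partsle n) G (pcons k mu).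
Proof.
move=> G0 Gn; rewrite (bigID (fun mu : part => k.+1 \in (mu : seq nat))) /= addrC big1 ?add0r; last first.
  by move=> mu /G0.
rewrite [RHS](bigID (fun mu => psize (pcons k mu) <= n)%N) /= [X in _ + X]big1 ?addr0; last first.
  by move=> mu; rewrite -ltnNge => /Gn.
rewrite -big_filter -[RHS]big_filter -[RHS](big_map (pcons k) predT).
apply: perm_big; apply: uniq_perm.
- by rewrite filter_uniq ?partsle_uniq.
- by rewrite map_inj_uniq ?filter_uniq ?partsle_uniq //; exact: pcons_inj.
move=> mu; rewrite mem_filter mem_partsle; apply/andP/mapP => [[/pcons_surj[nu ->] e]|[nu]].
  exists nu; rewrite // mem_filter e mem_partsle; apply: leq_trans e.
  by rewrite psize_pcons leq_addl.
rewrite mem_filter => /andP[e _] ->; split=> //.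
by rewrite (perm_mem (perm_pcons k nu)) mem_head.
Qed.

End PartSums.

Lemma cat_partC mu nu : cat_part mu nu = cat_part nu mu.
Proof.
apply: perm_part; rewrite (permPl (perm_cat_part _ _)) (permPr (perm_cat_part _ _)).
by rewrite perm_catC.
Qed.

Lemma cat_part_pcons k mu nu : cat_part (pcons k mu) nu = pcons k (cat_part mu nu).
Proof.
apply/perm_part/seq.permP => q; rewrite (seq.permP (perm_cat_part _ _)) (seq.permP (perm_pcons _ _)).
rewrite count_cat (seq.permP (perm_pcons _ _)) /= -addnA; congr (_ + _)%N.
by rewrite -count_cat -(seq.permP (perm_cat_part mu nu)).
Qed.

Section LittlewoodRichardson.
Variable R : comUnitRingType.
Hypothesis natu : forall n, n.+1%:R \is a @GRing.unit R.
Implicit Types (p y : nat -> R) (lam mu nu eta : part).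

Definition schc mu eta : R := (chi mu eta)%:~R / (zpart eta)%:R.

Definition LRc lam mu nu : R :=
  \sum_(a <- parts (psize mu)) \sum_(b <- parts (psize nu))
    (zpart (cat_part a b))%:R * (schc mu a * schc nu b) * schc lam (cat_part a b).

Lemma schc_eq0 mu eta : psize mu != psize eta -> schc mu eta = 0.
Proof. by move=> ne; rewrite /schc chi_eq0 // mul0r. Qed.

Lemma LRc_eq0 lam mu nu : psize lam != (psize mu + psize nu)%N -> LRc lam mu nu = 0.
Proof.
move=> ne; rewrite /LRc big1_seq // => a /andP[_]; rewrite mem_parts => /eqP ea.
rewrite big1_seq // => b /andP[_]; rewrite mem_parts => /eqP eb.
by rewrite (@schc_eq0 lam) ?mulr0 // psize_cat ea eb.
Qed.

Lemma schE_schc p mu : sch p mu = \sum_(eta <- parts (psize mu)) schc mu eta * pprod p eta.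
Proof. by []. Qed.

Lemma sum_schc_sch p eta :
  \sum_(mu <- parts (psize eta)) schc mu eta * sch p mu = pprod p eta / (zpart eta)%:R.
Proof.
rewrite (pprod_sch natu) mulr_suml; apply: eq_bigr => mu _.
by rewrite /schc mulrAC.
Qed.

Lemma pprod_cat p mu nu : pprod p (cat_part mu nu) = pprod p mu * pprod p nu.
Proof. by rewrite /pprod (perm_big _ (perm_cat_part mu nu)) big_cat. Qed.

Lemma sum_LRc_sch p mu nu :
  \sum_(lam <- parts (psize mu + psize nu)) LRc lam mu nu * sch p lam = sch p mu * sch p nu.
Proof.
rewrite (schE_schc p mu) (schE_schc p nu) big_distrlr /=.
under eq_bigr => lam _ do rewrite mulr_suml.
rewrite exchange_big /=; apply: eq_big_seq => a; rewrite mem_parts => /eqP ea.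
under eq_bigr => lam _ do rewrite mulr_suml.
rewrite exchange_big /=; apply: eq_big_seq => b; rewrite mem_parts => /eqP eb.
under eq_bigr => lam _ do rewrite -mulrA.
rewrite -mulr_sumr -ea -eb -psize_cat sum_schc_sch pprod_cat.
have zu := zpart_unit natu (cat_part a b).
rewrite mulrC -!mulrA [_^-1 * _]mulrA mulVr // mul1r.
by rewrite /schc; ring.
Qed.

Definition zprod p (eta : part) : R := pprod p eta / (zpart eta)%:R.

Lemma zprod_pcons p k eta :
  (k.+1 * count_mem k.+1 (pcons k eta))%:R * zprod p (pcons k eta) = p k.+1 * zprod p eta.
Proof.
rewrite /zprod pprod_pcons count_pcons eqxx add1n zpart_pcons [X in _ / X]natrM.
have v : (k.+1 * (count_mem k.+1 eta).+1)%:R \is a @GRing.unit R by rewrite natrM unitrM !natu.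
by rewrite invrM ?zpart_unit // mulrC -!mulrA mulVr // mulr1.
Qed.

Lemma zprod0 p : zprod p part0 = 1.
Proof. by rewrite /zprod zpart0 divr1 /pprod big_nil. Qed.

Lemma sum_zprod_cat_pcons y p n k eta : (psize (pcons k eta) <= n)%N ->
  \sum_(a <- partsle n) \sum_(b <- partsle n) (cat_part a b == pcons k eta)%:R *
     ((k.+1 * count_mem k.+1 a)%:R * zprod y a * zprod p b) =
  y k.+1 * \sum_(a <- partsle n) \sum_(b <- partsle n) (cat_part a b == eta)%:R * (zprod y a * zprod p b).
Proof.
move=> en; rewrite (@sum_partsle_pcons _ n k).
- rewrite mulr_sumr; apply: eq_bigr => a _; rewrite mulr_sumr; apply: eq_bigr => b _.
  rewrite cat_part_pcons (inj_eq (@pcons_inj k)) zprod_pcons.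
  by ring.
- move=> a ka; rewrite big1 // => b _.
  by move/count_memPn: ka => ->; rewrite muln0 !mul0r mulr0.
- move=> a na; rewrite big1 // => b _; case: eqP => [e|_]; last by rewrite mul0r.
  by move: en; rewrite -e psize_cat leqNgt (leq_trans na) // leq_addr.
Qed.

(* Multiplication by [k m_k (eta) = k m_k (a) + k m_k (b)] removes a part [k] from
   [a] or from [b]. *)
Lemma sum_zprod_cat y p n eta : (psize eta <= n)%N ->
  \sum_(a <- partsle n) \sum_(b <- partsle n) (cat_part a b == eta)%:R * (zprod y a * zprod p b) =
  zprod (fun m => y m + p m) eta.
Proof.
have [m] := ubnP (psize eta); elim: m eta => // m IH eta em en.
case e : (pval eta) => [|j s].
  have -> : eta = part0 by exact: val_inj.
  rewrite (bigD1_seq part0) ?partsle_uniq ?mem_partsle //= (bigD1_seq part0) ?partsle_uniq ?mem_partsle //=.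
  have cat0 a b : (cat_part a b == part0) = (a == part0) && (b == part0).
    apply/eqP/andP => [|[/eqP -> /eqP ->]]; last exact: val_inj.
    move=> /(congr1 (fun c : part => size c)); rewrite size_cat_part /= => /eqP.
    rewrite addn_eq0 !size_eq0 => /andP[/eqP a0 /eqP b0].
    by split; apply/eqP/val_inj.
  rewrite mul1r !zprod0 mulr1 !big1 ?addr0 // => [a /negPf na|b /negPf nb].
    by rewrite big1 // => b _; rewrite cat0 na mul0r.
  by rewrite cat0 nb andbF mul0r.
have j0 : (0 < j)%N by apply: (@part_gt0 eta); rewrite e mem_head.
have [k ek] : exists k, j = k.+1 by exists j.-1; rewrite prednK.
have [nu enu] : exists nu, eta = pcons k nu by apply: pcons_surj; rewrite e ek mem_head.
rewrite {}enu in em en *; have nun : (psize nu < psize (pcons k nu))%N by rewrite psize_pcons ltnS leq_addl.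
have IHnu := IH nu (leq_trans nun em) (leq_trans (ltnW nun) en).
have E1 := sum_zprod_cat_pcons y p en; rewrite IHnu in E1.
have E2 : \sum_(a <- partsle n) \sum_(b <- partsle n) (cat_part a b == pcons k nu)%:R *
     (zprod y a * ((k.+1 * count_mem k.+1 b)%:R * zprod p b)) = p k.+1 * zprod (fun m => y m + p m) nu.
  rewrite -IHnu exchange_big /= [in RHS]exchange_big /=.
  under [in RHS]eq_bigr => b _ do under eq_bigr => a _ do rewrite cat_partC [zprod y a * _]mulrC.
  rewrite -(sum_zprod_cat_pcons p y en); apply: eq_bigr => b _; apply: eq_bigr => a _.
  by rewrite cat_partC; congr (_ * _); rewrite mulrC.
have u : (k.+1 * count_mem k.+1 (pcons k nu))%:R \is a @GRing.unit R.
  by rewrite count_pcons eqxx natrM unitrM !natu.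
apply: (mulrI u); rewrite zprod_pcons mulrDl -E1 -E2 -big_split mulr_sumr /=.
apply: eq_bigr => a _; rewrite -big_split mulr_sumr /=; apply: eq_bigr => b _.
case: eqP => [eab|_]; last by rewrite !mul0r mulr0 addr0.
rewrite -[sort geq _]/(pval (pcons k nu)) -eab (seq.permP (perm_cat_part a b)) count_cat mulnDr natrD.
by ring.
Qed.

(** The coproduct of [s_lam] is dual to multiplication under the Hall pairing, so the coefficients
    of products appear again. In the basis [p_eta / z_eta] it splits a multiset of parts in two,
    which is [sum_zprod_cat]. *)
Lemma sum_LRc_schD y p lam n : (psize lam <= n)%N ->
  \sum_(eta <- partsle n) \sum_(alpha <- partsle n) LRc lam eta alpha * (sch y eta * sch p alpha) =
  sch (fun m => y m + p m) lam.
Proof.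
move=> ln; pose F a b : R := (zpart (cat_part a b))%:R * schc lam (cat_part a b).
transitivity (\sum_(a <- partsle n) \sum_(b <- partsle n) F a b * (zprod y a * zprod p b)).
  transitivity (\sum_(eta <- partsle n) \sum_(a <- parts (psize eta))
     \sum_(alpha <- partsle n) \sum_(b <- parts (psize alpha))
        F a b * ((schc eta a * sch y eta) * (schc alpha b * sch p alpha))).
    apply: eq_bigr => eta _; rewrite exchange_big /=; apply: eq_bigr => alpha _.
    rewrite /LRc mulr_suml; apply: eq_bigr => a _; rewrite mulr_suml; apply: eq_bigr => b _.
    by rewrite /F; ring.
  rewrite (exchange_partsle n (fun eta a => \sum_(alpha <- partsle n) \sum_(b <- parts (psize alpha))
        F a b * ((schc eta a * sch y eta) * (schc alpha b * sch p alpha)))).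
  apply: eq_bigr => a _; rewrite exchange_big /=.
  under eq_bigr => alpha _ do rewrite exchange_big /=.
  rewrite (exchange_partsle n (fun alpha b => \sum_(eta <- parts (psize a))
        F a b * ((schc eta a * sch y eta) * (schc alpha b * sch p alpha)))).
  apply: eq_bigr => b _; rewrite /zprod -!sum_schc_sch big_distrlr mulr_sumr /= exchange_big /=.
  by apply: eq_bigr => eta _; rewrite -mulr_sumr.
transitivity (\sum_(a <- partsle n) \sum_(b <- partsle n) \sum_(g <- parts (psize lam))
   (cat_part a b == g)%:R * (zprod y a * zprod p b) * ((zpart g)%:R * schc lam g)).
  apply: eq_bigr => a _; apply: eq_bigr => b _.
  have [e|ne] := eqVneq (psize lam) (psize (cat_part a b)).
    rewrite (bigD1_seq (cat_part a b)) ?parts_uniq ?mem_parts ?e //= eqxx mul1r mulrC.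
    rewrite big1 ?addr0 // => g /negPf ng; by rewrite eq_sym ng !mul0r.
  rewrite /F (schc_eq0 ne) mulr0 mul0r big1_seq // => g /andP[_]; rewrite mem_parts => /eqP eg.
  by case: eqP => [e|_]; [rewrite e eg eqxx in ne | rewrite !mul0r].
under eq_bigr => a _ do rewrite exchange_big /=.
rewrite exchange_big /=; apply: eq_big_seq => g; rewrite mem_parts => /eqP eg.
under eq_bigr => a _ do rewrite -mulr_suml.
rewrite -mulr_suml sum_zprod_cat ?eg // /zprod -mulrA mulKr ?zpart_unit // mulrC.
by [].
Qed.

End LittlewoodRichardson.

From mathcomp Require Import boolp classical_sets cardinality fsbigop.

(** * Power series and the amplitudes *)

Section FpsMorphisms.
Variable R : comNzRingType.

Fact fps_const_zmod_morphism : zmod_morphism (@fps_const R).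
Proof. by move=> a b; apply/fpsP => -[|n] //=; rewrite subrr. Qed.
HB.instance Definition _ := GRing.isZmodMorphism.Build R {fps R} (@fps_const R) fps_const_zmod_morphism.

Lemma fcoef_constM (c : R) f n : fcoef (fps_const c * f) n = c * fcoef f n.
Proof.
rewrite fcoefM big_ord_recl /= subn0 big1 ?addr0 // => i _.
by rewrite mul0r.
Qed.

Fact fps_const_monoid_morphism : monoid_morphism (@fps_const R).
Proof.
split=> [|a b]; first by [].
by apply/fpsP => n; rewrite fcoef_constM /=; case: n => //= n; rewrite mulr0.
Qed.
HB.instance Definition _ := GRing.isMonoidMorphism.Build R {fps R} (@fps_const R) fps_const_monoid_morphism.

Lemma fcoef_Xn k n : fcoef (fpsX R ^+ k) n = (n == k)%:R.
Proof.
elim: k n => [|k IH] n; first by rewrite expr0 /=; case: n.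
rewrite exprS fcoefM; case: n => [|n]; first by rewrite big_ord1 /= mul0r.
rewrite !big_ord_recl /= mul0r add0r mul1r subn1 /= IH big1 ?addr0 // => i _.
by rewrite mul0r.
Qed.

(* [f(X^2)], not [f^2]. *)
Definition fps_sq (f : {fps R}) : {fps R} :=
  Fps (fun n => if odd n then 0 else fcoef f n./2).

Lemma sum_even m (h : nat -> R) :
  \sum_(i < m.*2.+1) (if odd i then 0 else h i./2) = \sum_(i < m.+1) h i.
Proof.
elim: m => [|m IH]; first by rewrite !big_ord1.
rewrite doubleS 2!big_ord_recr IH [RHS]big_ord_recr /= odd_double /= addr0.
by rewrite doubleK.
Qed.

Fact fps_sq_zmod_morphism : zmod_morphism fps_sq.
Proof. by move=> f g; apply/fpsP => n /=; case: ifP; rewrite ?subrr. Qed.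
HB.instance Definition _ := GRing.isZmodMorphism.Build {fps R} {fps R} fps_sq fps_sq_zmod_morphism.

Fact fps_sq_monoid_morphism : monoid_morphism fps_sq.
Proof.
split=> [|f g]; first by apply/fpsP => -[|[|n]] //=; case: ifP.
apply/fpsP => n; rewrite fcoefM [LHS]/=; case: ifP => [on|/negbT en].
  rewrite big1 // => i _ /=; rewrite oddB ?on -1?ltnS //.
  by case: (odd i); rewrite ?mul0r ?mulr0.
have [m -> {n en}] : exists m, n = m.*2 by exists n./2; rewrite -[LHS]odd_double_half (negPf en).
rewrite doubleK -(sum_even m (fun j => fcoef f j * fcoef g (m - j))); apply: eq_bigr => i _ /=; rewrite oddB; last by rewrite -ltnS.
rewrite odd_double /=; case: ifP => [_|/negbT oi]; first by rewrite mul0r.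
congr (_ * fcoef g _); have -> : val i = i./2.*2 by rewrite -[LHS]odd_double_half (negPf oi).
by rewrite -doubleB !doubleK.
Qed.
HB.instance Definition _ := GRing.isMonoidMorphism.Build {fps R} {fps R} fps_sq fps_sq_monoid_morphism.

Definition fps_poly (p : {poly R}) : {fps R} := Fps (fun n => p`_n).

Fact fps_poly_zmod_morphism : zmod_morphism fps_poly.
Proof. by move=> p q; apply/fpsP => n /=; rewrite coefB. Qed.
HB.instance Definition _ := GRing.isZmodMorphism.Build {poly R} {fps R} fps_poly fps_poly_zmod_morphism.

Fact fps_poly_monoid_morphism : monoid_morphism fps_poly.
Proof.
split=> [|p q]; first by apply/fpsP => n /=; rewrite coef1; case: n.
by apply/fpsP => n /=; rewrite coefM.
Qed.
HB.instance Definition _ := GRing.isMonoidMorphism.Build {poly R} {fps R} fps_poly fps_poly_monoid_morphism.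

Lemma flin_poly (y : R) : flin y = fps_poly (1 - y%:P * 'X).
Proof.
apply/fpsP => n /=; rewrite coefB coefCM coef1 coefX.
by case: n => [|[|n]] /=; rewrite ?mulr0 ?mulr1 ?subr0 ?sub0r.
Qed.

Lemma fps_sq_poly_const c : fps_sq (fps_poly c%:P) = fps_const c.
Proof. by apply/fpsP => -[|[|n]] //=; rewrite coefC //; case: ifP. Qed.

Lemma fps_sq_polyX : fps_sq (fps_poly 'X) = fpsX R ^+ 2.
Proof.
apply/fpsP => n; rewrite fcoef_Xn /= coefX; case: ifP => [on|/negbT en].
  by case: eqP => // n2; rewrite n2 in on.
by rewrite -{2}[n]odd_double_half (negPf en) add0n -(eqn_pmul2r (isT : 0 < 2)%N) muln2.
Qed.

End FpsMorphisms.

(** * Laurent series and the parameter [q] *)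

Section Laurent.
Variable F : fieldType.
Local Notation tofrac := (@FracField.tofrac {fps F}).

Fact lconst_zmod_morphism : zmod_morphism (@lconst F).
Proof. by move=> a b; rewrite /lconst rmorphB rmorphB. Qed.
HB.instance Definition _ := GRing.isZmodMorphism.Build F (laurent F) (@lconst F) lconst_zmod_morphism.

Fact lconst_monoid_morphism : monoid_morphism (@lconst F).
Proof. by split=> [|a b]; rewrite /lconst ?rmorph1 // rmorphM rmorphM. Qed.
HB.instance Definition _ := GRing.isMonoidMorphism.Build F (laurent F) (@lconst F) lconst_monoid_morphism.

Lemma laurent_char0 : (forall n, n.+1%:R != 0 :> F) -> forall n, n.+1%:R != 0 :> laurent F.
Proof. by move=> c0 n; rewrite -(rmorph_nat (@lconst F)) fmorph_eq0. Qed.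

(** Polynomials in [e^(- t)] become values at [u^2]; this is how the polynomial identities for the
    quantum dimension reach the amplitudes. *)
Lemma tofrac_fps_sq_poly (p : {poly F}) :
  tofrac (fps_sq (fps_poly p)) = (map_poly (@lconst F) p).[lX F ^+ 2].
Proof.
elim/poly_ind: p => [|p c IH]; first by rewrite !rmorph0 horner0.
rewrite !rmorphD !rmorphM /= IH fps_sq_poly_const fps_sq_polyX map_polyC map_polyX !hornerE.
by rewrite expr2 rmorphM mulrA.
Qed.

End Laurent.

Section QuantumParameter.
Variable C : numClosedFieldType.
Local Notation K := (laurent C).

(** The linear coefficient [m i / 2] is what shows that [q] is not a root of unity. *)
Lemma qh_fps_exp m : let e := Fps (fun n => ('i / 2) ^+ n / n`!%:R) : {fps C} in
  fcoef (e ^+ m) 0 = 1 /\ fcoef (e ^+ m) 1 = m%:R * ('i / 2).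
Proof.
move=> e; elim: m => [|m [IH0 IH1]]; first by rewrite expr0 /= mul0r.
rewrite exprS !fcoefM big_ord1 big_ord_recl big_ord1 /= IH0 IH1 /= expr0 expr1 !divr1.
by rewrite !mulr1 mul1r -[m.+1]addn1 natrD mulrDl mul1r.
Qed.

Lemma qh_exp_neq1 m : (0 < m)%N -> (qh : K) ^+ m != 1.
Proof.
move=> m0; rewrite /qh -rmorphXn -(rmorph1 (@FracField.tofrac {fps C})) tofrac_eq.
apply/eqP => /fpsP/(_ 1%N)/=; have [_ ->] := qh_fps_exp m; apply/eqP.
by rewrite !mulf_neq0 ?pnatr_eq0 -?lt0n ?neq0Ci ?invr_eq0 ?pnatr_eq0.
Qed.

Lemma qh_neq0 : (qh : K) != 0.
Proof.
rewrite /qh tofrac_eq0; apply/eqP => /fpsP/(_ 0%N)/= /eqP.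
by rewrite expr0 fact0 divr1 oner_eq0.
Qed.

Lemma K_char0 n : n.+1%:R != 0 :> K.
Proof. by apply: laurent_char0 => m; rewrite pnatr_eq0. Qed.

End QuantumParameter.

Lemma sum_setT_seq (V : nmodType) (I : choiceType) (s : seq I) (F : I -> V) : uniq s ->
  (forall i, i \notin s -> F i = 0) ->
  \sum_(i \in [set: I]%classic) F i = \sum_(i <- s) F i.
Proof.
move=> us F0; rewrite [RHS]fsbig_seq //; apply: esym; apply: fsbig_widen; first by [].
by move=> i [_ /= /negP nis]; exact: F0.
Qed.

Lemma sum_setT_parts (V : nmodType) n (F : part -> V) :
  (forall mu, psize mu != n -> F mu = 0) ->
  \sum_(mu \in [set: part]%classic) F mu = \sum_(mu <- parts n) F mu.
Proof.
by move=> F0; apply: sum_setT_seq; [exact: parts_uniq | move=> mu; rewrite mem_parts; exact: F0].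
Qed.

Lemma sum_setT_pair (V : nmodType) (I J : choiceType) (s : seq I) (r : seq J) (F : I * J -> V) :
  uniq s -> uniq r -> (forall i j, (i \notin s) || (j \notin r) -> F (i, j) = 0) ->
  \sum_(x \in [set: I * J]%classic) F x = \sum_(i <- s) \sum_(j <- r) F (i, j).
Proof.
move=> us ur F0; rewrite (@sum_setT_seq _ _ [seq (i, j) | i <- s, j <- r]).
- by rewrite big_allpairs.
- by apply: allpairs_uniq => // -[? ?] [? ?].
move=> [i j] nij; apply: F0; rewrite -negb_and; apply: contra nij => /andP[si rj].
by apply/allpairsP; exists (i, j).
Qed.

(** * Cauchy sums and skew Cauchy sums *)

Section FieldSchur.
Variable K : fieldType.
Hypothesis char0 : forall n, n.+1%:R != 0 :> K.
Let natu n : n.+1%:R \is a @GRing.unit K.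
Proof. by rewrite unitfE char0. Qed.

Lemma schur_atE (p : nat -> K) mu : schur_at p mu = sch p mu.
Proof.
rewrite /schur_at (@sum_setT_parts _ (psize mu)) // => eta ne.
by rewrite /schur chi_eq0 ?mul0r // eq_sym.
Qed.

Lemma schurE mu eta : schur K mu eta = schc K mu eta.
Proof. by []. Qed.

Lemma pmul_schur mu nu g : pmul (schur K mu) (schur K nu) g =
  \sum_(a <- parts (psize mu)) \sum_(b <- parts (psize nu)) (cat_part a b == g)%:R * (schc K mu a * schc K nu b).
Proof.
transitivity (\sum_(x \in [set: part * part]%classic) (cat_part x.1 x.2 == g)%:R * (schc K mu x.1 * schc K nu x.2)).
  rewrite /pmul fsbig_mkcond; apply: eq_fsbigr => -[a b] _ /=; rewrite /functions.patch.
  case: ifPn => [/set_mem /= -> |]; first by rewrite eqxx mul1r.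
  rewrite notin_setE /= => /eqP/negPf ->; by rewrite mul0r.
apply: sum_setT_pair; rewrite ?parts_uniq // => a b; rewrite !mem_parts => /orP[ne|ne].
  by rewrite (@schc_eq0 _ mu a) 1?eq_sym // mul0r mulr0.
by rewrite (@schc_eq0 _ nu b) 1?eq_sym // !mulr0.
Qed.

Lemma LRE lam mu nu : LR K lam mu nu = LRc K lam mu nu.
Proof.
rewrite /LR /hall (@sum_setT_parts _ (psize lam)); last first.
  by move=> eta ne; rewrite schurE (@schc_eq0 _ lam) ?mulr0 // eq_sym.
under eq_bigr => g _.
  rewrite pmul_schur mulr_sumr mulr_suml.
  under eq_bigr => a _ do rewrite mulr_sumr mulr_suml.
  over.
rewrite exchange_big /=; apply: eq_bigr => a _.
rewrite exchange_big /=; apply: eq_bigr => b _.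
have [e|ne] := eqVneq (psize lam) (psize (cat_part a b)).
  rewrite (bigD1_seq (cat_part a b)) ?parts_uniq ?mem_parts ?e //= eqxx mul1r.
  by rewrite big1 ?addr0 // => g /negPf ng; rewrite eq_sym ng mul0r mulr0 mul0r.
rewrite (schc_eq0 _ ne) mulr0 big1_seq // => g /andP[_]; rewrite mem_parts => /eqP eg.
by case: eqP => [e|_]; [rewrite e eg eqxx in ne | rewrite mul0r mulr0 mul0r].
Qed.

Lemma sum_schc_row mu nu : psize mu = psize nu ->
  \sum_(eta <- parts (psize mu)) (zpart eta)%:R * schc K mu eta * schc K nu eta = (mu == nu)%:R.
Proof.
move=> e; have f0 : ((psize mu)`!)%:R != 0 :> K by rewrite -unitfE fact_unit.
apply: (mulfI f0); have := congr1 (intr : int -> K) (sum_chi_row e).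
rewrite rmorph_nat natrM => <-; rewrite rmorph_sum mulr_sumr; apply: eq_big_seq => eta.
rewrite mem_parts => /eqP em /=; rewrite rmorphMn rmorphM /= -[RHS]mulr_natr (class_size_div natu em).
have z0 : (zpart eta)%:R != 0 :> K by rewrite -unitfE zpart_unit.
by rewrite /schc; field.
Qed.

Lemma cat_part0 mu : cat_part part0 mu = mu.
Proof. by apply/perm_part/(perm_trans (perm_cat_part _ _)). Qed.

Lemma schc0 : schc K part0 part0 = 1.
Proof.
have := sch0 (fun=> 0 : K); rewrite schE_schc parts0 big_seq1.
by rewrite /pprod big_nil mulr1.
Qed.

Lemma LRc_0l lam nu : LRc K lam part0 nu = (lam == nu)%:R.
Proof.
have [e|ne] := eqVneq (psize lam) (psize nu); last first.
  by rewrite LRc_eq0 //; case: eqP => // e; rewrite e eqxx in ne.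
rewrite /LRc parts0 big_seq1 eq_sym -(sum_schc_row (esym e)); apply: eq_bigr => b _.
by rewrite cat_part0 schc0 mul1r.
Qed.

Lemma psize_eq0 mu : (psize mu == 0%N) = (mu == part0).
Proof.
apply/eqP/eqP => [mu0|-> //].
by have : mu \in parts 0 by [rewrite mem_parts mu0]; rewrite parts0 inE => /eqP.
Qed.

Lemma LRc_0 eta alpha : LRc K part0 eta alpha = ((eta == part0) && (alpha == part0))%:R.
Proof.
have [/andP[/eqP -> /eqP ->]|ne] := boolP (_ && _); first by rewrite LRc_0l eqxx.
by rewrite LRc_eq0 // eq_sym addn_eq0 !psize_eq0.
Qed.

Lemma sum_partsle_part0 (V : nmodType) n (F : part -> V) :
  (forall mu, mu != part0 -> F mu = 0) -> \sum_(mu <- partsle n) F mu = F part0.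
Proof.
move=> F0; rewrite (bigD1_seq part0) ?partsle_uniq ?mem_partsle //= big1 ?addr0 //.
Qed.

Lemma frame_cancel (a b r w : K) : a != 0 -> r != 0 ->
  (a * b) * ((a^-1 * r) * (r * w) / r) = b * (r * w).
Proof. by move=> a0 r0; field; rewrite a0 r0. Qed.

Lemma fcoef_sum (I : Type) (r : seq I) (P : pred I) (f : I -> {fps K}) n :
  fcoef (\sum_(i <- r | P i) f i) n = \sum_(i <- r | P i) fcoef (f i) n.
Proof. by elim/big_ind2: _ => // f1 x1 f2 x2 <- <-. Qed.

Lemma fcoef_mulXn (f : {fps K}) k n :
  fcoef (f * fpsX K ^+ k) n = if (k <= n)%N then fcoef f (n - k) else 0.
Proof.
rewrite mulrC fcoefM; case: leqP => kn.
  rewrite (bigD1 (Ordinal (kn : (k < n.+1)%N))) //= fcoef_Xn eqxx mul1r big1 ?addr0 // => i.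
  by rewrite fcoef_Xn -val_eqE /= => /negPf ->; rewrite mul0r.
rewrite big1 // => i _; rewrite fcoef_Xn ltn_eqF ?mul0r //.
by apply: leq_ltn_trans kn; rewrite -ltnS.
Qed.

Lemma hserM_exp (c : K) p n : fcoef (hser (fun m => c ^+ m * p m)) n = c ^+ n * fcoef (hser p) n.
Proof.
rewrite /= mulr_sumr; apply: eq_big_seq => eta; rewrite mem_parts => /eqP e.
by rewrite pprodM pprod_exp e mulrA.
Qed.

Lemma eq_hser (p q : nat -> K) : (forall m, (0 < m)%N -> p m = q m) -> hser p = hser q.
Proof.
move=> pq; apply/fpsP => n; apply: eq_bigr => eta _; by rewrite (eq_pprod _ pq).
Qed.

(** The sign [(-1)^m], which comes from [Q = - e^(- t)], absorbs the [(-1)^k] of the involution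
    omega; the minus sign that remains inverts the Cauchy kernel. *)
Lemma dual_cauchy (p q : nat -> K) m :
  (-1) ^+ m * \sum_(nu <- parts m) sch p nu * sch q (conj_part nu) = fcoef (hser (fun k => - (p k * q k))) m.
Proof.
under eq_bigr => nu _ do rewrite sch_conj.
rewrite (cauchy_sch natu) -hserM_exp; congr fcoef; apply: eq_hser => k _.
have s2 : (-1) ^+ k * (-1) ^+ k = 1 :> K by rewrite -exprMn mulrNN mul1r expr1n.
set s := (-1) ^+ k in s2 *; transitivity (- (s * s) * (p k * q k)); first by ring.
by rewrite s2 mulN1r.
Qed.

Lemma rmorph_LRc (R S : comUnitRingType) (f : {rmorphism R -> S}) lam mu nu :
  (forall n, n.+1%:R \is a @GRing.unit R) -> f (LRc R lam mu nu) = LRc S lam mu nu.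
Proof.
move=> u; have fs eta zeta : f (schc R eta zeta) = schc S eta zeta.
  have fz : f (zpart zeta)%:R^-1 = (zpart zeta)%:R^-1 by rewrite rmorphV ?rmorph_nat // zpart_unit.
  by rewrite /schc rmorphM /= fz rmorph_int.
rewrite /LRc rmorph_sum; apply: eq_bigr => a _; rewrite rmorph_sum; apply: eq_bigr => b _.
by rewrite -!fs -(rmorph_nat f) -!rmorphM.
Qed.

Lemma fps_poly_monomial (c : K) k : fps_poly (c%:P * 'X^k) = fps_const c * fpsX K ^+ k.
Proof. by apply/fpsP => n; rewrite fcoef_constM fcoef_Xn /= coefCM coefXn. Qed.

(** Degrees force [|beta| = m - |eta|]. For such [beta] the sum over [nu] is the product of the
    values at [eta] and [beta], and the sum over [beta] is a dual Cauchy sum in degree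
    [m - |eta|]. *)
Lemma skew_cauchy_term (rho : nat -> K) eta m : let om k := - (-1) ^+ k * rho k in
  (-1) ^+ m * (\sum_(beta <- partsle m) sch rho beta * \sum_(nu <- parts m) LRc K nu eta beta * sch om nu) =
  sch (fun k => - rho k) eta *
    (if (psize eta <= m)%N then fcoef (hser (fun k => - (rho k * rho k))) (m - psize eta) else 0).
Proof.
move=> om; case: leqP => em; last first.
  rewrite mulr0 [X in _ * X]big1 ?mulr0 // => beta _; rewrite big1_seq ?mulr0 // => nu /andP[_].
  rewrite mem_parts => /eqP e; rewrite LRc_eq0 ?mul0r // e ltn_eqF //.
  exact: leq_trans em (leq_addr _ _).
have -> : sch (fun k => - rho k) eta = (-1) ^+ psize eta * sch om eta.
  rewrite -schM_exp; apply: eq_sch => k _; rewrite /om mulNr mulrN mulrA -exprMn mulrNN.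
  by rewrite mul1r expr1n mul1r.
rewrite -dual_cauchy -{1}(subnK em) exprD.
rewrite (bigID (fun beta => psize beta == m - psize eta)%N) /= [X in _ + X]big1 ?addr0; last first.
  move=> beta ne; rewrite big1_seq ?mulr0 // => nu /andP[_].
  rewrite mem_parts => /eqP e; rewrite LRc_eq0 ?mul0r // e; apply: contraNneq ne => ->.
  by rewrite addKn.
rewrite -(sum_parts_partsle _ (leq_subr _ _)).
set S := \sum_(nu <- parts (m - psize eta)) _; set T := \sum_(nu <- parts (m - psize eta)) _.
suff -> : S = sch om eta * T by ring.
rewrite /S /T mulr_sumr; apply: eq_big_seq => beta; rewrite mem_parts => /eqP e.
have {1}-> : m = (psize eta + psize beta)%N by rewrite e subnKC.
rewrite (sum_LRc_sch natu) sch_conj -/(sch om beta).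
by ring.
Qed.

(** The power sums [(1 - X^k) rho_k] split as [- X^k rho_k] plus [rho_k]. In the coproduct of [s_mu]
    the factor indexed by [eta] then carries [X^|eta|], which matches the degree shift in
    [skew_cauchy_term]. *)
Lemma skew_cauchy (rho : nat -> K) mu m :
  (-1) ^+ m * \sum_(nu <- parts m) sch rho (conj_part nu) *
    (\sum_(eta <- partsle (psize mu)) \sum_(alpha <- partsle (psize mu)) \sum_(beta <- partsle (psize nu))
      LRc K mu eta alpha * LRc K nu eta beta * (sch rho alpha * sch rho beta)) =
  fcoef (hser (fun k => - (rho k * rho k)) * fps_poly (sch (fun k => (1 - 'X^k) * (rho k)%:P) mu)) m.
Proof.
have polyu n : n.+1%:R \is a @GRing.unit {poly K}.
  by rewrite -polyC_natr poly_unitE coefC /= unitfE char0 size_polyC char0.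
pose om k := - (-1) ^+ k * rho k.
have -> : sch (fun k => (1 - 'X^k) * (rho k)%:P) mu =
    \sum_(eta <- partsle (psize mu)) \sum_(alpha <- partsle (psize mu))
       (LRc K mu eta alpha * (sch (fun k => - rho k) eta * sch rho alpha))%:P * 'X^(psize eta).
  rewrite (@eq_sch _ _ (fun k => 'X^k * (- rho k)%:P + (rho k)%:P)); last first.
    by move=> k _; rewrite polyCN; ring.
  rewrite -(sum_LRc_schD polyu _ _ (leqnn _)); apply: eq_bigr => eta _; apply: eq_bigr => alpha _.
  rewrite (schM_exp 'X (fun k => (- rho k)%:P)) -(rmorph_LRc polyC) //.
  rewrite -[sch (fun k => (- rho k)%:P) eta](rmorph_sch polyC (fun k => - rho k)) //.
  by rewrite -[sch (fun k => (rho k)%:P) alpha](rmorph_sch polyC rho) // !polyCM; ring.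
rewrite rmorph_sum [in RHS]mulr_sumr fcoef_sum.
transitivity (\sum_(nu <- parts m) \sum_(eta <- partsle (psize mu)) \sum_(alpha <- partsle (psize mu))
    \sum_(beta <- partsle m) (-1) ^+ m * (LRc K mu eta alpha * sch rho alpha *
      (sch rho beta * (LRc K nu eta beta * sch om nu)))).
  rewrite mulr_sumr; apply: eq_big_seq => nu; rewrite mem_parts => /eqP ->.
  rewrite sch_conj 2!mulr_sumr; apply: eq_bigr => eta _.
  rewrite 2!mulr_sumr; apply: eq_bigr => alpha _; rewrite 2!mulr_sumr; apply: eq_bigr => beta _.
  rewrite -/(sch om nu); ring.
rewrite exchange_big; apply: eq_bigr => eta _; rewrite exchange_big rmorph_sum [in RHS]mulr_sumr fcoef_sum.
apply: eq_bigr => alpha _; rewrite exchange_big.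
set c := LRc K mu eta alpha * sch rho alpha; transitivity (c * ((-1) ^+ m *
   \sum_(beta <- partsle m) sch rho beta * \sum_(nu <- parts m) LRc K nu eta beta * sch om nu)).
  rewrite -/c 2!mulr_sumr; apply: eq_bigr => beta _; rewrite 3!mulr_sumr; apply: eq_bigr => nu _.
  by ring.
rewrite skew_cauchy_term [X in fcoef (_ * X)]fps_poly_monomial [X in _ = fcoef X _]mulrCA fcoef_constM fcoef_mulXn.
by rewrite /c -!mulrA; congr (_ * _); rewrite mulrCA.
Qed.

End FieldSchur.

(** A geometric sum along row [i]: moving the variable of this row from [q^rho] to [q^(mu + rho)]
    changes the [m]-th power sum by [[m]] times that of the [q^c], for [c] the contents of its
    boxes. *)
Lemma qn_geometric (K : fieldType) (t : K) m n i : t != 0 -> qn t m%:Z != 0 ->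
  (t ^ (m%:Z * (2 * n%:Z - 2 * i.+1%:Z + 1)) - t ^ (m%:Z * (- (2 * i.+1%:Z) + 1))) * (qn t m%:Z)^-1 =
  \sum_(1 <= k < n.+1) (t ^ (2 * (k%:Z - i.+1%:Z))) ^+ m.
Proof.
move=> t0 q0; apply: (canLR (mulfK q0)); elim: n => [|n IH].
  by rewrite big_geq // mul0r; apply/eqP; rewrite subr_eq0; apply/eqP; congr (t ^ _); ring.
rewrite big_nat_recr //= [(_ + _) * qn _ _]mulrDl -IH /qn exprnP exprz_exp [X in _ = _ + X]mulrBr -!expfzDr //.
set a := t ^ _; set b := t ^ _; set c := t ^ _; set d := t ^ _; set e := t ^ _.
have -> : a = d by congr (t ^ _); ring.
have -> : e = c by congr (t ^ _); ring.
by ring.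
Qed.

(** * Values of the topological vertex *)

Section VertexValues.
Variable C : numClosedFieldType.
Local Notation K := (laurent C).
Local Notation t := (qh : K).
Local Notation rho := (fun m : nat => (qn t m%:Z)^-1).

Let char0 := @K_char0 C.
Let natu n : n.+1%:R \is a @GRing.unit K.
Proof. by rewrite unitfE char0. Qed.
Let t0 := @qh_neq0 C.
Let t_inf := @qh_exp_neq1 C.

Lemma W2E mu nu : W2 C mu nu = sch rho mu * sch (p_mu_rho C mu) nu.
Proof. by rewrite /W2 !schur_atE. Qed.

Lemma W1E mu : W1 C mu = sch rho mu.
Proof. by rewrite /W1 W2E sch0 // mulr1. Qed.

Lemma p_mu_rho0 n : p_mu_rho C part0 n = rho n.
Proof. by rewrite /p_mu_rho big_ord0 addr0. Qed.

Lemma W2_0l nu : W2 C part0 nu = sch rho nu.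
Proof. by rewrite W2E sch0 // mul1r; apply: eq_sch => m _; exact: p_mu_rho0. Qed.

Lemma W2_0r mu : W2 C mu part0 = sch rho mu.
Proof. by rewrite W2E sch0 // mulr1. Qed.

Lemma kappa0 : kappa part0 = 0.
Proof. by rewrite /kappa big_ord0. Qed.

Lemma conj_part0 : conj_part part0 = part0.
Proof. exact: val_inj. Qed.

Lemma vertexE mu1 mu2 mu3 : vertex C mu1 mu2 mu3 =
  t ^ (kappa mu2 + kappa mu3) *
  \sum_(eta <- partsle (psize mu1)) \sum_(alpha <- partsle (psize mu1)) \sum_(beta <- partsle (psize mu3))
    LRc K mu1 eta alpha * LRc K (conj_part mu3) eta beta *
    (W2 C (conj_part mu2) alpha * W2 C mu2 beta / W1 C mu2).
Proof.
congr (_ * _).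
rewrite (@sum_setT_pair _ _ _ [seq (eta, alpha) | eta <- partsle (psize mu1), alpha <- partsle (psize mu1)]
   (partsle (psize mu3))).
- rewrite big_allpairs; apply: eq_bigr => eta _; apply: eq_bigr => alpha _; apply: eq_bigr => beta _.
  by rewrite !LRE.
- by apply: allpairs_uniq; rewrite ?partsle_uniq // => -[? ?] [? ?].
- exact: partsle_uniq.
move=> [eta alpha] beta ne; rewrite !LRE.
have [e1|ne1] := eqVneq (psize mu1) (psize eta + psize alpha)%N; last by rewrite (LRc_eq0 _ ne1) !mul0r.
have [e2|ne2] := eqVneq (psize (conj_part mu3)) (psize eta + psize beta)%N; last first.
  by rewrite [X in _ * X * _](LRc_eq0 _ ne2) mulr0 mul0r.
move: ne; rewrite mem_partsle -(psize_conj mu3) e2 leq_addl orbF => /negP[].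
by apply/allpairsP; exists (eta, alpha); rewrite !mem_partsle e1 leq_addr leq_addl.
Qed.

Lemma vertex_00 nu : vertex C nu part0 part0 = sch rho nu.
Proof.
rewrite vertexE kappa0 addr0 expr0z mul1r conj_part0.
rewrite sum_partsle_part0; last first.
  move=> eta ne; rewrite big1 // => alpha _; rewrite big1 // => beta _.
  by rewrite (LRc_0 char0) (negPf ne) mulr0 mul0r.
rewrite (bigD1_seq nu) ?partsle_uniq ?mem_partsle //= [X in _ + X]big1 ?addr0; last first.
  by move=> alpha na; rewrite big1 // => beta _; rewrite (LRc_0l char0) eq_sym (negPf na) !mul0r.
rewrite sum_partsle_part0; last first.
  by move=> beta nb; rewrite (LRc_0 char0) (negPf nb) andbF mulr0 mul0r.
by rewrite !(LRc_0l char0) !eqxx !mul1r !W2_0l W1E sch0 // divr1 mulr1.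
Qed.

Lemma vertex_0 mu nu : vertex C part0 mu (conj_part nu) =
  t ^ (- kappa nu) * (sch rho mu * sch (p_mu_rho C mu) nu).
Proof.
rewrite vertexE conj_partK (kappa_conj char0 t0 t_inf) psize_conj.
rewrite sum_partsle_part0; last first.
  move=> eta ne; rewrite big1 // => alpha _; rewrite big1 // => beta _.
  by rewrite (LRc_0 char0) (negPf ne) !mul0r.
rewrite sum_partsle_part0; last first.
  by move=> alpha na; rewrite big1 // => beta _; rewrite (LRc_0 char0) (negPf na) andbF !mul0r.
rewrite (bigD1_seq nu) ?partsle_uniq ?mem_partsle //= big1 ?addr0; last first.
  by move=> beta nb; rewrite (LRc_0l char0 nu) eq_sym (negPf nb) mulr0 mul0r.
(* The framing factor of [mu] in the vertex cancels against the one by which the values at [q^rho]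
   for [mu] and its transpose differ. *)
rewrite !(LRc_0l char0) !eqxx !mul1r W2_0r W1E W2E (sch_rho_conj char0 t0 t_inf) expfzDr //.
have w0 := sch_rho_neq0 char0 t0 t_inf mu; have tk : t ^ kappa mu != 0 by rewrite expfz_neq0.
by rewrite -(invr_expz t (kappa mu)) frame_cancel.
Qed.

Lemma vertex_mid mu nu : vertex C mu part0 (conj_part nu) =
  t ^ (- kappa nu) * \sum_(eta <- partsle (psize mu)) \sum_(alpha <- partsle (psize mu)) \sum_(beta <- partsle (psize nu))
    LRc K mu eta alpha * LRc K nu eta beta * (sch rho alpha * sch rho beta).
Proof.
rewrite vertexE conj_partK kappa0 add0r (kappa_conj char0 t0 t_inf) psize_conj conj_part0.
congr (_ * _); apply: eq_bigr => eta _; apply: eq_bigr => alpha _; apply: eq_bigr => beta _.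
by rewrite !W2_0l W1E sch0 // divr1.
Qed.

(* The framing factor turns [s_nu(q^rho)] into [s_(nu^t)(q^rho)], and then the
   sum over [nu] is the dual Cauchy sum. *)
Lemma frame_vertex nu : t ^ (- kappa nu) * vertex C nu part0 part0 = sch rho (conj_part nu).
Proof. by rewrite vertex_00 (sch_rho_conj char0 t0 t_inf). Qed.

Definition conifold_fps : {fps K} := hser (fun m => - (rho m * rho m)).

Definition inner_poly (mu : part) : {poly K} := (t ^ kappa mu)%:P *
  sch (fun m => (1 - 'X^m) * (rho m)%:P) (conj_part mu).
Definition outer_poly (mu : part) : {poly K} := sch (fun m => (1 - 'X^m) * (rho m)%:P) mu.

Lemma p_mu_rhoM mu m : (0 < m)%N -> - (p_mu_rho C mu m * rho m) = - (rho m * rho m) +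
  \sum_(i < size mu) \sum_(1 <= k < (nth 0%N mu i).+1) - (t ^ (2 * (k%:Z - i.+1%:Z))) ^+ m.
Proof.
move=> m0; have q0 : qn t m%:Z != 0 by apply: qn_neq0 => //; rewrite eqz_nat -lt0n.
rewrite /p_mu_rho mulrDl opprD; congr (_ + _); rewrite mulr_suml -sumrN; apply: eq_bigr => i _.
rewrite sumrN; congr (- _); exact: qn_geometric.
Qed.

(** Multiplied by [rho], the power sums at [q^(mu + rho)] and at [q^rho] differ by a sum over the
    boxes of [mu], which [hser] converts into a product of factors [1 - q^c X]; [sch_rho_boxes]
    evaluates it. *)
Lemma inner_amplitude mu m :
  (-1) ^+ m * \sum_(nu <- parts m) vertex C part0 mu (conj_part nu) * vertex C nu part0 part0 =
  fcoef (conifold_fps * fps_poly (inner_poly mu)) m.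
Proof.
transitivity (sch rho mu * ((-1) ^+ m * \sum_(nu <- parts m) sch (p_mu_rho C mu) nu * sch rho (conj_part nu))).
  rewrite mulrCA; congr (_ * _); rewrite mulr_sumr; apply: eq_bigr => nu _.
  by rewrite vertex_0 mulrAC frame_vertex mulrC mulrA.
rewrite (dual_cauchy char0) (eq_hser (p_mu_rhoM mu)) (hserD natu) (hser_sum natu).
rewrite /inner_poly -(sch_rho_boxes char0 t0 t_inf) -fcoef_constM mulrCA.
congr (fcoef (_ * _) m); set B := \prod_(i < size mu) \prod_(1 <= k < _) (1 - _).
have -> : fps_poly ((sch rho mu)%:P * B) = fps_const (sch rho mu) * fps_poly B.
  by apply/fpsP => n; rewrite fcoef_constM /= coefCM.
congr (_ * _); rewrite /B rmorph_prod; apply: eq_bigr => i _; rewrite (hser_sum natu) rmorph_prod.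
by apply: eq_bigr => k _; rewrite -(flin_hser natu) flin_poly.
Qed.

Lemma outer_amplitude mu m :
  (-1) ^+ m * \sum_(nu <- parts m) vertex C mu part0 (conj_part nu) * vertex C nu part0 part0 =
  fcoef (conifold_fps * fps_poly (outer_poly mu)) m.
Proof.
rewrite -(skew_cauchy char0); congr (_ * _); apply: eq_bigr => nu _.
by rewrite vertex_mid mulrAC frame_vertex.
Qed.

End VertexValues.

(** * Rescaling of the power sums *)

Section SeriesScaling.
Variables (L : fieldType) (c : part -> L).
Hypothesis c0 : c part0 = 1.
Hypothesis c_cat : forall mu nu, c (cat_part mu nu) = c mu * c nu.

Lemma pmul_scale (f g : pseries L) :
  pmul (fun mu => c mu * f mu) (fun mu => c mu * g mu) = fun mu => c mu * pmul f g mu.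
Proof.
apply/funext => mu; rewrite /pmul mulr_fsumr; apply: eq_fsbigr => -[a b] /set_mem /= <-.
by rewrite c_cat mulrACA.
Qed.

Lemma ppow_scale (f : pseries L) n : ppow (fun mu => c mu * f mu) n = fun mu => c mu * ppow f n mu.
Proof.
elim: n => [|n IH] /=; last by rewrite -pmul_scale -IH.
by apply/funext => mu; case: eqP => [->|_]; rewrite ?c0 ?mulr1 ?mulr0.
Qed.

Lemma pexp_scale (f : pseries L) : pexp (fun mu => c mu * f mu) = fun mu => c mu * pexp f mu.
Proof.
apply/funext => mu; rewrite /pexp mulr_fsumr; apply: eq_fsbigr => n _.
by rewrite ppow_scale mulrA.
Qed.

End SeriesScaling.

Lemma fps_sum_constM (R : idomainType) (I : choiceType) (c : R) (f : I -> {fps R}) :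
  fps_sum (fun i => fps_const c * f i) = fps_const c * fps_sum f.
Proof.
apply/fpsP => n; rewrite fcoef_constM /= mulr_fsumr; apply: eq_fsbigr => i _.
exact: fcoef_constM.
Qed.

Lemma fcoef_const_mid (R : comNzRingType) (x y : R) f n :
  fcoef (fps_const x * f * fps_const y) n = x * y * fcoef f n.
Proof. by rewrite mulrAC -rmorphM fcoef_constM. Qed.

Lemma lconst_tofrac (R : fieldType) (c : R) (f : {fps R}) :
  lconst c * FracField.tofrac f = FracField.tofrac (fps_const c * f).
Proof. by rewrite rmorphM. Qed.

Lemma tofrac_fps_sum_scale (R : fieldType) (b c : R) (x y : nat -> R) :
  (forall k, x k = c * y k) ->
  FracField.tofrac (fps_sum (fun k => fps_const (b * x k) * fpsX R ^+ (2 * k))) =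
  lconst c * FracField.tofrac (fps_sum (fun k => fps_const (b * y k) * fpsX R ^+ (2 * k))).
Proof.
move=> xy; rewrite lconst_tofrac -fps_sum_constM; congr (FracField.tofrac (fps_sum _)).
by apply/funext => k; rewrite xy mulrCA rmorphM mulrA.
Qed.

Lemma tofrac_fps_sum_const (R : fieldType) (c : R) (y : nat -> R) (h : nat -> {fps R}) :
  FracField.tofrac (fps_sum (fun k => fps_const (c * y k) * h k)) =
  lconst c * FracField.tofrac (fps_sum (fun k => fps_const (y k) * h k)).
Proof.
rewrite lconst_tofrac -fps_sum_constM; congr (FracField.tofrac (fps_sum _)).
by apply/funext => k; rewrite rmorphM mulrA.
Qed.

Lemma free_energy_scale (C : numClosedFieldType) (d : part -> C) F mu :
  free_energy (fun g k mu => d mu * F g k mu) mu = lconst (lconst (d mu)) * free_energy F mu.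
Proof.
unfold free_energy; destruct (mu == part0); first exact: (esym (mulr0 _)).
by apply: (@tofrac_fps_sum_scale _ _ (lconst (d mu))) => k; exact: tofrac_fps_sum_const.
Qed.

Lemma factor_inv (F : fieldType) (x a b : F) : x != 0 -> x^-1 * a - x * b = x^-1 * (a - b * x ^+ 2).
Proof. by move=> x0; field. Qed.

Lemma horner_lconst_linear (F : fieldType) (a b : F) x :
  (map_poly (@lconst F) (a%:P - b%:P * 'X)).[x] = lconst a - lconst b * x.
Proof. by rewrite rmorphB rmorphM /= !map_polyC map_polyX !hornerE. Qed.

(** [[c]_(e^t)] is [u^-1] times the linear factor [q^(c/2) - q^(- c/2) X] at [X = u^2]; one [u^-1]
    per box gives the power [- |mu|] of [lX F]. *)
Lemma horner_sch_boxes (F : fieldType) (t : F) (mu : part) : (forall n, n.+1%:R != 0 :> F) ->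
  t != 0 -> (forall m, (0 < m)%N -> t ^+ m != 1) ->
  lconst (qfactor t mu) * \prod_(i < size mu)
    ((\prod_(1 <= k < (nth 0%N mu i).+1)
        ((lX F)^-1 * lconst (t ^ (k%:Z - i.+1%:Z)) - lX F * lconst (t ^ (- (k%:Z - i.+1%:Z))))) /
     (\prod_(1 <= k < (nth 0%N mu i).+1) lconst (qn t (k%:Z - i.+1%:Z + (size mu)%:Z)))) =
  lX F ^- psize mu *
    (map_poly (@lconst F) (sch (fun m => (1 - 'X^m) * (qn t m%:Z)^-1%:P) mu)).[lX F ^+ 2].
Proof.
move=> char0 t0 t_inf; rewrite (sch_quantum_dim char0 t0 t_inf) rmorphM /= map_polyC hornerM hornerC.
rewrite prodf_div; set D := \prod_(i < _) \prod_(1 <= k < _) lconst _.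
have qE : lconst (qcoef t mu) = lconst (qfactor t mu) / D.
  rewrite /qcoef rmorphM fmorphV; congr (_ / _); rewrite rmorph_prod; apply: eq_bigr => i _.
  by rewrite rmorph_prod.
have x0 : lX F != 0 by rewrite tofrac_eq0; apply/eqP => /fpsP/(_ 1%N)/= /eqP; rewrite oner_eq0.
rewrite -[X in _ = _ * (X * _)]/(lconst (qcoef t mu)) qE.
rewrite [RHS]mulrCA -mulrA; congr (_ * _); rewrite mulrC; congr (_ * _).
rewrite rmorph_prod horner_prod -exprVn (psizeE (leqnn (size mu))) expr_sum -big_split /=.
apply: eq_bigr => i _; rewrite rmorph_prod horner_prod -[X in _ ^+ X * _]subn0 -subSS -prodr_const_nat.
rewrite -big_split; apply: eq_bigr => k _.
rewrite [RHS](congr1 ( *%R _) (horner_lconst_linear _ _ _)).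
exact: factor_inv.
Qed.

Section BraneWeight.
Variables (F : fieldType) (t i0 : F).
Hypotheses (char0 : forall n, n.+1%:R != 0 :> F) (i0_neq0 : i0 != 0).
Local Notation L := (laurent F).
Implicit Types mu nu eta : part.

(** This is [i^l(mu) e^(|mu| t / 2)] when [i0] is the imaginary unit and [lX F] is [e^(- t / 2)]. *)
Definition brane_weight mu : L := lX F ^- psize mu * lconst i0 ^+ size mu.

Lemma brane_weight_mul mu (x y : L) : x = lconst (i0 ^+ size mu) * y ->
  lX F ^- psize mu * x = brane_weight mu * y.
Proof. by move=> ->; rewrite /brane_weight rmorphXn mulrA. Qed.

Lemma brane_weight0 : brane_weight part0 = 1.
Proof. by rewrite /brane_weight expr0 invr1 mulr1. Qed.

Lemma brane_weight_cat mu nu : brane_weight (cat_part mu nu) = brane_weight mu * brane_weight nu.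
Proof. by rewrite /brane_weight psize_cat size_cat_part !exprD invfM mulrACA. Qed.

Definition weight a mu eta : F :=
  t ^ (a * kappa mu) * ((chi mu eta)%:~R / ((zpart eta)%:R * i0 ^+ size eta)).

Lemma weight_eq0 a mu eta : psize mu != psize eta -> weight a mu eta = 0.
Proof. by move=> ne; rewrite /weight chi_eq0 // mul0r mulr0. Qed.

Lemma weight0 a : weight a part0 part0 = 1.
Proof.
have := schc0 F; rewrite /schc => c0.
by rewrite /weight kappa0 mulr0 expr0z mul1r expr0 mulr1 c0.
Qed.

Lemma brane_weightM a mu eta : psize mu = psize eta ->
  brane_weight eta * lconst (weight a mu eta) =
  schur L mu eta * (lconst (t ^ (a * kappa mu)) * lX F ^- psize mu).
Proof.
move=> e; rewrite /brane_weight /weight -e.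
have -> : schur L mu eta = lconst (schur F mu eta).
  have fz : lconst (zpart eta)%:R^-1 = (zpart eta)%:R^-1 :> L by rewrite fmorphV rmorph_nat.
  by rewrite /schur [RHS]rmorphM /= fz rmorph_int.
have z0 : (zpart eta)%:R != 0 :> F by rewrite -unitfE zpart_unit // => n; rewrite unitfE.
have cE : i0 ^+ size eta * (t ^ (a * kappa mu) * ((chi mu eta)%:~R / ((zpart eta)%:R * i0 ^+ size eta))) =
    schur F mu eta * t ^ (a * kappa mu).
  by rewrite /schur; field; rewrite z0 expf_neq0.
have lM x y : lconst (x * y) = lconst x * lconst y :> L := rmorphM (@lconst F) x y.
have li n : lconst i0 ^+ n = lconst (i0 ^+ n) :> L := esym (rmorphXn (@lconst F) n i0).
by rewrite -mulrA li -lM cE lM mulrC mulrA.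
Qed.

Lemma sum_brane_weight a (y : part -> L) eta :
  brane_weight eta * (\sum_(mu <- parts (psize eta)) lconst (weight a mu eta) * y mu) =
  psum (fun mu eta => schur L mu eta * (lconst (t ^ (a * kappa mu)) * (lX F ^- psize mu * y mu))) eta.
Proof.
rewrite mulr_sumr /psum (@sum_setT_parts _ (psize eta)).
  apply: eq_big_seq => mu; rewrite mem_parts => /eqP e.
  by rewrite mulrA brane_weightM // -!mulrA.
by move=> mu ne; rewrite schurE schc_eq0 ?mul0r.
Qed.

Lemma pexp_brane_weight (f g : pseries L) : (forall mu, f mu = brane_weight mu * g mu) ->
  pexp f = fun mu => brane_weight mu * pexp g mu.
Proof. by move=> /funext ->; rewrite (pexp_scale brane_weight0 brane_weight_cat). Qed.

Lemma sum_factor_cancel (I : Type) (r : seq I) (w y : I -> L) g : g != 0 ->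
  (\sum_(i <- r) w i * (g * y i)) / g = \sum_(i <- r) w i * y i.
Proof. by move=> g0; rewrite mulr_suml; apply: eq_bigr => i _; rewrite mulrCA mulrC mulKf. Qed.

Lemma horner_lconstM (c : F) p x :
  (map_poly (@lconst F) (c%:P * p)).[x] = lconst c * (map_poly (@lconst F) p).[x].
Proof. by rewrite rmorphM /= map_polyC hornerM hornerC. Qed.

Lemma lconst_expD (a k : int) (x y : L) : t != 0 ->
  lconst (t ^ (a * k)) * (x * (lconst (t ^ k) * y)) = lconst (t ^ ((a + 1) * k)) * (x * y).
Proof.
move=> t0; rewrite mulrDl mul1r expfzDr //.
have -> : lconst (t ^ (a * k) * t ^ k) = lconst (t ^ (a * k)) * lconst (t ^ k) :> L by rewrite rmorphM.
by rewrite -mulrA; congr (_ * _); rewrite mulrCA.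
Qed.

Lemma horner_lconst1 x : (map_poly (@lconst F) 1).[x] = 1.
Proof. by rewrite rmorph1 hornerC. Qed.

End BraneWeight.

(** * Normalized amplitudes *)

Section Amplitudes.
Variable C : numClosedFieldType.
Local Notation K := (laurent C).
Local Notation L := (laurent K).
Local Notation t := (qh : K).
Local Notation ev p := (map_poly (@lconst K) p).[(u : L) ^+ 2].

Let char0 := @K_char0 C.
Let natu n : n.+1%:R \is a @GRing.unit K.
Proof. by rewrite unitfE char0. Qed.
Let t0 := @qh_neq0 C.
Let t_inf := @qh_exp_neq1 C.

Lemma lconst_i_neq0 : lconst ('i : C) != 0.
Proof. by rewrite fmorph_eq0 neq0Ci. Qed.

Lemma fcoef_sq (R : comNzRingType) (f : {fps R}) n :
  fcoef (fps_sq f) n = if odd n then 0 else fcoef f n./2.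
Proof. by []. Qed.

Lemma fcoef_Q k n : fcoef (Q C ^+ k) n = if n == k.*2 then (-1) ^+ k else 0.
Proof.
have -> : Q C = fps_const (-1) * fpsX K ^+ 2 by rewrite rmorphN rmorph1 mulN1r.
rewrite exprMn -rmorphXn fcoef_constM -exprM fcoef_Xn mulnC muln2.
by case: eqP => _; rewrite ?mulr1 ?mulr0.
Qed.

(** [Q^|nu|] sits in degree [2 |nu|] of [u] with the sign [(-1)^|nu|]. Odd coefficients vanish, and
    the coefficient of degree [2 m] is the sum over the partitions of [m] that the hypothesis
    evaluates. *)
Lemma amplitudeE V (P : part -> {poly K}) a eta :
  (forall mu m, (-1) ^+ m * \sum_(nu <- parts m) V mu (conj_part nu) * vertex C nu part0 part0 =
     fcoef (conifold_fps C * fps_poly (P mu)) m) ->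
  amplitude V a eta = \sum_(mu <- parts (psize eta)) lconst (weight t (lconst 'i) a mu eta) *
    (FracField.tofrac (fps_sq (conifold_fps C)) * ev (P mu)).
Proof.
move=> VP; transitivity (FracField.tofrac (\sum_(mu <- parts (psize eta))
   fps_const (weight t (lconst 'i) a mu eta) * fps_sq (conifold_fps C * fps_poly (P mu)))); last first.
  rewrite rmorph_sum; apply: eq_bigr => mu _.
  by rewrite !rmorphM /= tofrac_fps_sq_poly.
congr FracField.tofrac; apply/fpsP => n; rewrite fcoef_sum.
transitivity (\sum_(x \in [set: part * part]%classic) let: (mu, nu) := x in
    weight t (lconst 'i) a mu eta * (V mu (conj_part nu) * vertex C nu part0 part0 *
      (if n == (psize nu).*2 then (-1) ^+ psize nu else 0))).
  apply: eq_fsbigr => -[mu nu] _; rewrite fcoef_const_mid fcoef_Q [RHS]mulrA; congr (_ * _).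
  by rewrite [X in _ * X = _]mulrC mulrACA /weight.
rewrite (@sum_setT_pair _ _ _ (parts (psize eta)) (parts n./2)) ?parts_uniq //; last first.
  move=> mu nu; rewrite !mem_parts => /orP[ne|ne]; first by rewrite (weight_eq0 t (lconst 'i)) ?mul0r.
  case: eqP => [e|_]; last by rewrite !mulr0.
  by rewrite e doubleK eqxx in ne.
apply: eq_bigr => mu _; rewrite fcoef_constM -mulr_sumr fcoef_sq; congr (_ * _).
rewrite -VP [in RHS]mulr_sumr; case: ifP => [on|/negbT en].
  by rewrite big1 // => nu _; case: eqP => [e|_]; [rewrite e odd_double in on | rewrite mulr0].
apply: eq_big_seq => nu; rewrite mem_parts => /eqP ->.
by rewrite -{1}[n]odd_double_half (negPf en) add0n eqxx mulrC.
Qed.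

Lemma conifold_neq0 : FracField.tofrac (fps_sq (conifold_fps C)) != 0 :> L.
Proof.
rewrite tofrac_eq0; apply/eqP => /fpsP/(_ 0%N); rewrite /fps_sq [LHS]/= => /eqP.
by rewrite -[X in X == _]/(fcoef (conifold_fps C) 0) hser0 oner_eq0.
Qed.

(** At [part0] only the term [mu = part0] occurs, and it is the closed amplitude because
    [P part0 = 1]; this factor is common to all terms and cancels. *)
Lemma normalizedE V (P : part -> {poly K}) a eta : P part0 = 1 ->
  (forall mu m, (-1) ^+ m * \sum_(nu <- parts m) V mu (conj_part nu) * vertex C nu part0 part0 =
     fcoef (conifold_fps C * fps_poly (P mu)) m) ->
  normalized (amplitude V a) eta = \sum_(mu <- parts (psize eta)) lconst (weight t (lconst 'i) a mu eta) * ev (P mu).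
Proof.
move=> P0 VP; rewrite /normalized !(amplitudeE _ _ VP) parts0 big_seq1 weight0 P0.
rewrite (@horner_lconst1 K) rmorph1 mul1r mulr1; exact: sum_factor_cancel conifold_neq0.
Qed.

Lemma qdimE mu : qdim mu = (u : L) ^- psize mu * ev (outer_poly C mu).
Proof. exact: (horner_sch_boxes mu char0 t0 t_inf). Qed.

Lemma outer_poly0 : outer_poly C part0 = 1.
Proof. exact: sch0. Qed.

Lemma inner_poly0 : inner_poly C part0 = 1.
Proof. by rewrite /inner_poly kappa0 expr0z mul1r conj_part0 sch0. Qed.

Lemma lconst_iX n : lconst (('i : C) ^+ n) = lconst 'i ^+ n.
Proof. by rewrite rmorphXn. Qed.

Lemma open_free_energy F (mu : part) :
  (u : L) ^- psize mu * free_energy (fun g k mu => 'i ^+ size mu * F g k mu) mu =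
  brane_weight (lconst 'i) mu * free_energy F mu.
Proof.
apply: brane_weight_mul; rewrite -lconst_iX.
exact: (free_energy_scale (fun mu => 'i ^+ size mu) F mu).
Qed.

Lemma schur_expansion V P a eta : P part0 = 1 ->
  (forall mu m, (-1) ^+ m * \sum_(nu <- parts m) V mu (conj_part nu) * vertex C nu part0 part0 =
     fcoef (conifold_fps C * fps_poly (P mu)) m) ->
  brane_weight (lconst 'i) eta * normalized (amplitude V a) eta =
  psum (fun mu eta => schur L mu eta * (lconst (t ^ (a * kappa mu)) * ((u : L) ^- psize mu * ev (P mu)))) eta.
Proof.
move=> P0 VP; rewrite (normalizedE _ _ P0 VP).
exact: (sum_brane_weight t char0 lconst_i_neq0 a (fun mu => ev (P mu)) eta).
Qed.

End Amplitudes.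

Theorem theorem3p1 (C : numClosedFieldType) (a : int)
    (F F' : nat -> nat -> part -> C) :
  normalized (Z C a) = pexp (free_energy F) ->
  normalized (Z' C a) = pexp (free_energy F') ->
  pexp (fun mu => u ^- psize mu *
          free_energy (fun g k mu => 'i ^+ size mu * F g k mu) mu) =
    psum (fun mu eta => schur (laurent (laurent C)) mu eta *
          (lconst (qh ^ ((a + 1) * kappa mu)) * qdim (conj_part mu)))
  /\
  pexp (fun mu => u ^- psize mu *
          free_energy (fun g k mu => 'i ^+ size mu * F' g k mu) mu) =
    psum (fun mu eta => schur (laurent (laurent C)) mu eta *
          (lconst (qh ^ (a * kappa mu)) * qdim mu)).
Proof.
move=> ZF ZF'; split.
  rewrite (pexp_brane_weight (open_free_energy F)) -ZF; apply/funext => eta.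
  rewrite (schur_expansion _ _ (inner_poly0 C) (@inner_amplitude C)).
  congr psum; apply/funext => mu; apply/funext => zeta; congr (_ * _).
  rewrite qdimE psize_conj /inner_poly horner_lconstM.
  (* The factor [t^(kappa mu)] of [inner_poly] raises the framing from [a] to [a + 1]. *)
  exact: lconst_expD (@qh_neq0 C).
rewrite (pexp_brane_weight (open_free_energy F')) -ZF'; apply/funext => eta.
rewrite (schur_expansion _ _ (outer_poly0 C) (@outer_amplitude C)).
by congr psum; apply/funext => mu; apply/funext => zeta; rewrite qdimE.
Qed.
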